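(* Let $b$ be a block idempotent of $\mathcal{O}G$ with defect group $D$, with source algebra $A=l\mathcal{O}Gl$ and with saturated fusion system $\mathcal{F}$ of $A$ on $D$. (i) If there is a normal subgroup $\tilde{D}$ of $D$ with $\mathrm{hyp}(\mathcal{F})\leq\tilde{D}$ such that, with $\bar D=D/\tilde D$, one has $\mathcal{F}_{D\times^{\bar{D}}D}=N_{\mathcal{F}_{D\times^{\bar{D}}D}}(D)$, then $A$ has a $D\times D$-stable unital basis. (ii) (The case $\tilde D=D$.) If $\mathcal{F}=N_{\mathcal{F}}(D)$, then $A$ has a $D\times D$-stable unital basis. (iii) If $b$ is a nilpotent block, then $A$ has a $D\times D$-stable unital basis.
   Context: $\mathcal{O}$ is a complete local noetherian commutative ring with identity whose residue field $k$ is algebraically closed of prime characteristic $p$. All $\mathcal{O}$-modules and $\mathcal{O}$-algebras are finitely generated and free over $\mathcal{O}$; algebras are unital. A basis of an $\mathcal{O}$-algebra is an $\mathcal{O}$-basis of the underlying module; it is unital if each of its elements is invertible. A basis is stable under a group acting on the algebra if it is permuted by the group. $G$ is a finite group with $p$ dividing $|G|$. Source algebra: $b$ is a primitive central idempotent of $\mathcal{O}G$ with defect group $D$ (a $p$-subgroup of $G$). For a $p$-subgroup $R$ of $G$, $\mathrm{Br}_R^{\mathcal{O}G}:(\mathcal{O}G)^R\to kC_G(R)$ is the Brauer homomorphism. Let $l\in(\mathcal{O}Gb)^D$ be a primitive idempotent with $\mathrm{Br}_D^{\mathcal{O}G}(l)\neq 0$; then $A=l\mathcal{O}Gl$ is a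 source algebra of $b$. The group $D\times D$ acts on $A$ by $(u,v)a=uav^{-1}$. Fusion system: for each $R\le D$ there is a unique block $e_R$ of $kC_G(R)$ with $\mathrm{Br}_R^{\mathcal{O}G}(l)e_R\ne0$. $\mathcal{F}$ is the saturated fusion system on $D$ whose objects are the subgroups of $D$ and whose morphisms $R_1\to R_2$ are the conjugation maps $c_g: u\mapsto gug^{-1}$, with $g\in G$, ${}^gR_1\le R_2$ and ${}^ge_{R_1}=e_{{}^gR_1}$ (equivalently ${}^g(R_1,e_{R_1})\le (R_2,e_{R_2})$ as Brauer pairs). The hyperfocal subgroup is $\mathrm{hyp}(\mathcal{F})=\langle u\varphi(u^{-1})\mid R\le D,\ u\in R,\ \varphi\in O^p(\mathrm{Aut}_{\mathcal{F}}(R))\rangle$, where $O^p(X)$ is the smallest normal subgroup of $X$ whose quotient is a $p$-group. The block $b$ is nilpotent if and only if $\mathrm{hyp}(\mathcal F)=1$ (equivalently, all morphisms of $\mathcal F$ are induced by conjugation in $D$). Subcategories: for $\tilde D\trianglelefteq D$ and $\bar D=D/\tilde D$ put $D\times^{\bar D}D=\{(u,v)\in D\times D\mid u\tilde D=v\tilde D\}$. For an injective homomorphism $\phi:R_1\to R_2$ between subgroups of $D$ let $\Delta(\phi)=\{(\phi(u),u)\mid u\in R_1\}$. The category $\mathcal{F}_{D\times^{\bar D}D}$ has the subgroups of $D$ as objects, and its morphisms $R_1\to R_2$ are the $\phi\in\mathrm{Hom}_{\mathcal F}(R_1,R_2)$ with $\Delta(\phi)\le D\times^{\bar D}D$. For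 a category $\mathcal{C}$ equal to $\mathcal{F}$ or to $\mathcal{F}_{D\times^{\bar D}D}$ and for $R\le D$, the category $N_{\mathcal{C}}(R)$ has the subgroups of $N_D(R)$ as objects, and its morphisms $R_1\to R_2$ are the morphisms $\phi:R_1\to R_2$ of $\mathcal{C}$ which extend to some morphism $\phi':RR_1\to RR_2$ of $\mathcal{C}$ with $\phi'(R)=R$. *)

(* Defs.v *)
From HB Require Import structures.
From mathcomp Require Import all_boot all_order all_fingroup all_algebra all_solvable.

Set Implicit Arguments.
Unset Strict Implicit.
Unset Printing Implicit Defensive.

Import GroupScope GRing.Theory.
Local Open Scope ring_scope.

(* Ideals are Prop-valued, so that "every ideal" is not restricted to
   decidable ones. *)

Section CommutativeRings.
Variable O : comNzRingType.
Implicit Types I J m : O -> Prop.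

Definition is_ideal I : Prop :=
  [/\ I 0, forall x y, I x -> I y -> I (x + y) & forall c x, I x -> I (c * x)].

Definition is_maximal_ideal m : Prop :=
  [/\ is_ideal m, ~ m 1 &
      forall I, is_ideal I -> (forall x, m x -> I x) -> ~ I 1 ->
      forall x, I x -> m x].

Definition is_local_with m : Prop :=
  is_maximal_ideal m /\
  (forall m', is_maximal_ideal m' -> forall x, m' x <-> m x).

Definition is_noetherian : Prop :=
  forall I, is_ideal I ->
  exists s : seq O, forall x,
    I x <-> exists c : 'I_(size s) -> O, x = \sum_i c i * s`_i.

Definition ideal_mul I J : O -> Prop := fun x =>
  exists s : seq (O * O),
    (forall q, q \in s -> I q.1 /\ J q.2) /\ x = \sum_(q <- s) q.1 * q.2.

Fixpoint ideal_pow I (n : nat) : O -> Prop :=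
  if n is n'.+1 then ideal_mul I (ideal_pow I n') else fun=> True.

(* "Complete" includes separated. *)
Definition is_adically_complete m : Prop :=
  (forall x, (forall n, ideal_pow m n x) -> x = 0) /\
  (forall u : nat -> O,
     (forall n, exists N, forall i j : nat,
        (N <= i)%N -> (N <= j)%N -> ideal_pow m n (u i - u j)) ->
     exists x, forall n, exists N, forall i : nat,
        (N <= i)%N -> ideal_pow m n (u i - x)).

End CommutativeRings.

(* The residue field is given up to isomorphism, as a field k with a surjective
   ring morphism res : O -> k whose kernel is the maximal ideal. *)
Record complete_local_base (p : nat) (O : comNzRingType) (k : fieldType)
    (res : {rmorphism O -> k}) : Prop := CompleteLocalBase {
  clb_surj : forall y : k, exists x : O, res x = y;
  clb_local : is_local_with (fun x : O => res x = 0);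
  clb_noetherian : is_noetherian O;
  clb_complete : is_adically_complete (fun x : O => res x = 0);
  clb_closed : GRing.closed_field_axiom k;
  clb_char : p \in [pchar k]
}.

(* The group algebra of the finite group formed by all of gT, with the convolution
   product.  It is a wrapper around {ffun gT -> R}, which already carries the
   pointwise operations. *)

Record galg (R : comNzRingType) (gT : finGroupType) : Type :=
  Galg { galg_ffun : {ffun gT -> R} }.

Section GroupAlgebra.
Variables (R : comNzRingType) (gT : finGroupType).
Implicit Types (a b c : galg R gT) (g h x y : gT).

HB.instance Definition _ := [isNew for @galg_ffun R gT].
HB.instance Definition _ := [Choice of galg R gT by <:].

Definition gcoef a : gT -> R := fun_of_fin (galg_ffun a).

Definition galg_mk (f : gT -> R) : galg R gT := Galg (finfun f).

Lemma gcoefE f g : gcoef (galg_mk f) g = f g.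
Proof. by rewrite /gcoef /galg_mk ffunE. Qed.

Lemma galgP a b : (forall g, gcoef a g = gcoef b g) <-> a = b.
Proof. by split=> [ab | -> //]; apply/val_inj/ffunP. Qed.

Definition galg_add a b := galg_mk (fun g => gcoef a g + gcoef b g).
Definition galg_opp a := galg_mk (fun g => - gcoef a g).
Definition galg_zero := galg_mk (fun=> 0).

Fact galg_addA : associative galg_add.
Proof. by move=> a b c; apply/galgP=> g; rewrite !gcoefE addrA. Qed.

Fact galg_addC : commutative galg_add.
Proof. by move=> a b; apply/galgP=> g; rewrite !gcoefE addrC. Qed.

Fact galg_add0 : left_id galg_zero galg_add.
Proof. by move=> a; apply/galgP=> g; rewrite !gcoefE add0r. Qed.

Fact galg_addN : left_inverse galg_zero galg_opp galg_add.
Proof. by move=> a; apply/galgP=> g; rewrite !gcoefE addNr. Qed.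

HB.instance Definition _ := GRing.isZmodule.Build (galg R gT)
  galg_addA galg_addC galg_add0 galg_addN.

Lemma gcoefD a b g : gcoef (a + b) g = gcoef a g + gcoef b g.
Proof. exact: gcoefE. Qed.

Lemma gcoef0 g : gcoef 0 g = 0.
Proof. exact: gcoefE. Qed.

Definition gelt g : galg R gT := galg_mk (fun h => (h == g)%:R).

Definition galg_mul a b : galg R gT :=
  galg_mk (fun g => \sum_h gcoef a h * gcoef b (h^-1 * g)%g).

Fact galg_mulA : associative galg_mul.
Proof.
move=> a b c; apply/galgP=> g; rewrite !gcoefE.
under eq_bigr => h _ do rewrite gcoefE mulr_sumr.
under [RHS]eq_bigr => h _ do rewrite gcoefE mulr_suml.
rewrite [RHS]exchange_big /=; apply: eq_bigr => h _.
rewrite [RHS](reindex_inj (mulgI h)) /=; apply: eq_bigr => x _.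
by rewrite mulKg invMg !mulrA -mulgA.
Qed.

Fact galg_mul1l : left_id (gelt 1%g) galg_mul.
Proof.
move=> a; apply/galgP=> g; rewrite gcoefE (bigD1 1%g) //= gcoefE eqxx mul1r.
rewrite invg1 mul1g big1 ?addr0 // => h h1.
by rewrite gcoefE (negPf h1) mul0r.
Qed.

Fact galg_mul1r : right_id (gelt 1%g) galg_mul.
Proof.
move=> a; apply/galgP=> g; rewrite gcoefE (bigD1 g) //= mulVg gcoefE eqxx mulr1.
rewrite big1 ?addr0 // => h hg.
by rewrite gcoefE -eq_mulVg1 (negPf hg) mulr0.
Qed.

Fact galg_mulDl : left_distributive galg_mul +%R.
Proof.
move=> a b c; apply/galgP=> g; rewrite gcoefD !gcoefE -big_split /=.
by apply: eq_bigr => h _; rewrite gcoefD mulrDl.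
Qed.

Fact galg_mulDr : right_distributive galg_mul +%R.
Proof.
move=> a b c; apply/galgP=> g; rewrite gcoefD !gcoefE -big_split /=.
by apply: eq_bigr => h _; rewrite gcoefD mulrDr.
Qed.

Fact galg_1neq0 : gelt 1%g != 0.
Proof.
apply/eqP=> /galgP/(_ 1%g); rewrite gcoefE gcoef0 eqxx.
by apply/eqP; exact: oner_neq0.
Qed.

HB.instance Definition _ := GRing.Zmodule_isNzRing.Build (galg R gT)
  galg_mulA galg_mul1l galg_mul1r galg_mulDl galg_mulDr galg_1neq0.

Definition galg_scale (r : R) a : galg R gT := galg_mk (fun g => r * gcoef a g).

Fact galg_scaleA r s a : galg_scale r (galg_scale s a) = galg_scale (r * s) a.
Proof. by apply/galgP=> g; rewrite !gcoefE mulrA. Qed.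

Fact galg_scale1 : left_id 1 galg_scale.
Proof. by move=> a; apply/galgP=> g; rewrite gcoefE mul1r. Qed.

Fact galg_scaleDr : right_distributive galg_scale +%R.
Proof. by move=> r a b; apply/galgP=> g; rewrite gcoefD !gcoefE mulrDr. Qed.

Fact galg_scaleDl a : {morph galg_scale^~ a : r s / r + s}.
Proof. by move=> r s; apply/galgP=> g; rewrite gcoefD !gcoefE mulrDl. Qed.

HB.instance Definition _ := GRing.Zmodule_isLmodule.Build R (galg R gT)
  galg_scaleA galg_scale1 galg_scaleDr galg_scaleDl.

Fact galg_scaleAl r a b : r *: (a * b) = r *: a * b.
Proof.
apply/galgP=> g; rewrite !gcoefE mulr_sumr.
by apply: eq_bigr => h _; rewrite gcoefE mulrA.
Qed.

HB.instance Definition _ :=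
  GRing.Lmodule_isLalgebra.Build R (galg R gT) galg_scaleAl.

Fact galg_scaleAr r a b : r *: (a * b) = a * (r *: b).
Proof.
apply/galgP=> g; rewrite !gcoefE mulr_sumr.
by apply: eq_bigr => h _; rewrite gcoefE mulrCA.
Qed.

HB.instance Definition _ :=
  GRing.Lalgebra_isAlgebra.Build R (galg R gT) galg_scaleAr.

(* Left conjugation g a g^-1, written ^g a on paper. *)
Definition gconj g a : galg R gT := gelt g * a * gelt g^-1%g.

Lemma geltM g h : gelt g * gelt h = gelt (g * h)%g.
Proof.
apply/galgP=> x; rewrite gcoefE (bigD1 g) //= !gcoefE eqxx mul1r.
rewrite big1 ?addr0 => [|y yg]; last by rewrite gcoefE (negPf yg) mul0r.
by rewrite -(inj_eq (mulgI g)) mulKVg.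
Qed.

Lemma gconj1 a : gconj 1%g a = a.
Proof. by rewrite /gconj invg1 (_ : gelt 1%g = 1) ?mul1r ?mulr1. Qed.

Lemma gconjM g h a : gconj (g * h)%g a = gconj g (gconj h a).
Proof. by rewrite /gconj invMg -!geltM !mulrA. Qed.

(* Subrings of the group algebra are represented by Prop-valued predicates.
   RH, for a subgroup H, consists of the elements with support in H. *)
Definition in_subalg (H : {group gT}) a : Prop :=
  forall g, g \notin H -> gcoef a g = 0.

Definition fixed_by (Q : {group gT}) a : Prop :=
  forall u, u \in Q -> gconj u a = a.

Definition is_idempotent a : Prop := a * a = a.

Definition primitive_idempotent_in (S : galg R gT -> Prop) e : Prop :=
  [/\ S e, is_idempotent e, e != 0 &
      forall e1 e2, S e1 -> S e2 -> is_idempotent e1 -> is_idempotent e2 ->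
        e1 * e2 = 0 -> e2 * e1 = 0 -> e = e1 + e2 -> e1 = 0 \/ e2 = 0].

Definition in_center_of (H : {group gT}) a : Prop :=
  in_subalg H a /\ (forall c, in_subalg H c -> a * c = c * a).

Definition is_block (H : {group gT}) e : Prop :=
  primitive_idempotent_in (in_center_of H) e.

(* The relative trace Tr_Q^H; for a fixed by Q it does not depend on the choice
   of the coset representatives. *)
Definition rel_trace (Q H : {group gT}) a : galg R gT :=
  \sum_(X in lcosets Q H) gconj (repr X) a.

Definition is_trace_from (Q : {group gT}) b : Prop :=
  exists a, fixed_by Q a /\ b = rel_trace Q [set: gT]%G a.

Definition is_defect_group b (D : {group gT}) : Prop :=
  is_trace_from D b /\
  (forall Q : {group gT}, Q \subset D -> is_trace_from Q b -> Q = D).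

Definition in_corner (l a : galg R gT) : Prop := exists c, a = l * c * l.

(* A finite family is used as basis; the unit of l (RG) l is l. *)
Definition is_basis_of_corner (l : galg R gT) n (X : n.-tuple (galg R gT)) : Prop :=
  [/\ forall i, in_corner l (tnth X i),
      forall c : 'I_n -> R, \sum_i c i *: tnth X i = 0 -> forall i, c i = 0 &
      forall a, in_corner l a ->
        exists c : 'I_n -> R, a = \sum_i c i *: tnth X i].

Definition invertible_in_corner (l x : galg R gT) : Prop :=
  in_corner l x /\ exists y : galg R gT, [/\ in_corner l y, x * y = l & y * x = l].

Definition has_stable_unital_basis (D : {group gT}) (l : galg R gT) : Prop :=
  exists n, exists X : n.-tuple (galg R gT),
    [/\ is_basis_of_corner l X,
        forall i, invertible_in_corner l (tnth X i) &
        forall (u v : gT) (x : galg R gT), u \in D -> v \in D -> x \in X ->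
          gelt u * x * gelt v^-1%g \in X].

End GroupAlgebra.

Section BrauerAndSource.
Variables (O : comNzRingType) (k : fieldType) (res : {rmorphism O -> k}).
Variable gT : finGroupType.

(* Br_Q is defined here on all of OG, but is meant for Q-fixed elements, where
   it is an algebra morphism to kC_G(Q). *)
Definition brauer (Q : {group gT}) (a : galg O gT) : galg k gT :=
  galg_mk (fun g => if g \in 'C(Q)%g then res (gcoef a g) else 0).

Definition is_source_idempotent (b : galg O gT) (D : {group gT})
    (l : galg O gT) : Prop :=
  primitive_idempotent_in
    (fun a => (exists c, a = c * b) /\ fixed_by D a) l /\
  brauer D l != 0.

(* e R is the block of kC_G(R) determined by l, for every subgroup R of D;
   the values of e at other subgroups are never used. *)
Definition is_block_choice (D : {group gT}) (l : galg O gT)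
    (e : {group gT} -> galg k gT) : Prop :=
  forall Q : {group gT}, Q \subset D ->
    is_block 'C(Q)%G (e Q) /\ brauer Q l * e Q != 0.

End BrauerAndSource.

Section Fusion.
Variable gT : finGroupType.

(* A category whose objects are subgroups of gT and whose morphisms from R1 to
   R2 are maps between these subgroups; such a map is represented by any
   function on gT that coincides with it on R1. *)
Record subgroup_cat := SubgroupCat {
  cat_ob : {group gT} -> Prop;
  cat_hom : {group gT} -> {group gT} -> (gT -> gT) -> Prop
}.

Definition cat_eq (C1 C2 : subgroup_cat) : Prop :=
  (forall Q, cat_ob C1 Q <-> cat_ob C2 Q) /\
  (forall Q1 Q2 phi, cat_ob C1 Q1 -> cat_ob C1 Q2 ->
     (cat_hom C1 Q1 Q2 phi <-> cat_hom C2 Q1 Q2 phi)).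

(* N_C(Q), for C a category on the subgroups of D and Q a subgroup of D.  Since
   Q1 normalises Q, the join Q <*> Q1 is the product Q Q1. *)
Definition normalizer_cat (D : {group gT}) (C : subgroup_cat) (Q : {group gT}) :
    subgroup_cat :=
  SubgroupCat
    (fun Q1 => Q1 \subset 'N_D(Q)%g)
    (fun Q1 Q2 phi =>
       [/\ Q1 \subset 'N_D(Q)%g, Q2 \subset 'N_D(Q)%g, cat_hom C Q1 Q2 phi &
           exists phi' : gT -> gT,
             [/\ cat_hom C (Q <*> Q1)%G (Q <*> Q2)%G phi',
                 {in Q1, phi' =1 phi} & phi' @: Q = Q]]).

(* The smallest normal subgroup whose quotient is a p-group. *)
Definition p_residual (p : nat) (hT : finGroupType) (H : {set hT}) : {set hT} :=
  \bigcap_(N : {group hT} | (N <| H)%g && p.-group (H / N)%g) N.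

Variables (k : fieldType) (D : {group gT}) (e : {group gT} -> galg k gT).

(* In MathComp u ^ x is x^-1 u x, so c_g(u) = g u g^-1 is u ^ g^-1, and
   ^g Q is Q :^ g^-1. *)
Definition fusion_hom (Q1 Q2 : {group gT}) (phi : gT -> gT) : bool :=
  [&& Q1 \subset D, Q2 \subset D &
      [exists g : gT,
        [&& (Q1 :^ g^-1)%g \subset Q2,
            gconj g (e Q1) == e (Q1 :^ g^-1)%G &
            [forall u in Q1, phi u == (u ^ g^-1)%g]]]].

Definition fusion_cat : subgroup_cat :=
  SubgroupCat (fun Q => Q \subset D) (fun Q1 Q2 phi => fusion_hom Q1 Q2 phi).

(* The group of automorphisms of Q in the fusion system; Aut Q consists of
   permutations of gT which are trivial outside Q. *)
Definition fusion_aut (Q : {group gT}) : {set {perm gT}} :=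
  [set a in Aut Q | fusion_hom Q Q a].

Fact fusion_aut_group_set (Q : {group gT}) :
  Q \subset D -> group_set (fusion_aut Q).
Proof.
move=> sQD; apply/group_setP; split.
  rewrite inE group1 /fusion_hom sQD /=; apply/existsP; exists 1%g.
  rewrite (_ : (Q :^ 1^-1)%G = Q) ?gconj1 ?eqxx; last first.
    by apply/val_inj; rewrite /= invg1 conjsg1.
  rewrite /= invg1 conjsg1 subxx /=.
  by apply/forall_inP=> u _; rewrite perm1 conjg1.
have fE x : (x \in fusion_aut Q) = (x \in Aut Q) && fusion_hom Q Q x.
  by rewrite inE.
move=> a c; rewrite !fE /fusion_hom sQD /=.
move=> /andP[Aa /existsP[g /and3P[sg /eqP eg /forall_inP ag]]].
move=> /andP[Ac /existsP[h /and3P[sh /eqP eh /forall_inP ch]]].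
have Qg : (Q :^ g^-1)%G = Q.
  by apply/val_inj/eqP; rewrite /= eqEcard sg cardJg leqnn.
have Qh : (Q :^ h^-1)%G = Q.
  by apply/val_inj/eqP; rewrite /= eqEcard sh cardJg leqnn.
have Qhg : (Q :^ (h * g)^-1)%G = Q.
  apply/val_inj; rewrite /= invMg conjsgM.
  by rewrite (congr1 val Qg : (Q :^ g^-1 = Q)%g) (congr1 val Qh : (Q :^ h^-1 = Q)%g).
rewrite groupM //=; apply/existsP; exists (h * g)%g; apply/and3P; split.
- by rewrite (congr1 val Qhg : (Q :^ (h * g)^-1 = Q)%g).
- by rewrite gconjM eg Qg eh Qh Qhg.
apply/forall_inP=> u uQ; rewrite permM (eqP (ch _ _)) ?(eqP (ag _ uQ)).
  by rewrite -conjgM invMg.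
by rewrite (subsetP sg) // memJ_conjg.
Qed.

Definition hyperfocal (p : nat) : {set gT} :=
  <<\bigcup_(Q : {group gT} | Q \subset D)
      [set (u * (a : {perm gT}) u^-1)%g |
         u in Q, a in p_residual p (fusion_aut Q)]>>%g.

Definition is_nilpotent_fusion (p : nat) : Prop := hyperfocal p = 1%g.

(* D x^(D/Dt) D *)
Definition fibre_product (Dt : {group gT}) : {set gT * gT} :=
  [set w in setX D D | (w.1 *: Dt == w.2 *: Dt)%g].

Definition graph_of (Q1 : {group gT}) (phi : gT -> gT) : {set gT * gT} :=
  [set (phi u, u) | u in Q1].

Definition fibre_fusion_cat (Dt : {group gT}) : subgroup_cat :=
  SubgroupCat (fun Q => Q \subset D)
    (fun Q1 Q2 phi =>
       fusion_hom Q1 Q2 phi /\ graph_of Q1 phi \subset fibre_product Dt).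

End Fusion.

(* Main.v *)
Require Import Defs.
From HB Require Import structures.
From mathcomp Require Import all_boot all_order all_fingroup all_algebra all_solvable.
From mathcomp Require Import ring.
From Stdlib Require Import Classical.

(** Write c_g for the map u |-> gug^-1.  The proof has three parts.

A stable basis exists for a soft reason.  Every g in G is lgl + (g - lgl), so the
multilinearity of the determinant writes 1 as the sum, over all subsets S of G, of
the determinants of the families made of lgl for g in S and of g - lgl for the other g
[sum_det_cut].  Over k this sum is invariant under the p-group D x D, hence it equals
the part of it indexed by the D x D-stable subsets S, and one of these has an
invertible determinant [stable_cut].  For such an S the elements lgl with g in S form
a D x D-stable basis of A.  They need not be invertible.  But the coordinate form dual
to lgl in this basis is invariant under the stabiliser of g, and the Brauer map at
Q = D meet D^g therefore does not kill the product of the g^-1-conjugate of l and l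
[cut_local]; by the uniqueness of the blocks e Q this says that c_g is a morphism of
the fusion system on Q [basis_of_extension].

Suppose that every such c_g extends to the automorphism c_h of D given by some h in
the stabiliser of (D, e D).  The block e D of kC(D) has one isomorphism class of
primitive idempotents [all_linked]; as l and its h-conjugate are determined up to
isomorphism by their images in kC(D), they are isomorphic in (kG)^D
[source_conjugate], and lifting an isomorphism to OG gives a unit a_g of A which satisfies
a_g v = c_g(v) a_g for v in Q.  The units a_g can be chosen compatibly with the action of D x D
[equivariant_units], and lgl + t a_g, for a generic scalar t, is still a basis and
consists of units, since k is infinite [stable_unital_basis].

It remains to extend fusion maps to D.  In (ii) this is the hypothesis.  If hyp(F) lies
in a normal subgroup Dt of D, then every fusion map agrees modulo Dt with conjugation
by an element of D [fusion_mod].  This is Alperin's fusion theorem modulo Dt: moving a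
subgroup to a position where a defect group T of its pair lies in D, and extending maps
to normalisers, one is reduced to the stabiliser of a pair (R, e R).  That stabiliser is
generated by T, C(R) and p'-elements [index_coprime], and the p'-elements move the
elements of R within cosets of Dt by the definition of the hyperfocal subgroup.
So c_g becomes, after composition with an inner automorphism of D, a morphism of the
subcategory of (i), and extends to D by hypothesis.  For (iii) take Dt = 1: then c_g is
itself conjugation by an element of D.

The local theory used here rests on two facts.  In the corner of a primitive idempotent
of a finite-dimensional algebra every element is nilpotent or invertible
[primitive_dichotomy].  If e is a relative trace from P of elements of the ideal of j,
then every primitive idempotent i below e which survives the Brauer map at T is a
multiple xj'y of a conjugate j' of j whose group contains T [trace_local]; the existence
and conjugacy of defect groups, and the embedding of Brauer pairs into (D, e D), are
instances of it. *)

Module StableBases.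

Set Implicit Arguments.
Unset Strict Implicit.
Unset Printing Implicit Defensive.

Import GroupScope GRing.Theory.
Local Open Scope ring_scope.

(** * Group algebras: coefficients, conjugation, fixed elements *)

Section Coefficients.
Variables (R : comNzRingType) (gT : finGroupType).
Implicit Types (a b c : galg R gT) (g h u x y : gT).

Lemma gcoefN a g : gcoef (- a) g = - gcoef a g.
Proof. by rewrite {1}/gcoef [galg_ffun (- a)]/= ffunE. Qed.

Lemma gcoefB a b g : gcoef (a - b) g = gcoef a g - gcoef b g.
Proof. by rewrite gcoefD gcoefN. Qed.

Lemma gcoefZ r a g : gcoef (r *: a) g = r * gcoef a g.
Proof. exact: gcoefE. Qed.

Lemma gcoef_sum I (s : seq I) (P : pred I) (F : I -> galg R gT) g :
  gcoef (\sum_(i <- s | P i) F i) g = \sum_(i <- s | P i) gcoef (F i) g.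
Proof.
exact: (big_morph (fun a => gcoef a g) (fun a b => gcoefD a b g) (gcoef0 _ g)).
Qed.

Lemma gcoefM a b g :
  gcoef (a * b) g = \sum_h gcoef a h * gcoef b (h^-1 * g)%g.
Proof. exact: gcoefE. Qed.

Lemma gcoef_gelt g h : gcoef (gelt R g) h = (h == g)%:R.
Proof. exact: gcoefE. Qed.

Lemma gelt1 : gelt R (1%g : gT) = 1.
Proof. by []. Qed.

Lemma gcoef_gelt_mul u a g : gcoef (gelt R u * a) g = gcoef a (u^-1 * g)%g.
Proof.
rewrite gcoefM (bigD1 u) //= gcoef_gelt eqxx mul1r big1 ?addr0 // => h hu.
by rewrite gcoef_gelt (negPf hu) mul0r.
Qed.

Lemma gcoef_mul_gelt a u g : gcoef (a * gelt R u) g = gcoef a (g * u^-1)%g.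
Proof.
rewrite gcoefM (bigD1 (g * u^-1)%g) //= gcoef_gelt invMg invgK mulgKV eqxx.
rewrite mulr1 big1 ?addr0 // => h hu; rewrite gcoef_gelt.
case: eqP => [E|]; last by rewrite mulr0.
by case/eqP: hu; rewrite -E invMg invgK mulKVg.
Qed.

Lemma gcoef_gconj g a x : gcoef (gconj g a) x = gcoef a (x ^ g)%g.
Proof. by rewrite /gconj gcoef_mul_gelt gcoef_gelt_mul invgK conjgE mulgA. Qed.

Lemma gelt_mulV g : gelt R g * gelt R g^-1%g = 1.
Proof. by rewrite geltM mulgV. Qed.

Lemma gelt_Vmul g : gelt R g^-1%g * gelt R g = 1.
Proof. by rewrite geltM mulVg. Qed.

Lemma galg_expand a : a = \sum_g gcoef a g *: gelt R g.
Proof.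
apply/galgP=> x; rewrite gcoef_sum (bigD1 x) //= gcoefZ gcoef_gelt eqxx mulr1.
rewrite big1 ?addr0 // => g gx.
by rewrite gcoefZ gcoef_gelt eq_sym (negPf gx) mulr0.
Qed.

Fact gconj_is_zmod_morphism g : zmod_morphism (@gconj R gT g).
Proof. by move=> a b; rewrite /gconj mulrBr mulrBl. Qed.

HB.instance Definition _ g :=
  GRing.isZmodMorphism.Build _ _ (@gconj R gT g) (gconj_is_zmod_morphism g).

Lemma gconjZ g r a : gconj g (r *: a) = r *: gconj g a.
Proof. by rewrite /gconj -scalerAr -scalerAl. Qed.

Fact gconj_is_monoid_morphism g : monoid_morphism (@gconj R gT g).
Proof.
split=> [|a b]; first by rewrite /gconj mulr1 gelt_mulV.
by rewrite /gconj !mulrA -(mulrA _ (gelt R g^-1)) gelt_Vmul mulr1.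
Qed.

HB.instance Definition _ g :=
  GRing.isMonoidMorphism.Build _ _ (@gconj R gT g) (gconj_is_monoid_morphism g).

Lemma gconj_gelt g x : gconj g (gelt R x) = gelt R (x ^ g^-1)%g.
Proof. by rewrite /gconj !geltM conjgE invgK mulgA. Qed.

Lemma gconjK g : cancel (@gconj R gT g) (gconj g^-1%g).
Proof. by move=> a; rewrite -gconjM mulVg gconj1. Qed.

Lemma gconjKV g : cancel (gconj g^-1%g) (@gconj R gT g).
Proof. by move=> a; rewrite -gconjM mulgV gconj1. Qed.

Lemma gconj_inj g : injective (@gconj R gT g).
Proof. exact: can_inj (gconjK g). Qed.

Lemma gelt_gconj g a : gelt R g * a = gconj g a * gelt R g.
Proof. by rewrite /gconj -mulrA gelt_Vmul mulr1. Qed.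

Lemma gconj_id_comm g a : gconj g a = a <-> gelt R g * a = a * gelt R g.
Proof.
split=> [E | E]; first by rewrite gelt_gconj E.
by rewrite /gconj E -mulrA gelt_mulV mulr1.
Qed.

End Coefficients.

(** A subset closed under the operations of a possibly non-unital algebra; the
unit of the corners considered below is an idempotent of the subset. *)
Record is_subalg (k : comNzRingType) (gT : finGroupType)
    (S : galg k gT -> Prop) : Prop := IsSubalg {
  subalgD : forall a b, S a -> S b -> S (a + b);
  subalgZ : forall r a, S a -> S (r *: a);
  subalgM : forall a b, S a -> S b -> S (a * b)
}.

Section FixedElements.
Variables (R : comNzRingType) (gT : finGroupType).
Implicit Types (a b c : galg R gT) (g h u x y : gT) (C H P Q T : {group gT}).
Implicit Types S : galg R gT -> Prop.

(** This is (RC)^T.  It covers the centre of RC, for T = C, and (RG)^T, for C the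
centraliser of the trivial group. *)
Definition sfix C T a : Prop := in_subalg C a /\ fixed_by T a.

Lemma fixed_byP T a :
  fixed_by T a <-> forall u g, u \in T -> gcoef a (g ^ u)%g = gcoef a g.
Proof.
split=> [fa u g uT | fa u uT]; first by rewrite -gcoef_gconj fa.
by apply/galgP=> x; rewrite gcoef_gconj fa.
Qed.

Lemma fixed_byS H T a : H \subset T -> fixed_by T a -> fixed_by H a.
Proof. by move=> /subsetP sHT fa u /sHT; apply: fa. Qed.

Lemma fixed_by1 T : fixed_by T (1 : galg R gT).
Proof. by move=> u _; rewrite rmorph1. Qed.

Lemma fixed_subalg T : is_subalg (@fixed_by R gT T).
Proof.
split=> [a b fa fb | r a fa | a b fa fb] u uT.
- by rewrite raddfD /= fa ?fb.
- by rewrite gconjZ fa.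
- by rewrite rmorphM /= fa ?fb.
Qed.

Lemma in_subalg1 H : in_subalg H (1 : galg R gT).
Proof. by move=> g gH; rewrite gcoef_gelt; case: eqP gH => // ->; rewrite group1. Qed.

Lemma in_subalg_subalg H : is_subalg (@in_subalg R gT H).
Proof.
split=> [a b fa fb | r a fa | a b fa fb] g gH.
- by rewrite gcoefD fa ?fb ?addr0.
- by rewrite gcoefZ fa ?mulr0.
rewrite gcoefM big1 // => h _; have [hH|hH] := boolP (h \in H); last by rewrite fa ?mul0r.
by rewrite fb ?mulr0 // groupMl ?groupV.
Qed.

Lemma in_subalg_gelt H h : h \in H -> in_subalg H (gelt R h).
Proof. by move=> hH g gH; rewrite gcoef_gelt; case: eqP gH => // ->; rewrite hH. Qed.

Lemma in_subalgS H P a : H \subset P -> in_subalg H a -> in_subalg P a.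
Proof. by move=> /subsetP sHP fa g gP; apply: fa; apply: contra gP; apply: sHP. Qed.

Lemma in_subalgT a : in_subalg [set: gT] a.
Proof. by move=> g; rewrite inE. Qed.

Lemma in_subalg_gconj H g a :
  in_subalg H a -> in_subalg (H :^ g^-1)%G (gconj g a).
Proof.
move=> fa x xH; rewrite gcoef_gconj fa //; apply: contra xH => xH.
by rewrite /= mem_conjgV.
Qed.

Lemma in_subalg_norm H g a : g \in 'N(H) -> in_subalg H a -> in_subalg H (gconj g a).
Proof.
move=> gN fa x xH; rewrite gcoef_gconj fa //; apply: contra xH.
by rewrite memJ_norm.
Qed.

Lemma fixed_by_gconj T g a :
  fixed_by T a -> fixed_by (T :^ g^-1)%G (gconj g a).
Proof.
move=> fa u; rewrite /= mem_conjgV => uT.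
rewrite -gconjM -{2}(fa _ uT) -gconjM; congr (gconj _ a).
by rewrite conjgE !mulgA mulgV mul1g.
Qed.

Lemma sfix_gconj C T g a : sfix C T a -> sfix (C :^ g^-1)%G (T :^ g^-1)%G (gconj g a).
Proof. by case=> ? ?; split; [apply: in_subalg_gconj | apply: fixed_by_gconj]. Qed.

Lemma subalgI S1 S2 : is_subalg S1 -> is_subalg S2 ->
  is_subalg (fun a => S1 a /\ S2 a).
Proof.
move=> s1 s2; split=> [a b [a1 a2] [b1 b2] | r a [a1 a2] | a b [a1 a2] [b1 b2]].
- by split; [apply: (subalgD s1) | apply: (subalgD s2)].
- by split; [apply: (subalgZ s1) | apply: (subalgZ s2)].
- by split; [apply: (subalgM s1) | apply: (subalgM s2)].
Qed.

Lemma sfix_subalg C T : is_subalg (sfix C T).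
Proof. by apply: subalgI; [apply: in_subalg_subalg | apply: fixed_subalg]. Qed.

Lemma sfix1 C T : sfix C T (1 : galg R gT).
Proof. by split; [apply: in_subalg1 | apply: fixed_by1]. Qed.

Lemma subalgN S : is_subalg S -> forall a, S a -> S (- a).
Proof. by move=> sS a Sa; rewrite -scaleN1r; apply: (subalgZ sS). Qed.

Lemma subalgB S : is_subalg S -> forall a b, S a -> S b -> S (a - b).
Proof. by move=> sS a b Sa Sb; apply: (subalgD sS) => //; apply: subalgN. Qed.

Lemma subalg_sum S (sS : is_subalg S) I (s : seq I) (P : pred I) F :
  S 0 -> (forall i, P i -> S (F i)) -> S (\sum_(i <- s | P i) F i).
Proof. by move=> S0 SF; apply: big_ind => //; apply: subalgD sS. Qed.

Lemma comm_of_fixed H a b : fixed_by H a -> in_subalg H b -> a * b = b * a.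
Proof.
move=> fa sb; rewrite [b]galg_expand mulr_sumr mulr_suml; apply: eq_bigr => g _.
have [gH|gH] := boolP (g \in H); last by rewrite sb // !scale0r mulr0 mul0r.
by rewrite -scalerAr -scalerAl; congr (_ *: _); apply/esym/gconj_id_comm/fa.
Qed.

(** Commuting with the elements of H is commuting with their linear combinations. *)
Lemma in_centerP H a : in_center_of H a <-> sfix H H a.
Proof.
split=> -[sa fa]; split=> //; last by move=> c sc; apply: comm_of_fixed fa sc.
by move=> u uH; apply/gconj_id_comm; rewrite fa //; apply: in_subalg_gelt.
Qed.

Lemma primitive_eq S1 S2 e : (forall a, S1 a <-> S2 a) ->
  primitive_idempotent_in S1 e -> primitive_idempotent_in S2 e.
Proof.
move=> S12 [Se ee e0 prim]; split=> //; first exact/S12.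
by move=> e1 e2 /S12 s1 /S12 s2; apply: prim.
Qed.

Lemma blockP H f : is_block H f <-> primitive_idempotent_in (sfix H H) f.
Proof.
split; apply: primitive_eq => a; first exact: in_centerP.
by split=> ?; apply/in_centerP.
Qed.

Lemma mem_repr_lcoset (T : {group gT}) h : repr (h *: T)%g \in (h *: T)%g.
Proof. by apply: (mem_repr h); rewrite lcoset_refl. Qed.

Lemma gconj_repr T h a : fixed_by T a -> gconj (repr (h *: T)%g) a = gconj h a.
Proof.
by move=> fa; case/lcosetP: (mem_repr_lcoset T h) => t tT ->; rewrite gconjM fa.
Qed.

Lemma repr_lcosets T H X : X \in lcosets T H -> T \subset H ->
  repr X \in H /\ X = (repr X *: T)%g.
Proof.
move=> /lcosetsP[h hH ->] sTH.
case/lcosetP: (mem_repr_lcoset T h) => t tT ->.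
split; first by rewrite groupM // (subsetP sTH).
by rewrite lcosetM (lcoset_id tT).
Qed.

End FixedElements.

Section RelativeTrace.
Variables (R : comNzRingType) (gT : finGroupType).
Implicit Types (a b c : galg R gT) (g h u x y : gT) (C H P Q T : {group gT}).

Lemma lcosets_lmul T H u X : u \in H -> T \subset H ->
  ((u *: X)%g \in lcosets T H) = (X \in lcosets T H).
Proof.
move=> uH sTH.
have main v Y : v \in H -> Y \in lcosets T H -> (v *: Y)%g \in lcosets T H.
  move=> vH /lcosetsP[h hH ->]; apply/lcosetsP; exists (v * h)%g.
    by rewrite groupM.
  by rewrite lcosetM.
apply/idP/idP => [XH|]; last exact: main.
by have := main u^-1%g _ _ XH; rewrite groupV -lcosetM mulVg mul1g; apply.
Qed.

Lemma lcoset_bij u : bijective (fun X : {set gT} => (u *: X)%g).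
Proof.
by exists (fun X => (u^-1 *: X)%g) => X; rewrite -lcosetM ?mulVg ?mulgV mul1g.
Qed.

Lemma big_lcosets_shift (V : nmodType) T H u (F : {set gT} -> V) :
  u \in H -> T \subset H ->
  \sum_(X in lcosets T H) F X = \sum_(X in lcosets T H) F (u *: X)%g.
Proof.
move=> uH sTH; rewrite (reindex _ (onW_bij _ (lcoset_bij u))) /=.
by apply: eq_bigl => X; rewrite lcosets_lmul.
Qed.

Lemma gconj_repr_shift T H X u a : T \subset H -> X \in lcosets T H ->
  fixed_by T a -> gconj (repr (u *: X)%g) a = gconj u (gconj (repr X) a).
Proof.
move=> sTH /repr_lcosets/(_ sTH)[_ E] fa.
by rewrite {1}E -lcosetM gconj_repr // gconjM.
Qed.

Lemma rel_trace_fixed T H a :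
  T \subset H -> fixed_by T a -> fixed_by H (rel_trace T H a).
Proof.
move=> sTH fa u uH; rewrite raddf_sum /= /rel_trace [RHS](big_lcosets_shift _ uH) //.
by apply: eq_bigr => X XH; rewrite (gconj_repr_shift _ sTH).
Qed.

Lemma rel_traceD T H a b : rel_trace T H (a + b) = rel_trace T H a + rel_trace T H b.
Proof. by rewrite /rel_trace -big_split; apply: eq_bigr => X _; rewrite raddfD. Qed.

Lemma rel_traceZ T H r a : rel_trace T H (r *: a) = r *: rel_trace T H a.
Proof. by rewrite /rel_trace scaler_sumr; apply: eq_bigr => X _; rewrite gconjZ. Qed.

Lemma rel_trace_mulr T H a b : T \subset H -> fixed_by H b ->
  rel_trace T H (a * b) = rel_trace T H a * b.
Proof.
move=> sTH fb; rewrite /rel_trace mulr_suml; apply: eq_bigr => X XH.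
by rewrite rmorphM /= [X in _ * X]fb //; case: (repr_lcosets XH sTH).
Qed.

Lemma rel_trace_mull T H a b : T \subset H -> fixed_by H b ->
  rel_trace T H (b * a) = b * rel_trace T H a.
Proof.
move=> sTH fb; rewrite /rel_trace mulr_sumr; apply: eq_bigr => X XH.
by rewrite rmorphM /= [X in X * _]fb //; case: (repr_lcosets XH sTH).
Qed.

Lemma rel_trace_const T H a : T \subset H -> fixed_by H a ->
  rel_trace T H a = a *+ #|H : T|.
Proof.
move=> sTH fa; rewrite /rel_trace (eq_bigr (fun=> a)) => [|X XH].
  by rewrite sumr_const card_lcosets.
by rewrite fa //; case: (repr_lcosets XH sTH).
Qed.

Lemma rel_trace_id H a : fixed_by H a -> rel_trace H H a = a.
Proof. by move=> fa; rewrite rel_trace_const // indexgg mulr1n. Qed.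

Lemma rel_trace_trans T P H a : T \subset P -> P \subset H -> fixed_by T a ->
  rel_trace T H a = rel_trace P H (rel_trace T P a).
Proof.
move=> sTP sPH fa; have sTH := subset_trans sTP sPH.
rewrite {1}/rel_trace (partition_big (fun X => (X * P)%g) (mem (lcosets P H))) /=.
  apply: eq_bigr => Y YH; case: (repr_lcosets YH sPH); set h := repr Y => hH E.
  rewrite raddf_sum /= (reindex _ (onW_bij _ (lcoset_bij h))) /=.
  apply: eq_big => [X | X /andP[XE _]].
    have shift x : ((h *: (x *: T)) * P == Y)%g = (x \in P).
      rewrite E -lcosetM -mulgA (mulSGid sTP).
      by apply/eqP/idP => [/lcoset_eqP | xP]; [|apply/lcoset_eqP];
        rewrite mem_lcoset mulKg.
    rewrite lcosets_lmul //; apply/andP/lcosetsP.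
      by move=> [/lcosetsP[x xH ->]]; rewrite shift => xP; exists x.
    move=> [x xP ->]; rewrite shift; split=> //.
    by apply/lcosetsP; exists x => //; apply: (subsetP sPH).
  by rewrite (gconj_repr_shift _ sTH) //; move: XE; rewrite lcosets_lmul.
move=> X XH; case: (repr_lcosets XH sTH) => hH E; apply/lcosetsP.
by exists (repr X) => //; rewrite {1}E -mulgA (mulSGid sTP).
Qed.

Lemma rel_trace_gconj T H g a : T \subset H -> fixed_by T a ->
  gconj g (rel_trace T H a) = rel_trace (T :^ g^-1)%G (H :^ g^-1)%G (gconj g a).
Proof.
move=> sTH fa; rewrite raddf_sum /= /rel_trace.
have fga := fixed_by_gconj (g := g) fa.
rewrite [RHS](reindex_inj (@conjsg_inj _ g^-1%g)) /=.
apply: eq_big => [X | X XH].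
  have lcJ v (A B : {group gT}) Y : Y \in lcosets A B ->
      (Y :^ v)%g \in lcosets (A :^ v)%g (B :^ v)%g.
    move=> /lcosetsP[x xB ->]; apply/lcosetsP; exists (x ^ v)%g.
      by rewrite memJ_conjg.
    by rewrite conjsMg conjg_set1.
  apply/idP/idP => [|XJ]; first exact: lcJ.
  by have := lcJ g (T :^ g^-1)%G (H :^ g^-1)%G _ XJ; rewrite !conjsgKV.
case: (repr_lcosets XH sTH) => hH E.
have -> : (X :^ g^-1 = (repr X ^ g^-1)%g *: (T :^ g^-1)%G)%g.
  by rewrite {1}E conjsMg conjg_set1.
rewrite gconj_repr // -!gconjM; congr (gconj _ a).
by rewrite conjgE invgK !mulgA mulgKV.
Qed.

End RelativeTrace.

(** * Primitive idempotents and local rings *)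

Section FixedPoints.

(** The orbits of a p-group outside its fixed points have sizes divisible by p. *)
Lemma sum_over_fixpoints (R : comNzRingType) (p : nat) (aT : finGroupType)
    (X : finType) (to : {action aT &-> X}) (P : {group aT}) (F : X -> R) :
  p \in [pchar R] -> (p.-group P)%g ->
  (forall x u, u \in P -> F (to x u) = F x) ->
  \sum_x F x = \sum_(x in 'Fix_to(P)) F x.
Proof.
move=> pR pP Finv; have p_pr := pcharf_prime pR.
rewrite (bigID (mem 'Fix_to(P))) /= -[RHS]addr0; congr (_ + _).
pose S := ~: 'Fix_to(P).
have actS : [acts P, on S | to].
  by rewrite astabsC; apply: acts_fix_norm (normG P).
rewrite (eq_bigl (mem S)) => [|x]; last by rewrite /= in_setC.
rewrite (set_partition_big _ (orbit_partition actS)) /= big1 // => O /imsetP[x xS ->].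
rewrite (eq_bigr (fun=> F x)) => [|y /orbitP[u uP <-]]; last exact: Finv.
rewrite sumr_const card_orbit.
have [[|n] E] := p_natP (pnat_dvd (dvdn_indexg P ('C_P[x | to])) pP).
  have /eqP := card_orbit to P x; rewrite E expn0 => /eqP/card_orbit1/orbit1P.
  by move=> xfix; rewrite in_setC xfix in xS.
by rewrite E expnS mulrnA (mulrn_pchar pR) mul0rn.
Qed.

End FixedPoints.

Section Corners.
Variables (k : fieldType) (gT : finGroupType).
Implicit Types (a b c e i j x y : galg k gT) (S : galg k gT -> Prop).
Implicit Types f q : {poly k}.

Definition nilpot a : Prop := exists n, a ^+ n.+1 = 0.

Definition corner S e a : Prop := [/\ S a, e * a = a & a * e = a].

Definition corner_unit S e a : Prop :=
  exists b, [/\ corner S e b, a * b = e & b * a = e].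

Definition grow a : 'rV[k]_#|gT| := \row_j gcoef a (enum_val j).

Lemma grow_inj : injective grow.
Proof.
move=> a b E; apply/galgP=> g.
by have /rowP/(_ (enum_rank g)) := E; rewrite !mxE enum_rankK.
Qed.

Fact grow_is_linear : linear grow.
Proof. by move=> r a b; apply/rowP=> j; rewrite !mxE gcoefD gcoefZ. Qed.

HB.instance Definition _ :=
  GRing.isLinear.Build k (galg k gT) 'rV[k]_#|gT| _ grow grow_is_linear.

Definition ungrow (v : 'rV[k]_#|gT|) : galg k gT :=
  galg_mk (fun g => v 0 (enum_rank g)).

Lemma growK : cancel grow ungrow.
Proof. by move=> a; apply/galgP=> g; rewrite gcoefE mxE enum_rankK. Qed.

Lemma ungrowK : cancel ungrow grow.
Proof. by move=> v; apply/rowP=> j; rewrite mxE gcoefE enum_valK. Qed.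

Fact ungrow_is_linear : linear ungrow.
Proof. by move=> r a b; apply/galgP=> g; rewrite gcoefD gcoefZ !gcoefE !mxE. Qed.

HB.instance Definition _ :=
  GRing.isLinear.Build k 'rV[k]_#|gT| (galg k gT) _ ungrow ungrow_is_linear.

(** Right multiplication, acting on coordinate rows, so that products keep their order;
the rank of rmat a is the dimension of the left ideal generated by a. *)
Definition rmat a : 'M[k]_#|gT| := lin1_mx (fun v => grow (ungrow v * a)).

Lemma grow_mul x a : grow (x * a) = grow x *m rmat a.
Proof.
have lin : linear (fun v => grow (ungrow v * a)).
  by move=> r u v; rewrite linearP /= mulrDl -scalerAl linearP.
pose L := GRing.isLinear.Build k _ _ _ _ lin.
pose f : {linear 'rV[k]_#|gT| -> 'rV[k]_#|gT|} := HB.pack (fun v => grow (ungrow v * a)) L.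
by have /= := mul_rV_lin1 f (grow x); rewrite growK => <-.
Qed.

Lemma rmatM a b : rmat (a * b) = rmat a *m rmat b.
Proof.
apply/row_matrixP=> i; rewrite !rowE mulmxA.
by rewrite -[delta_mx 0 i]ungrowK -!grow_mul mulrA.
Qed.

Lemma rmat0 : rmat 0 = 0.
Proof.
apply/row_matrixP=> i; rewrite !rowE mulmx0 -[delta_mx 0 i]ungrowK -grow_mul.
by rewrite mulr0 linear0.
Qed.

Lemma rmat_eq0 a : rmat a = 0 -> a = 0.
Proof.
move=> a0; apply: grow_inj; rewrite -[a in grow a]mul1r grow_mul a0 mulmx0.
by rewrite linear0.
Qed.

(** The first #|gT| + 1 powers of a are linearly dependent. *)
Lemma exists_annihilator a : exists2 f : {poly k}, f != 0 & horner_alg a f = 0.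
Proof.
pose n := #|gT|.
pose M : 'M[k]_(n.+1, n) := \matrix_(i < n.+1) grow (a ^+ i).
have : ~~ row_free M by rewrite /row_free neq_ltn ltnS rank_leq_col.
rewrite -kermx_eq0 => /rowV0Pn[v /sub_kermxP vM v0].
exists (rVpoly v).
  by apply: contra v0 => /eqP E; rewrite -[v]rVpolyK E linear0.
apply: grow_inj; rewrite linear0 -vM mulmx_sum_row.
rewrite /rVpoly poly_def !raddf_sum /=; apply: eq_bigr => i _.
rewrite rowK valK -mul_polyC rmorphM /= horner_algC rmorphXn /= horner_algX.
by rewrite mulr_algl linearZ.
Qed.

Section PolynomialsInCorner.
Variables (S : galg k gT -> Prop) (e a : galg k gT).
Hypotheses (sS : is_subalg S) (Se : S e) (ee : e * e = e) (aS : corner S e a).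

Lemma horner_corner_comm f : e * horner_alg a f = horner_alg a f * e.
Proof.
case: aS => _ ea ae; elim/poly_ind: f => [|f c IH]; first by rewrite rmorph0 mulr0 mul0r.
rewrite rmorphD rmorphM /= horner_algX horner_algC mulrDr mulrDl mulrA IH -!mulrA ea ae.
by rewrite -scalerAr -scalerAl mulr1 mul1r.
Qed.

Lemma horner_corner f : corner S e (e * horner_alg a f).
Proof.
have Se' : S (e * horner_alg a f).
  case: aS => Sa ea ae; elim/poly_ind: f => [|f c IH].
    by rewrite rmorph0 mulr0 -(scale0r e); apply: (subalgZ sS).
  rewrite rmorphD rmorphM /= horner_algX horner_algC mulrDr mulrA -scalerAr mulr1.
  by apply: (subalgD sS); [apply: (subalgM sS) | apply: (subalgZ sS)].
by split; rewrite // ?mulrA ?ee // -mulrA -horner_corner_comm mulrA ee.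
Qed.

Lemma horner_cornerM f q :
  e * horner_alg a f * (e * horner_alg a q) = e * horner_alg a (f * q).
Proof.
by rewrite rmorphM /= [e * horner_alg a f]horner_corner_comm !mulrA -(mulrA _ e e) ee -horner_corner_comm.
Qed.

End PolynomialsInCorner.
End Corners.

Section LocalCorners.
Variables (k : fieldType) (gT : finGroupType).
Implicit Types (a b c e i j x y : galg k gT) (S : galg k gT -> Prop).

Lemma nilp0 : nilpot (0 : galg k gT).
Proof. by exists 0%N; rewrite expr1. Qed.

Lemma nilp_idem a : a * a = a -> nilpot a -> a = 0.
Proof.
move=> aa [n]; elim: n => [|n IH]; first by rewrite expr1.
by rewrite !exprS mulrA aa -exprS.
Qed.

Lemma nilp_not_unit S e a :
  corner S e a -> e * e = e -> e <> 0 -> nilpot a -> ~ corner_unit S e a.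
Proof.
move=> [_ ea ae] ee e0 [n an] [b [[_ eb be] ab ba]]; apply: e0.
suff E m : a ^+ m.+1 * b ^+ m.+1 = e by rewrite -(E n) an mul0r.
elim: m => [|m IH]; first by rewrite !expr1.
by rewrite [a ^+ _]exprS [b ^+ _]exprSr mulrA -(mulrA a) IH ae.
Qed.

(** Fitting's lemma.  Let X^m g annihilate a, with g prime to X.  A Bezout relation
between X^(m+1) and g writes e as the sum of two orthogonal idempotents which are
polynomials in a, and primitivity makes one of them vanish: a is nilpotent if e is a
multiple of g(a), and invertible if e is a multiple of a^(m+1). *)
Lemma primitive_dichotomy S e a :
  is_subalg S -> primitive_idempotent_in S e -> corner S e a ->
  nilpot a \/ corner_unit S e a.
Proof.
move=> sS [Se ee e0 prim] aS; have [f f0 fa] := exists_annihilator a.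
have [m [g /implyP/(_ f0) g0 fE]] := multiplicity_XsubC f 0.
rewrite subr0 in fE.
have : coprimep ('X^(m.+1)) g.
  by apply: coprimep_expl; rewrite -['X]subr0 coprimep_sym coprimep_XsubC.
move=> /Bezout_eq1_coprimepP[[u v] /= uv1].
pose phi q := e * horner_alg a q.
have phiM q r : phi q * phi r = phi (q * r) by apply: (horner_cornerM ee aS).
have phiC q := horner_corner sS Se ee aS q.
have phiD q r : phi q + phi r = phi (q + r) by rewrite /phi rmorphD mulrDr.
have phi1 : phi 1 = e by rewrite /phi rmorph1 mulr1.
have phiX : phi 'X = a by case: aS => _ ea _; rewrite /phi /= horner_algX.
have phi_f r : phi (r * ('X^m * g)) = 0.
  by rewrite mulrC (mulrC _ g) -fE /phi rmorphM /= fa mul0r mulr0.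
have orth q r : phi (q * 'X^(m.+1)) * phi (r * g) = 0.
  rewrite phiM (_ : _ * _ = (q * r * 'X) * ('X^m * g)) // exprSr; ring.
have sum1 : phi (u * 'X^(m.+1)) + phi (v * g) = e by rewrite phiD uv1.
have orthC : phi (v * g) * phi (u * 'X^(m.+1)) = 0 by rewrite phiM mulrC -phiM.
have idem1 : is_idempotent (phi (u * 'X^(m.+1))).
  rewrite /is_idempotent -[LHS]addr0 -(orth u v) -mulrDr sum1.
  by case: (phiC (u * 'X^(m.+1))).
have idem2 : is_idempotent (phi (v * g)).
  rewrite /is_idempotent -[LHS]add0r -orthC -mulrDr sum1.
  by case: (phiC (v * g)).
case: (prim _ _ _ _ idem1 idem2 (orth u v) orthC (esym sum1)).
- by case: (phiC (u * 'X^(m.+1))).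
- by case: (phiC (v * g)).
- move=> z1; left; exists m; rewrite z1 add0r in sum1.
  have -> : a ^+ m.+1 = phi 'X^(m.+1).
    rewrite /phi rmorphXn /= horner_algX exprS mulrA.
    by case: aS => _ -> _.
  case: (phiC 'X^(m.+1)) => _ _; rewrite -/(phi _) => <-; rewrite -sum1 phiM.
  have -> : 'X^(m.+1) * (v * g) = 'X * v * ('X^m * g) by rewrite exprS; ring.
  exact: phi_f.
move=> z2; right; rewrite z2 addr0 in sum1; exists (phi (u * 'X^m)).
split; first exact: phiC.
  by rewrite -[X in X * _]phiX phiM mulrC -mulrA -exprSr.
by rewrite -[X in _ * X]phiX phiM -mulrA -exprSr.
Qed.

Lemma corner0 S e : is_subalg S -> S e -> corner S e 0.
Proof.
by move=> sS Se; split; rewrite ?mul0r ?mulr0 // -(scale0r e); apply: (subalgZ sS).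
Qed.

Lemma cornerD S e a b : is_subalg S -> corner S e a -> corner S e b -> corner S e (a + b).
Proof.
move=> sS [Sa ea ae] [Sb eb be]; split; first exact: (subalgD sS).
  by rewrite mulrDr ea eb.
by rewrite mulrDl ae be.
Qed.

Lemma cornerM S e a b : is_subalg S -> corner S e a -> corner S e b -> corner S e (a * b).
Proof.
move=> sS [Sa ea ae] [Sb eb be]; split; first exact: (subalgM sS).
  by rewrite mulrA ea.
by rewrite -mulrA be.
Qed.

Lemma cornerZ S e r a : is_subalg S -> corner S e a -> corner S e (r *: a).
Proof.
move=> sS [Sa ea ae]; split; first exact: (subalgZ sS).
  by rewrite -scalerAr ea.
by rewrite -scalerAl ae.
Qed.

Lemma cornerB S e a b : is_subalg S -> corner S e a -> corner S e b -> corner S e (a - b).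
Proof. by move=> sS aS bS; rewrite -scaleN1r; apply: cornerD => //; apply: cornerZ. Qed.

Lemma corner_cut S e a : is_subalg S -> S e -> e * e = e -> S a -> corner S e (e * a * e).
Proof.
move=> sS Se ee Sa; split; last by rewrite -mulrA ee.
  by apply: (subalgM sS) => //; apply: (subalgM sS).
by rewrite !mulrA ee.
Qed.

Section Local.
Variables (S : galg k gT -> Prop) (e : galg k gT).
Hypotheses (sS : is_subalg S) (eP : primitive_idempotent_in S e).
Let Se : S e. Proof. by case: eP. Qed.
Let ee : e * e = e. Proof. by case: eP. Qed.
Let e0 : e <> 0. Proof. by case: eP => _ _ /eqP. Qed.

Lemma unit_not_nilp a : corner S e a -> corner_unit S e a -> ~ nilpot a.
Proof. by move=> aS ua na; case: (nilp_not_unit aS ee e0 na). Qed.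

Lemma one_sub_nilp a : corner S e a -> nilpot a -> corner_unit S e (e - a).
Proof.
move=> aS na; have eaS : corner S e (e - a) by apply: cornerB.
case: (primitive_dichotomy sS eP eaS) => // nea; case: e0.
case: aS => Sa ea ae; case: nea => n En; case: na => m Em.
have cea : GRing.comm e a by rewrite /GRing.comm ea ae.
(* e is the sum of a and e - a, which commute and would both be nilpotent *)
have cm : GRing.comm (e - a) a.
  by rewrite /GRing.comm mulrBl mulrBr ea ae.
have : e ^+ (n.+1 + m.+1) = 0.
  rewrite -[e in LHS](subrK a) exprDn_comm // big1 // => i _.
  have [le_m | lt_m] := leqP m.+1 i.
    by rewrite -(subnK le_m) [a ^+ _]exprD Em !mulr0 mul0rn.
  rewrite -(subnK (_ : n.+1 <= n.+1 + m.+1 - i)%N).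
    by rewrite exprD En mulr0 mul0r mul0rn.
  by rewrite -addnBA ?leq_addr // ltnW.
have eX q : e ^+ q.+1 = e.
  by elim: q => [|q IH]; rewrite ?expr1 // exprS IH ee.
by rewrite eX.
Qed.

Lemma unit_factor a b : corner S e a -> corner S e b ->
  corner_unit S e (a * b) -> corner_unit S e a.
Proof.
move=> aS bS uab; case: (primitive_dichotomy sS eP aS) => // na.
case: (uab) => d [dS abd dab]; case: na => n; elim: n => [|n IH].
  by rewrite expr1 => a0; case: e0; rewrite -abd a0 !mul0r.
move=> En; apply: IH.
have [Sa ea ae] := aS.
have -> : a ^+ n.+1 = a ^+ n.+1 * e by rewrite exprSr -mulrA ae.
by rewrite -abd !mulrA -exprSr En !mul0r.
Qed.

Lemma nilp_corner_mul a b : corner S e a -> corner S e b -> nilpot a -> nilpot (a * b).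
Proof.
move=> aS bS na; case: (primitive_dichotomy sS eP (cornerM sS aS bS)) => // u.
by case: (unit_not_nilp aS (unit_factor aS bS u)).
Qed.

Lemma nilp_corner_mulr a b : corner S e a -> corner S e b -> nilpot a -> nilpot (b * a).
Proof.
move=> aS bS na; have [n En] := nilp_corner_mul aS bS na.
exists n.+1; have E m : (b * a) ^+ m.+1 = b * (a * b) ^+ m * a.
  elim: m => [|m IH]; first by rewrite expr0 expr1 mulr1.
  by rewrite exprS IH exprS !mulrA.
by rewrite E En mulr0 mul0r.
Qed.

(** If a + b had an inverse d, then da and e - da = db would both be nilpotent. *)
Lemma nilpD a b : corner S e a -> corner S e b -> nilpot a -> nilpot b -> nilpot (a + b).
Proof.
move=> aS bS na nb; have abS := cornerD sS aS bS.
case: (primitive_dichotomy sS eP abS) => // -[d [dS abd dab]].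
have [] // : ~ nilpot (e - d * a); last first.
  have -> : e - d * a = d * b by rewrite -dab mulrDr addrC addKr.
  exact: nilp_corner_mulr.
have daS := cornerM sS dS aS.
apply: unit_not_nilp; first by apply: cornerB.
by apply: one_sub_nilp => //; apply: nilp_corner_mulr.
Qed.

(** In a local corner, some term of a non-nilpotent sum is invertible. *)
Lemma local_sum (I : finType) (P : pred I) (F : I -> galg k gT) :
  (forall t, P t -> corner S e (F t)) -> ~ nilpot (\sum_(t | P t) F t) ->
  exists2 t, P t & corner_unit S e (F t).
Proof.
move=> FS ns; apply: NNPP => nu; apply: ns.
suff [] : corner S e (\sum_(t | P t) F t) /\ nilpot (\sum_(t | P t) F t) by [].
apply: (big_ind (fun z => corner S e z /\ nilpot z)).
- by split; [apply: corner0 | apply: nilp0].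
- by move=> x y [xS nx] [yS ny]; split; [apply: cornerD | apply: nilpD].
move=> t Pt; split; first exact: FS.
case: (primitive_dichotomy sS eP (FS t Pt)) => // u.
by case: nu; exists t.
Qed.

Hypothesis closed_k : GRing.closed_field_axiom k.

(** Take a polynomial annihilating a in the corner and a root r of it; as long as
a - r e is invertible, the factor X - r can be cancelled. *)
Lemma corner_eigenvalue a : corner S e a -> exists r : k, nilpot (a - r *: e).
Proof.
move=> aS; have [f f0 fa] := exists_annihilator a.
have {fa}: e * horner_alg a f = 0 by rewrite fa mulr0.
have [n] := ubnP (size f); elim: n f f0 => // n IH f f0 lef fa.
have [/size_poly1P[c c0 fE]|] := boolP (size f == 1)%N.
  case: e0; move/eqP: fa; rewrite fE /= horner_algC -scalerAr mulr1 scaler_eq0.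
  by rewrite (negPf c0) /= => /eqP.
move=> /(PreClosedField.closed_rootP closed_k)[r rf].
have arS : corner S e (a - r *: e) by apply: cornerB => //; apply: cornerZ.
case: (primitive_dichotomy sS eP arS) => [|[d [dS ad da]]]; first by exists r.
have /factor_theorem[q fE] := rf.
have q0 : q != 0 by apply: contraNneq f0 => q0; rewrite fE q0 mul0r.
have [Sa ea ae] := aS.
have [_ _ qe] := horner_corner sS Se ee aS q.
have qar : e * horner_alg a q * (a - r *: e) = 0.
  rewrite -fa fE rmorphM rmorphB /= horner_algX horner_algC mulrA !mulrBr.
  by rewrite -!scalerAr qe mulr1.
have := congr1 (fun z => z * d) qar; rewrite /= -mulrA ad qe mul0r; apply: IH => //.
by move: lef; rewrite fE size_Mmonic ?monicXsubC // size_XsubC addn2 /= ltnS.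
Qed.
End Local.

(** Put x' = ixj and y' = jyi.  Then x'y' = i, so that y'x' is an idempotent of jSj; it
is nonzero because i = x'(y'x')y', hence equal to j. *)
Lemma primitive_iso S i j x y : is_subalg S -> primitive_idempotent_in S i ->
    primitive_idempotent_in S j -> S x -> S y -> i = x * j * y ->
  exists x' y', [/\ S x', S y', x' * y' = i & y' * x' = j].
Proof.
move=> sS iP jP Sx Sy iE; have [Si ii i0 _] := iP; have [Sj jj j0 jprim] := jP.
pose x' := i * x * j; pose y' := j * y * i.
have x'y' : x' * y' = i.
  rewrite /x' /y' !mulrA -(mulrA (i * x) j j) jj.
  by rewrite -(mulrA i x j) -(mulrA i (x * j) y) -iE !ii.
have Sx' : S x' by apply: (subalgM sS) => //; apply: (subalgM sS).
have Sy' : S y' by apply: (subalgM sS) => //; apply: (subalgM sS).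
exists x', y'; split=> //.
have jy : j * y' = y' by rewrite /y' !mulrA jj.
have yi : y' * i = y' by rewrite /y' -mulrA ii.
have ix : i * x' = x' by rewrite /x' !mulrA ii.
have xj : x' * j = x' by rewrite /x' -mulrA jj.
have uu : y' * x' * (y' * x') = y' * x' by rewrite mulrA -(mulrA y') x'y' yi.
have ju : j * (y' * x') = y' * x' by rewrite mulrA jy.
have uj : y' * x' * j = y' * x' by rewrite -mulrA xj.
case: (jprim (y' * x') (j - y' * x')).
- exact: (subalgM sS).
- by apply: (subalgB sS) => //; apply: (subalgM sS).
- exact: uu.
- by rewrite /is_idempotent mulrBr !mulrBl jj ju uj uu subrr subr0.
- by rewrite mulrBr uj uu subrr.
- by rewrite mulrBl ju uu subrr.
- by rewrite addrC subrK.
- have iE' : i = x' * (y' * x') * y' by rewrite mulrA x'y' -mulrA x'y' ii.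
  by move=> E; case/eqP: i0; rewrite iE' E mulr0 mul0r.
by move/eqP; rewrite subr_eq0 => /eqP.
Qed.

(** The left ideal of x + y contains that of x, and it contains y, which is not in it. *)
Lemma rank_orthogonal x y : x * x = x -> y * y = y -> x * y = 0 -> y * x = 0 ->
  y <> 0 -> (\rank (rmat x) < \rank (rmat (x + y)%R))%N.
Proof.
move=> xx yy xy yx y0; apply: rank_ltmx; rewrite ltmxE.
have xs : x * (x + y) = x by rewrite mulrDr xx xy addr0.
rewrite -{1}xs rmatM submxMl /=; apply/negP => /submxP[B EB]; apply: y0.
have sy : (x + y) * y = y by rewrite mulrDl xy yy add0r.
by apply: rmat_eq0; rewrite -sy rmatM EB -mulmxA -rmatM xy rmat0 mulmx0.
Qed.

(** Splitting an idempotent repeatedly, a property inherited by one of the two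
parts of every orthogonal splitting is inherited by some primitive part; the
dimension of the left ideal of the idempotent decreases. *)
Lemma primitive_below S y (Pr : galg k gT -> Prop) :
    is_subalg S -> S y -> y * y = y -> Pr y -> ~ Pr 0 ->
    (forall y1 y2, S y1 -> S y2 -> y1 * y1 = y1 -> y2 * y2 = y2 ->
       y1 * y2 = 0 -> y2 * y1 = 0 -> Pr (y1 + y2) -> Pr y1 \/ Pr y2) ->
  exists i, [/\ primitive_idempotent_in S i, Pr i, y * i = i & i * y = i].
Proof.
move=> sS + + + Pr0 Prsplit; have [n] := ubnP (\rank (rmat y)).
elim: n y => // n IH y ley Sy yy Pry.
have [yP | nyP] := classic (primitive_idempotent_in S y); first by exists y.
have y0 : y != 0 by apply/eqP => y0; apply: Pr0; rewrite -y0.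
have [y1 [y2 [[S1 S2 i1 i2] [o12 o21 yE] [n1 n2]]]] : exists y1 y2,
    [/\ [/\ S y1, S y2, y1 * y1 = y1 & y2 * y2 = y2],
        [/\ y1 * y2 = 0, y2 * y1 = 0 & y = y1 + y2] & y1 <> 0 /\ y2 <> 0].
  apply: NNPP => no; apply: nyP; split=> // y1 y2 S1 S2 i1 i2 o12 o21 yE.
  apply: NNPP => n12; apply: no; exists y1, y2; split=> //.
  by split=> E; apply: n12; [left | right].
have small u v : u * u = u -> v * v = v -> u * v = 0 -> v * u = 0 -> v <> 0 ->
    y = u + v -> (\rank (rmat u) < \rank (rmat y))%N.
  by move=> uu vv uv vu v0 ->; apply: rank_orthogonal.
have below u v : S u -> u * u = u -> v * v = v -> u * v = 0 -> v * u = 0 -> v <> 0 ->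
    y = u + v -> Pr u -> 
    exists i, [/\ primitive_idempotent_in S i, Pr i, y * i = i & i * y = i].
  move=> Su uu vv uv vu v0 E Pru.
  have [i [iP Pri ui iu]] := IH u (leq_trans (small u v uu vv uv vu v0 E) (ltnSE ley)) Su uu Pru.
  have vi : v * i = 0 by rewrite -ui mulrA vu mul0r.
  have iv : i * v = 0 by rewrite -iu -mulrA uv mulr0.
  exists i; split=> //; first by rewrite E mulrDl ui vi addr0.
  by rewrite E mulrDr iu iv addr0.
have := Pry; rewrite {1}yE => /(Prsplit y1 y2 S1 S2 i1 i2 o12 o21)[Pr1|Pr2].
  exact: (below y1 y2).
by apply: (below y2 y1) => //; rewrite addrC.
Qed.

End LocalCorners.

(** * The Brauer map *)

Section BrauerMap.
Variables (k : fieldType) (gT : finGroupType).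
Implicit Types (a b c e i j x y : galg k gT) (S : galg k gT -> Prop).
Implicit Types (g h u : gT) (C H P Q R T V W : {group gT}).

(** On the elements fixed by a p-subgroup Q this is the Brauer homomorphism. *)
Definition br Q a : galg k gT :=
  galg_mk (fun g => if g \in 'C(Q)%g then gcoef a g else 0).

Lemma gcoef_br Q a g :
  gcoef (br Q a) g = if g \in 'C(Q)%g then gcoef a g else 0.
Proof. exact: gcoefE. Qed.

Fact br_is_linear Q : linear (br Q).
Proof.
move=> r a b; apply/galgP=> g; rewrite gcoefD gcoefZ !gcoef_br.
by case: ifP => _; rewrite ?gcoefD ?gcoefZ // mulr0 addr0.
Qed.

HB.instance Definition _ Q :=
  GRing.isLinear.Build k (galg k gT) (galg k gT) _ (br Q) (br_is_linear Q).

Lemma br_in Q a : in_subalg 'C(Q)%G (br Q a).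
Proof. by move=> g gC; rewrite gcoef_br (negPf gC). Qed.

Lemma br_id Q a : in_subalg 'C(Q)%G a -> br Q a = a.
Proof.
move=> sa; apply/galgP=> g; rewrite gcoef_br; case: ifP => // gC.
by rewrite sa ?gC.
Qed.

Lemma br1 Q : br Q 1 = 1.
Proof. by apply: br_id; apply: in_subalg1. Qed.

Lemma br_br V W a : V \subset W -> br W (br V a) = br W a.
Proof.
move=> sVW; apply/galgP=> g; rewrite !gcoef_br; case: ifP => // gC.
by rewrite (subsetP (centS sVW)).
Qed.

Lemma br_gconj Q g a : br (Q :^ g^-1)%G (gconj g a) = gconj g (br Q a).
Proof.
apply/galgP=> x; rewrite gcoef_gconj !gcoef_br gcoef_gconj /= centJ.
by rewrite mem_conjgV.
Qed.

Lemma br_norm Q g a : g \in 'N(Q)%g -> br Q (gconj g a) = gconj g (br Q a).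
Proof.
move=> gN; rewrite -br_gconj; congr (br _ _); apply/val_inj => /=.
by rewrite (normP _) // groupV.
Qed.

Lemma br_fixed Q H a : H \subset 'N(Q)%g -> fixed_by H a -> fixed_by H (br Q a).
Proof. by move=> /subsetP sHN fa u uH; rewrite -br_norm ?sHN // fa. Qed.

Lemma in_cent_fixed Q a : in_subalg 'C(Q)%G a -> fixed_by Q a.
Proof.
move=> sa u uQ; apply/gconj_id_comm.
apply: (comm_of_fixed (H := 'C(Q)%G)) => // v vC.
rewrite gconj_gelt conjgE invgK mulgA.
by move/centP/(_ u uQ): vC => /= ->; rewrite mulgK.
Qed.

Variable p : nat.
Hypothesis pk : p \in [pchar k].

(** Multiplicativity: modulo p, only the Q-fixed terms of the convolution
survive at an element centralised by Q. *)
Lemma brM Q a b : (p.-group Q)%g -> fixed_by Q a -> fixed_by Q b ->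
  br Q (a * b) = br Q a * br Q b.
Proof.
move=> pQ /fixed_byP fa /fixed_byP fb; apply/galgP=> g; rewrite gcoef_br.
case: ifP => gC; last first.
  apply/esym; apply: (subalgM (in_subalg_subalg _ 'C(Q)%G)); rewrite ?gC //; exact: br_in.
rewrite !gcoefM (sum_over_fixpoints (to := conjg_action gT) pk pQ) /=; last first.
  move=> h u uQ; rewrite fa //; congr (_ * _).
  have gu : g = (g ^ u)%g by apply/esym/conjg_fixP/commgP; move/centP: gC => /(_ u uQ).
  by rewrite {1}gu -conjVg -conjMg fb.
rewrite [RHS](bigID (mem 'C(Q)%g)) /= [X in _ = _ + X]big1 ?addr0 => [|h /negPf hC]; last first.
  by rewrite gcoef_br hC mul0r.
apply: eq_big => [h | h].
  by rewrite afixJ.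
rewrite afixJ => hC; rewrite !gcoef_br hC groupM ?groupV //.
Qed.

Lemma brX Q a n : (p.-group Q)%g -> fixed_by Q a -> br Q (a ^+ n) = br Q a ^+ n.
Proof.
move=> pQ fa; elim: n => [|n IH]; first by rewrite !expr0 br1.
rewrite !exprS brM // ?IH //; elim: {IH} n => [|n IH]; first exact: fixed_by1.
by rewrite exprS; apply: (subalgM (fixed_subalg _ Q)).
Qed.

Lemma br_nilpot Q a : (p.-group Q)%g -> fixed_by Q a -> nilpot a -> nilpot (br Q a).
Proof. by move=> pQ fa [n E]; exists n; rewrite -brX // E linear0. Qed.

Lemma br_idem Q i : (p.-group Q)%g -> fixed_by Q i -> i * i = i ->
  br Q i * br Q i = br Q i.
Proof. by move=> pQ fi ii; rewrite -brM // ii. Qed.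

Definition lact (X : {set gT}) u := (u^-1 *: X)%g.

Fact lact1 X : lact X 1%g = X.
Proof. by rewrite /lact invg1 mul1g. Qed.

Fact lactM X : act_morph lact X.
Proof. by move=> u v; rewrite /lact invMg lcosetM. Qed.

Definition lcoset_action := TotalAction lact1 lactM.

(** The key exchange argument: a trace is a sum over cosets, on which T acts; the
Brauer map kills the non-trivial orbits, so some T-fixed coset hP contributes an
invertible term to the local corner of i. *)
Lemma trace_local R H P T e c j i :
    P \subset H -> T \subset H -> H \subset 'N(R)%g -> (p.-group T)%g ->
    sfix 'C(R)%G P c -> sfix 'C(R)%G P j -> e = rel_trace P H (c * j) ->
    primitive_idempotent_in (sfix 'C(R)%G T) i -> e * i = i -> br T i != 0 ->
  exists h, [/\ h \in H, T \subset (P :^ h^-1)%g &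
    exists x y, [/\ sfix 'C(R)%G T x, sfix 'C(R)%G T y & i = x * gconj h j * y]].
Proof.
move=> sPH sTH sHN pT cP jP eE iP ei /eqP bi.
have sS := sfix_subalg k 'C(R)%G T.
have [[si fi] ii i0 _] := iP.
have cjP := subalgM (sfix_subalg _ _ _) cP jP; have [_ fcj] := cjP.
move: cjP fcj eE; set w := c * j => wP fw eE.
pose F X := i * gconj (repr X) w * i.
have FT X u : X \in lcosets P H -> u \in T -> F (u *: X)%g = gconj u (F X).
  move=> XH uT; rewrite /F [gconj u (_ * i)]rmorphM /= [gconj u (i * _)]rmorphM /= fi //.
  by rewrite (gconj_repr_shift _ sPH).
pose fixc X := (X \in lcosets P H) && (X \in 'Fix_lcoset_action(T)).
have FC X : fixc X -> corner (sfix 'C(R)%G T) i (F X).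
  move=> /andP[XH /afixP XT]; split; last by rewrite /F -mulrA ii.
    split.
      apply: (subalgM (in_subalg_subalg _ _)) => //.
      apply: (subalgM (in_subalg_subalg _ _)) => //.
      apply: in_subalg_norm; last by case: wP.
      have [rH _] := repr_lcosets XH sPH.
      by apply: (subsetP (norms_cent _)) (subsetP sHN _ rH).
    move=> u uT; rewrite -FT //; congr F.
    by rewrite -[u in LHS]invgK; apply: XT; rewrite groupV.
  by rewrite /F !mulrA ii.
have bri : br T i = br T (\sum_(X | fixc X) F X).
  apply/galgP=> g; rewrite !gcoef_br; case: ifP => // gC.
  have -> : gcoef i g = \sum_(X in lcosets P H) gcoef (F X) g.
    rewrite -gcoef_sum; congr (gcoef _ g).
    by rewrite /F -mulr_suml -mulr_sumr -/(rel_trace P H w) -eE -mulrA ei ii.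
  rewrite gcoef_sum big_mkcond /=.
  rewrite (sum_over_fixpoints (to := lcoset_action) pk pT) /=.
    rewrite big_mkcond [RHS]big_mkcond; apply: eq_bigr => X _.
    by rewrite /fixc; case: (X \in lcosets _ _); case: (X \in 'Fix_(_)(_)).
  move=> X u uT; rewrite /lact lcosets_lmul ?groupV ?(subsetP sTH) //.
  case: ifP => // XH; rewrite FT ?groupV // gcoef_gconj; congr (gcoef _ _).
  by apply/conjg_fixP/commgP; move/centP: gC => /(_ u^-1%g); rewrite groupV => /(_ uT).
have [|X fX uX] := local_sum sS iP FC.
  move=> nF; apply: bi; apply: nilp_idem; first by rewrite br_idem.
  rewrite bri; apply: br_nilpot => //.
  apply: (subalg_sum (fixed_subalg _ T)) => [u uT|X fX]; first by rewrite raddf0.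
  by case: (FC X fX) => [[]].
have /andP[XH /afixP XT] := fX; have [rH XE] := repr_lcosets XH sPH.
have sTPX : T \subset (P :^ (repr X)^-1)%G.
  apply/subsetP=> u uT; rewrite /= mem_conjgV.
  have := XT u^-1%g; rewrite groupV /= /lact invgK => /(_ uT) uX'.
  have : (u * repr X)%g \in (u *: X)%g by rewrite mem_lcoset mulKg {2}XE lcoset_refl.
  by rewrite uX' {2}XE mem_lcoset conjgE.
exists (repr X); split=> //.
have [z [[Sz _ zi] _ zF]] := uX.
exists (z * gconj (repr X) c), i; split=> //.
  apply: (subalgM sS) => //; case: cP => sc fc; split.
    apply: in_subalg_norm sc.
    by apply: (subsetP (norms_cent _)) (subsetP sHN _ rH).
  exact: fixed_byS (fixed_by_gconj fc).
by rewrite -{1}zF /F /w [gconj _ (c * j)]rmorphM /= !mulrA zi.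
Qed.

End BrauerMap.

(** * Images of primitive idempotents under Brauer maps *)

Section BrauerImages.
Variables (k : fieldType) (gT : finGroupType) (p : nat).
Hypothesis pk : p \in [pchar k].
Implicit Types (a b c e i j x y z : galg k gT) (S : galg k gT -> Prop).
Implicit Types (g h u : gT) (C H P Q R T V W : {group gT}).

(** The sum of two nilpotent elements of a local corner is nilpotent. *)
Lemma local_split S e a b : is_subalg S -> primitive_idempotent_in S e ->
  corner S e a -> corner S e b -> e = a + b -> corner_unit S e a \/ corner_unit S e b.
Proof.
move=> sS eP aS bS E.
case: (primitive_dichotomy sS eP aS) => [na|]; last by left.
case: (primitive_dichotomy sS eP bS) => [nb|]; last by right.
have := nilpD sS eP aS bS na nb; rewrite -E => ne.
by have [_ ee /eqP[]] := eP; apply: nilp_idem.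
Qed.

Lemma norm_cent R H g : H \subset 'N(R)%g -> g \in H -> g \in 'N('C(R))%g.
Proof. by move=> sHN gH; apply: (subsetP (norms_cent sHN)). Qed.

(** The element jyj has image y, and is nilpotent or invertible in the corner of j. *)
Lemma br_primitive R T j : R \subset T -> T \subset 'N(R)%g -> (p.-group T)%g ->
    primitive_idempotent_in (sfix 'C(R)%G T) j -> br T j != 0 ->
  forall y, in_subalg 'C(T)%G y -> y * y = y -> br T j * y = y -> y * br T j = y ->
  y = 0 \/ y = br T j.
Proof.
move=> sRT sTN pT jP bj y sy yy jy yj; have sS := sfix_subalg k 'C(R)%G T.
have [[sj fj] jj j0 _] := jP.
have fy : fixed_by T y := in_cent_fixed sy.
have Sy : sfix 'C(R)%G T y by split=> //; apply: in_subalgS sy; apply: centS.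
have XS : corner (sfix 'C(R)%G T) j (j * y * j) by apply: corner_cut.
have brX : br T (j * y * j) = y.
  have fjy : fixed_by T (j * y) := subalgM (fixed_subalg _ T) fj fy.
  by rewrite (brM pk) // (brM pk) // (br_id sy) jy yj.
have fX : fixed_by T (j * y * j) by case: XS => [[]].
case: (primitive_dichotomy sS jP XS) => [nX | [b [[[sb fb] _ _] Xb _]]].
  by left; apply: nilp_idem yy _; rewrite -[y]brX; apply: (br_nilpot pk pT fX nX).
right; have E : y * br T b = br T j by rewrite -{1}brX -(brM pk) // Xb.
by rewrite -yj -E mulrA yy E.
Qed.

Lemma br_primitive_in R T j : R \subset T -> T \subset 'N(R)%g -> (p.-group T)%g ->
    primitive_idempotent_in (sfix 'C(R)%G T) j -> br T j != 0 ->
  primitive_idempotent_in (in_subalg 'C(T)%G) (br T j).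
Proof.
move=> sRT sTN pT jP bj; have [[sj fj] jj _ _] := jP.
split=> //; [exact: br_in | exact: (br_idem pk) |].
move=> e1 e2 s1 s2 i1 i2 o12 o21 E.
have [||-> | E1] := br_primitive sRT sTN pT jP bj s1 i1.
- by rewrite E mulrDl i1 o21 addr0.
- by rewrite E mulrDr i1 o12 addr0.
- by left.
by right; move: E; rewrite E1 -[X in X = _]addr0 => /addrI/esym.
Qed.

(** A central idempotent z of kC(V) which is orthogonal to j at every p-subgroup
W strictly above V and normalising V is orthogonal to j at V: the product is
supported on elements whose stabiliser in T is exactly V, so it lifts to a T-fixed
element Y that the Brauer map at T kills, and jYj is nilpotent. *)
Lemma br_orthogonal R T V j z :
    R \subset V -> V \proper T -> T \subset 'N(R)%g -> (p.-group T)%g ->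
    primitive_idempotent_in (sfix 'C(R)%G T) j -> br T j != 0 ->
    sfix 'C(V)%G 'C(V)%G z -> z * z = z -> fixed_by 'N_T(V)%G z ->
    (forall W, V \proper W -> W \subset 'N_T(V)%g -> br W j * br W z = 0) ->
  br V j * z = 0.
Proof.
move=> sRV pVT sTN pT jP bj [sz cz] zz fz orth; have sVT := proper_sub pVT.
have sS := sfix_subalg k 'C(R)%G T.
have [[sj fj] jj j0 _] := jP; have pV := pgroupS sVT pT.
have fjV := fixed_byS sVT fj.
have bjz : br V j * z = z * br V j by apply/esym; apply: comm_of_fixed cz (@br_in k gT V j).
have brjj := br_idem pk pV fjV jj.
pose y := br V j * z; rewrite -/y.
have yy : y * y = y by rewrite /y mulrA -(mulrA (br V j)) -bjz mulrA brjj -mulrA zz.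
have sy : in_subalg 'C(V)%G y by apply: (subalgM (in_subalg_subalg _ _)) => //; apply: br_in.
have sNT : 'N_T(V) \subset T by apply: subsetIl.
have sNN : 'N_T(V) \subset 'N(V)%g by apply: subsetIr.
have fbj : fixed_by 'N_T(V)%G (br V j) by apply: br_fixed => //; apply: fixed_byS fj.
have fy : fixed_by 'N_T(V)%G y by apply: (subalgM (fixed_subalg _ _)).
pose good (c : gT) := (c \in 'C(V)%g) && ('C_T[c]%g == V :> {set gT}).
have cTJ (c : gT) u : u \in T -> ('C_T[c ^ u] = 'C_T[c] :^ u)%g.
  by move=> uT; rewrite conjIg (conjGid uT) -normJ conjg_set1.
have sVC (c : gT) : c \in 'C(V)%g -> V \subset 'C_T[c]%g.
  by move=> cC; rewrite subsetI sVT sub_cent1.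
have y0 (c : gT) : c \in 'C(V)%g -> ~~ good c -> gcoef y c = 0.
  move=> cC; rewrite /good cC /= => ngc.
  pose K := ('C_T[c])%G; have pK : (p.-group K)%g := pgroupS (subsetIl _ _) pT.
  have VK : V \proper K by rewrite properEneq eq_sym ngc sVC.
  have VW := nilpotent_proper_norm (pgroup_nil pK) VK.
  have sWN : 'N_K(V) \subset 'N_T(V) by apply: setSI; apply: subsetIl.
  have sWT := subset_trans sWN sNT.
  have : gcoef (br 'N_K(V)%G y) c = 0.
    rewrite /y (brM pk) ?(pgroupS sWT) //; first last.
    - exact: fixed_byS fz.
    - exact: fixed_byS fbj.
    by rewrite br_br ?(proper_sub VW) // orth // gcoef0.
  rewrite gcoef_br ifT //; apply/centP => u /setIP[/setIP[_ /cent1P] ? _].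
  by apply/commute_sym.
have goodJ (c : gT) u : good c -> u \in T -> good (c ^ u)%g -> gcoef y (c ^ u)%g = gcoef y c.
  move=> /andP[_ /eqP Ec] uT /andP[_ /eqP]; rewrite cTJ // Ec => nV.
  by rewrite -gcoef_gconj fy // inE uT; apply/normP.
pose Y := galg_mk (fun g => if [pick t | (t \in T) && good (g ^ t)%g] is Some t
                            then gcoef y (g ^ t)%g else 0) : galg k gT.
have YE g t : t \in T -> good (g ^ t)%g -> gcoef Y g = gcoef y (g ^ t)%g.
  move=> tT gt; rewrite gcoefE; case: pickP => [s /andP[sT gs] | /(_ t)]; last by rewrite tT gt.
  have -> : (g ^ s = (g ^ t) ^ (t^-1 * s))%g by rewrite -conjgM mulKVg.
  by rewrite goodJ ?groupM ?groupV // -conjgM mulKVg.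
have Y0 g : (forall t, t \in T -> ~~ good (g ^ t)%g) -> gcoef Y g = 0.
  by move=> no; rewrite gcoefE; case: pickP => // s /andP[sT gs]; case/negP: (no s sT).
have fY : fixed_by T Y.
  apply/fixed_byP=> u g uT.
  have [t /andP[tT gt] | no] := pickP [pred t | (t \in T) && good (g ^ t)%g].
    rewrite (YE g t) // (YE _ (u^-1 * t)%g) ?groupM ?groupV //.
      by rewrite -conjgM mulKVg.
    by rewrite -conjgM mulKVg.
  rewrite (Y0 g) => [|t tT]; last by have := no t; rewrite /= tT /= => ->.
  by rewrite Y0 // => t tT; have := no (u * t)%g; rewrite /= groupM //= -conjgM => ->.
have sY : in_subalg 'C(R)%G Y.
  move=> g gC; apply: Y0 => t tT; apply: contra gC => /andP[gt _].
  have := subsetP (centS sRV) _ gt; rewrite -(memJ_norm _ (norm_cent sTN (groupVr tT))).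
  by rewrite conjgK.
have brVY : br V Y = y.
  apply/galgP=> g; rewrite gcoef_br; case: ifP => gC; last by rewrite sy ?gC.
  have [gg | ngg] := boolP (good g); first by rewrite (YE _ 1%g) ?conjg1.
  rewrite (y0 g) // Y0 // => t tT; apply: contra ngg => /andP[_ /eqP E].
  rewrite /good gC /= eq_sym eqEcard sVC //=.
  by rewrite -(cardJg _ t) -cTJ // E.
have brTY : br T Y = 0.
  apply/galgP=> g; rewrite gcoef_br gcoef0; case: ifP => // gC.
  rewrite Y0 // => t tT; apply/negP => /andP[_ /eqP E].
  have gt : (g ^ t = g)%g by apply/conjg_fixP/commgP; move/centP: gC => /(_ t tT).
  move: pVT; rewrite -E gt (setIidPl _) ?properxx //.
  by rewrite sub_cent1.
have XS : corner (sfix 'C(R)%G T) j (j * Y * j) by apply: corner_cut.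
have fX : fixed_by T (j * Y * j) by case: XS => [[]].
have fjY : fixed_by T (j * Y) := subalgM (fixed_subalg _ T) fj fY.
case: (primitive_dichotomy sS jP XS) => [nX | [b [[[sb fb] _ _] Xb _]]].
  apply: nilp_idem => //.
  have <- : br V (j * Y * j) = y.
    rewrite !(brM pk) //; first last; try exact: fixed_byS sVT _.
    by rewrite brVY /y !mulrA brjj -mulrA -bjz mulrA brjj.
  exact: (br_nilpot pk pV (fixed_byS sVT fX) nX).
case/eqP: bj; rewrite -Xb !(brM pk) //.
by rewrite brTY mulr0 !mul0r.
Qed.

End BrauerImages.

Section DefectPoints.
Variables (k : fieldType) (gT : finGroupType) (p : nat).
Hypothesis pk : p \in [pchar k].
Implicit Types (a b c e i j x y z : galg k gT) (S : galg k gT -> Prop).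
Implicit Types (g h u : gT) (C H P Q R T V W : {group gT}).

(** The conjugates of x under H correspond to the left cosets of C_H(x). *)
Lemma rel_trace_class H (x : gT) :
  rel_trace 'C_H[x]%G H (gelt k x) = \sum_(y in (x ^: H)%g) gelt k y.
Proof.
have sCH : 'C_H[x] \subset H by apply: subsetIl.
rewrite /rel_trace (eq_bigr (fun X => gelt k (x ^ (repr X)^-1)%g)) => [|X _]; last first.
  by rewrite gconj_gelt.
have -> : (x ^: H)%g = [set (x ^ (repr (X : {set gT}))^-1)%g | X in lcosets 'C_H[x]%G H].
  apply/setP=> y; apply/imsetP/imsetP => [[u uH ->] | [X XH ->]]; last first.
    have [rH _] := repr_lcosets XH sCH.
    by exists (repr X)^-1%g; rewrite ?groupV.
  exists (u^-1 *: 'C_H[x]%G)%g.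
    by apply/lcosetsP; exists u^-1%g; rewrite ?groupV.
  case/lcosetP: (mem_repr_lcoset 'C_H[x]%G u^-1%g) => v /setIP[_ /cent1P xv] ->.
  rewrite invMg invgK conjgM; congr (_ ^ _)%g.
  by apply/esym/conjg_fixP/commgP/commuteV.
rewrite [RHS]big_imset //= => X Y XH YH.
have [rX EX] := repr_lcosets XH sCH; have [rY EY] := repr_lcosets YH sCH.
move=> E; rewrite EX EY; apply/lcoset_eqP.
rewrite mem_lcoset inE groupM ?groupV //=; apply/cent1P/commute_sym/commgP/conjg_fixP.
by rewrite conjgM -E -conjgM mulVg conjg1.
Qed.

(** The idempotent e is a sum of multiples of class sums, that is, of traces from
centralisers C_H(x); by locality a single x in the support of e is enough, and a
Sylow p-subgroup T of C_H(x) serves, because x then lies in the support of br T e. *)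
Lemma trace_from_centraliser R H e :
    R \subset H -> H \subset 'N(R)%g -> (p.-group R)%g ->
    primitive_idempotent_in (sfix 'C(R)%G H) e ->
    (forall a, in_subalg 'C(R)%G a -> e * a = a * e) ->
  exists T c, [/\ T \subset H, R \subset T, (p.-group T)%g &
    [/\ sfix 'C(R)%G T c, e = rel_trace T H c & br T e != 0]].
Proof.
move=> sRH sHN pR eP eC; have sS := sfix_subalg k 'C(R)%G H.
have [[se fe] ee e0 _] := eP.
pose f (y : gT) := repr (y ^: H)%g.
have fin (y : gT) : f y \in (y ^: H)%g by apply: (mem_repr y); apply: class_refl.
pose t (x : gT) := rel_trace 'C_H[x]%G H (gcoef e x *: gelt k x).
have eE : e = \sum_(x : gT | f x == x) t x.
  rewrite {1}[e]galg_expand (partition_big f (fun x : gT => f x == x)) /=; last first.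
    by move=> y _; apply/eqP; rewrite {1}/f (class_eqP (fin y)).
  apply: eq_bigr => x /eqP fx; rewrite /t rel_traceZ rel_trace_class scaler_sumr.
  apply: eq_big => [y | y /eqP fy].
    apply/eqP/idP => [<- | yx]; first by rewrite class_sym.
    by rewrite /f (class_eqP yx).
  congr (_ *: _); have /imsetP[u uH E] := fin y.
  by rewrite -fy E -gcoef_gconj fe.
have tS (x : gT) : corner (sfix 'C(R)%G H) e (e * t x).
  have [z0 | nz] := eqVneq (gcoef e x) 0.
    by rewrite /t z0 scale0r /rel_trace big1 ?mulr0 => [|X _]; [apply: corner0|rewrite raddf0].
  have xC : x \in 'C(R)%g by apply: contraNT nz => xC; rewrite se.
  have st : sfix 'C(R)%G H (t x).
    split; last first.
      apply: rel_trace_fixed; rewrite ?subsetIl // => u /setIP[_ /cent1P ux].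
      rewrite gconjZ gconj_gelt; congr (_ *: gelt _ _).
      by apply/conjg_fixP/commgP/commuteV.
    apply: (subalg_sum (in_subalg_subalg _ _)) => [g gC|X XH]; first by rewrite gcoef0.
    have [rH _] := repr_lcosets XH (subsetIl _ _).
    apply: in_subalg_norm; first exact: norm_cent sHN rH.
    by apply: (subalgZ (in_subalg_subalg _ _)); apply: in_subalg_gelt.
  split; [exact: (subalgM sS) | by rewrite mulrA ee |].
  by rewrite -eC ?mulrA ?ee //; case: (subalgM sS (conj se fe) st).
have [|x _ [b [bS _ bt]]] := local_sum sS eP (P := fun x : gT => f x == x) (fun (x : gT) _ => tS x).
  rewrite -mulr_sumr -eE => ne; by case/eqP: e0; apply: (nilp_idem ee); rewrite -ee.
have nz : gcoef e x != 0.
  apply/eqP=> z0; case/eqP: e0; rewrite -bt /t z0 scale0r /rel_trace big1 ?mulr0 // => X _.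
  by rewrite raddf0.
have xC : x \in 'C(R)%g by apply: contraNT nz => xC; rewrite se.
have [T sylT] := Sylow_exists p 'C_H[x]%G.
have sTC := pHall_sub sylT; have sCH : 'C_H[x] \subset H by apply: subsetIl.
have sTH := subset_trans sTC sCH; have pT := pHall_pgroup sylT.
have sRT : R \subset T.
  have sRC : R \subset 'C_H[x]%G by rewrite subsetI sRH sub_cent1.
  apply: (normal_sub_max_pgroup (Hall_max sylT)) => //.
  by rewrite /normal sRC (subset_trans sCH).
have fxT : fixed_by 'C_H[x]%G (gelt k x).
  move=> u /setIP[_ /cent1P ux]; rewrite gconj_gelt; congr gelt.
  by apply/conjg_fixP/commgP/commuteV.
pose m := #|'C_H[x] : T|; have m0 : m%:R != 0 :> k.
  by rewrite -(dvdn_pcharf pk) -p'natE ?(pcharf_prime pk) //; case/and3P: sylT.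
exists T, (b * (gcoef e x / m%:R *: gelt k x)); split=> //.
have fxT' := fixed_byS sTC fxT; have [[sb fb] eb be] := bS.
split.
- apply: (subalgM (sfix_subalg _ _ _)); first by split=> //; apply: fixed_byS fb.
  by apply: (subalgZ (sfix_subalg _ _ _)); split=> //; apply: in_subalg_gelt.
- have E := rel_traceZ T H (gcoef e x / m%:R) (gelt k x).
  rewrite rel_trace_mull // -[e in LHS]bt; rewrite -[RHS](congr1 ( *%R b) (esym E)).
  rewrite (rel_trace_trans sTC) // (rel_trace_const sTC) // -/m -scaler_nat.
  by rewrite rel_traceZ scalerA divfK // /t rel_traceZ mulrA be.
apply: contraNneq nz => z0; have := congr1 (fun a => gcoef a x) z0.
rewrite gcoef0 gcoef_br ifT // => [->//|]; apply/centP=> u uT.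
by have /setIP[_ /cent1P ux] := subsetP sTC _ uT; apply: commute_sym.
Qed.

(** If e is a trace from P, then already from the ideal of some primitive
idempotent j. *)
Lemma trace_from_primitive R H P e c :
    P \subset H -> H \subset 'N(R)%g ->
    primitive_idempotent_in (sfix 'C(R)%G H) e ->
    (forall a, in_subalg 'C(R)%G a -> e * a = a * e) ->
    sfix 'C(R)%G P c -> e = rel_trace P H c ->
  exists d j, [/\ sfix 'C(R)%G P d, primitive_idempotent_in (sfix 'C(R)%G P) j,
    e * j = j & e = rel_trace P H (d * j)].
Proof.
move=> sPH sHN eP eC cS eE; have sS := sfix_subalg k 'C(R)%G H.
have sSP := sfix_subalg k 'C(R)%G P.
have [[se fe] ee e0 _] := eP.
have feP := fixed_byS sPH fe.
pose Pr y := exists2 d, sfix 'C(R)%G P d & e = rel_trace P H (d * y).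
have [|||| y1 y2 S1 S2 _ _ _ _ [d dS E] | j [jP [d dS E] ej _]] :=
    @primitive_below _ _ (sfix 'C(R)%G P) e Pr sSP.
- by [].
- by exact: ee.
- by exists c => //; rewrite rel_trace_mulr // -eE.
- case=> d dS; rewrite mulr0 /rel_trace big1 => [E|X _]; last by rewrite raddf0.
  by rewrite E eqxx in e0.
- have cut y : sfix 'C(R)%G P y -> corner (sfix 'C(R)%G H) e (e * rel_trace P H (d * y)).
    move=> yS; have [sdy fdy] := subalgM sSP dS yS.
    have st : in_subalg 'C(R)%G (rel_trace P H (d * y)).
      apply: (subalg_sum (in_subalg_subalg _ _)) => [g gC|X XH]; first by rewrite gcoef0.
      have [rH _] := repr_lcosets XH sPH.
      by apply: in_subalg_norm => //; apply: norm_cent sHN rH.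
    have tS : sfix 'C(R)%G H (rel_trace P H (d * y)).
      by split=> //; apply: rel_trace_fixed.
    split; [exact: (subalgM sS) | by rewrite mulrA ee |].
    by rewrite -eC ?mulrA ?ee //; case: (subalgM sS (conj se fe) tS).
  have found y : sfix 'C(R)%G P y ->
      corner_unit (sfix 'C(R)%G H) e (e * rel_trace P H (d * y)) -> Pr y.
    move=> yS [b [[[sb fb] _ be] _ E']]; exists (b * d).
      by apply: (subalgM sSP) => //; split=> //; apply: fixed_byS fb.
    by rewrite -mulrA rel_trace_mull // -{1}E' mulrA be.
  have [] := local_split sS eP (cut _ S1) (cut _ S2).
  + by rewrite -mulrDr -rel_traceD -mulrDr -E ee.
  + by left; apply: found.
  by right; apply: found.
by exists d, j.
Qed.

(** If e is split, the image of one of the parts still has a nonzero product with f. *)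
Lemma primitive_local R T e f : R \subset T -> T \subset 'N(R)%g -> (p.-group T)%g ->
    sfix 'C(R)%G T e -> e * e = e -> in_subalg 'C(T)%G f ->
    br T e * f != 0 ->
  exists i, [/\ primitive_idempotent_in (sfix 'C(R)%G T) i, br T i * f != 0, e * i = i
    & i * e = i].
Proof.
move=> sRT sTN pT eS ee sf ef.
apply: (primitive_below (Pr := fun y => br T y * f != 0)) => //.
- exact: sfix_subalg.
- by rewrite linear0 mul0r eqxx.
move=> y1 y2 _ _ _ _ _ _; rewrite linearD mulrDl => n0.
have [E1|] := eqVneq (br T y1 * f) 0; last by left.
by right; rewrite E1 add0r in n0.
Qed.

(** Let T be as in trace_from_centraliser, so that some primitive idempotent i below e
survives the Brauer map at T, and let j be as in trace_from_primitive.  By trace_local i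
is a multiple of a conjugate of j by an element which normalises T; hence j survives
as well. *)
Lemma defect_point R H e :
    R \subset H -> H \subset 'N(R)%g -> (p.-group R)%g ->
    primitive_idempotent_in (sfix 'C(R)%G H) e ->
    (forall a, in_subalg 'C(R)%G a -> e * a = a * e) ->
  exists T d j, [/\ T \subset H, R \subset T, (p.-group T)%g &
    [/\ sfix 'C(R)%G T d, primitive_idempotent_in (sfix 'C(R)%G T) j, e * j = j,
        br T j != 0 & e = rel_trace T H (d * j)]].
Proof.
move=> sRH sHN pR eP eC; have [[se fe] ee _ _] := eP.
have [T [c [sTH sRT pT [cS eE be]]]] := trace_from_centraliser sRH sHN pR eP eC.
have [d [j [dS jP ej E]]] := trace_from_primitive sTH sHN eP eC cS eE.
have sTN := subset_trans sTH sHN; have [[sj fj] jj _ _] := jP.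
exists T, d, j; split=> //; split=> //.
have eS : sfix 'C(R)%G T e by split=> //; apply: fixed_byS fe.
have [|i [iP]] := primitive_local sRT sTN pT eS ee (@in_subalg1 _ _ 'C(T)%G).
  by rewrite mulr1.
rewrite mulr1 => bi ei _.
have [h [hH sTh [x [y [[sx fx] [sy fy] iE]]]]] :=
  trace_local pk sTH sTH sHN pT dS (conj sj fj) E iP ei bi.
have Th : (T :^ h^-1)%G = T.
  by apply/val_inj/eqP; rewrite /= eq_sym eqEcard sTh cardJg leqnn.
apply: contraNneq bi => bj0; have fhj := fixed_by_gconj (g := h) fj; rewrite Th in fhj.
have fxj := subalgM (fixed_subalg _ T) fx fhj.
rewrite iE (brM pk pT fxj fy) (brM pk pT fx fhj).
have -> : br T (gconj h j) = gconj h (br T j) by rewrite -br_gconj Th.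
by rewrite bj0 raddf0 mulr0 mul0r.
Qed.

End DefectPoints.

(** * Brauer pairs below a source idempotent *)

Section Blocks.
Variables (k : fieldType) (gT : finGroupType) (p : nat).
Hypothesis pk : p \in [pchar k].
Implicit Types (a b c e f i j x y z : galg k gT) (S : galg k gT -> Prop).
Implicit Types (g h u : gT) (C H P Q R T V W : {group gT}).

Lemma primitive_gconj C T g j : primitive_idempotent_in (sfix C T) j ->
  primitive_idempotent_in (sfix (C :^ g^-1)%G (T :^ g^-1)%G) (gconj g j).
Proof.
move=> [Sj jj j0 prim].
have back a : sfix (C :^ g^-1)%G (T :^ g^-1)%G a -> sfix C T (gconj g^-1%g a).
  move=> /(sfix_gconj g^-1%g); rewrite invgK.
  have KV (A : {group gT}) : ((A :^ g^-1) :^ g)%G = A.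
    by apply/val_inj; rewrite /= conjsgKV.
  by rewrite !KV.
split; first exact: sfix_gconj.
- by rewrite /is_idempotent -rmorphM jj.
- by apply: contraNneq j0 => E; apply/eqP/(gconj_inj (g := g)); rewrite E raddf0.
move=> e1 e2 s1 s2 i1 i2 o12 o21 E.
have inj0 a : gconj g^-1%g a = 0 -> a = 0.
  by move=> E0; rewrite -[a](gconjKV g) E0 raddf0.
have [|||||||E1|E2] := prim (gconj g^-1%g e1) (gconj g^-1%g e2).
- exact: back.
- exact: back.
- by rewrite /is_idempotent -rmorphM i1.
- by rewrite /is_idempotent -rmorphM i2.
- by rewrite -rmorphM o12 raddf0.
- by rewrite -rmorphM o21 raddf0.
- by rewrite -raddfD -E /= gconjK.
- by left; apply: inj0.
by right; apply: inj0.
Qed.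

Lemma block_gconj Q g f :
  is_block 'C(Q)%G f -> is_block 'C(Q :^ g^-1)%G (gconj g f).
Proof.
move=> /blockP fP; apply/blockP.
have -> : 'C(Q :^ g^-1)%G = ('C(Q) :^ g^-1)%G by apply/val_inj; rewrite /= centJ.
exact: primitive_gconj.
Qed.

(** The block f is the sum of the orthogonal central idempotents fz and f - fz. *)
Lemma block_absorb H f z : is_block H f -> sfix H H z -> z * z = z ->
  f * z = f \/ f * z = 0.
Proof.
move=> /blockP[[sf cf] ff f0 prim] [sz cz] zz.
have fz : f * z = z * f by apply: comm_of_fixed cf sz.
have fzz : f * z * (f * z) = f * z by rewrite {2}fz mulrA -(mulrA f z z) zz fz -mulrA ff -fz.
have ffz : f * (f * z) = f * z by rewrite mulrA ff.
have fzf : f * z * f = f * z by rewrite -mulrA -fz ffz.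
have sS := sfix_subalg k H H; have SM := subalgM sS (conj sf cf) (conj sz cz).
case: (prim (f * z) (f - f * z)) => //.
- by apply: (subalgB sS).
- by rewrite /is_idempotent mulrBl !mulrBr ff ffz fzf fzz subrr subr0.
- by rewrite mulrBr fzf fzz subrr.
- by rewrite mulrBl ffz fzz subrr.
- by rewrite addrC subrK.
- by right.
by move/eqP; rewrite subr_eq0 => /eqP <-; left.
Qed.

Lemma block_eq H f f' : is_block H f -> is_block H f' -> f * f' != 0 -> f = f'.
Proof.
move=> fB f'B n0; have [[sf cf] ff _ _] := (proj1 (blockP H f)) fB.
have [[sf' cf'] ff' _ _] := (proj1 (blockP H f')) f'B.
have [E|E] := block_absorb fB (conj sf' cf') ff'; last by rewrite E eqxx in n0.
have [E'|E'] := block_absorb f'B (conj sf cf) ff.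
  by rewrite -E (comm_of_fixed cf sf') E'.
by rewrite (comm_of_fixed cf sf') E' eqxx in n0.
Qed.

(** T has no fixed point on the cosets of a proper subgroup, so the conjugates in the
trace cancel modulo p on the elements centralised by T. *)
Lemma br_rel_trace0 P T a : P \proper T -> (p.-group T)%g -> fixed_by P a ->
  br T (rel_trace P T a) = 0.
Proof.
move=> /andP[sPT nsTP] pT fa; apply/galgP=> g; rewrite gcoef_br gcoef0; case: ifP => // gC.
rewrite gcoef_sum big_mkcond /= (sum_over_fixpoints (to := lcoset_action gT) pk pT) /=.
  rewrite big1 // => X /afixP XT; case: ifP => // XH; case/negP: nsTP.
  have [rT XE] := repr_lcosets XH sPT; apply/subsetP => u uT.
  have vT : (repr X * u * (repr X)^-1)%g \in T by rewrite !groupM ?groupV.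
  have := XT _ (groupVr vT); rewrite /= /lact invgK => uX.
  have : (repr X * u)%g \in ((repr X * u * (repr X)^-1) *: X)%g.
    rewrite mem_lcoset !invMg invgK -!mulgA mulKg mulVg mulg1.
    by rewrite {2}XE lcoset_refl.
  by rewrite uX {2}XE mem_lcoset mulKg.
move=> X u uT; rewrite /lact lcosets_lmul ?groupV //.
case: ifP => // XH; rewrite (gconj_repr_shift _ sPT) // gcoef_gconj; congr (gcoef _ _).
by apply/conjg_fixP/commgP; move/centP: gC => /(_ u^-1%g); rewrite groupV => /(_ uT).
Qed.

Lemma in_subalg_C1 a : in_subalg 'C(1)%G a.
Proof. by move=> g; rewrite /= cent1T inE. Qed.

Lemma centS_norm V W : V \subset W -> 'C(W) \subset 'C(V)%g /\ 'C(W) \subset 'N(W)%g.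
Proof. by move=> sVW; split; [apply: centS | apply: cent_sub]. Qed.

Lemma br_center V W z : V \subset W -> (p.-group W)%g ->
  sfix 'C(V)%G 'C(V)%G z -> z * z = z -> fixed_by W z ->
  sfix 'C(W)%G 'C(W)%G (br W z) /\ br W z * br W z = br W z.
Proof.
move=> sVW pW [sz cz] zz fz; have [sCC sCN] := centS_norm sVW.
split; last exact: (br_idem pk).
by split; [apply: br_in | apply: br_fixed => //; apply: fixed_byS cz].
Qed.

End Blocks.

(** The data which a source idempotent l of a block with defect group D provides
over the residue field. *)
Record source_pairs (k : fieldType) (gT : finGroupType) (p : nat)
    (D : {group gT}) (l : galg k gT) (e : {group gT} -> galg k gT) : Prop :=
  SourcePairs {
    sp_pgroup : (p.-group D)%g;
    sp_primitive : primitive_idempotent_in (sfix 'C(1)%G D) l;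
    sp_local : br D l != 0;
    sp_block : forall Q : {group gT}, Q \subset D ->
      is_block 'C(Q)%G (e Q) /\ br Q l * e Q != 0
  }.

Section SourceIdempotent.
Variables (k : fieldType) (gT : finGroupType) (p : nat).
Hypothesis pk : p \in [pchar k].
Implicit Types (a b c f i j x y z : galg k gT) (S : galg k gT -> Prop).
Implicit Types (g h u : gT) (C H P Q R T V W : {group gT}).
Variables (D : {group gT}) (l : galg k gT) (e : {group gT} -> galg k gT).
Hypothesis src : source_pairs p D l e.

Let pD : (p.-group D)%g := sp_pgroup src.
Let lP : primitive_idempotent_in (sfix 'C(1)%G D) l := sp_primitive src.
Let brl : br D l != 0 := sp_local src.
Let eP := sp_block src.
Let fl : fixed_by D l. Proof. by case: lP => [[]]. Qed.
Let ll : l * l = l. Proof. by case: lP. Qed.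

Lemma block_idem Q : Q \subset D -> sfix 'C(Q)%G 'C(Q)%G (e Q) /\ e Q * e Q = e Q.
Proof. by move=> /eP[/blockP[]]. Qed.

(** Induction downwards from D, where the image of l is primitive.  Let N = N_D(Q) and
let F be the sum of the distinct N-conjugates of e Q.  For Q < W <= N the image of l at
W lies in the block e W, which br W F either contains or kills; which case occurs
does not depend on W, as it can be read off at N.  It cannot be the second one, or
br_orthogonal for z = F would give br Q l * e Q = 0.  In the first case br_orthogonal
for z = 1 - F gives br Q l * F = br Q l.  If e Q were not N-fixed, br Q l * F would be a
trace from a proper subgroup of N, contrary to br N l <> 0; so F = e Q. *)
Lemma br_block Q : Q \subset D -> br Q l * e Q = br Q l.
Proof.
have [n] := ubnP (#|D| - #|Q|); elim: n Q => // n IH Q leQ sQD.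
have [eB neq0] := eP sQD; have [[seQ ceQ] eeQ] := block_idem sQD.
have pQ := pgroupS sQD pD; have flQ := fixed_byS sQD fl.
have brlQ := br_idem pk pQ flQ ll.
have le_comm : br Q l * e Q = e Q * br Q l.
  by apply/esym; apply: comm_of_fixed ceQ (@br_in _ _ Q l).
have [DQ | nDQ] := eqVneq D Q.
  rewrite -{}DQ in seQ ceQ eeQ brlQ le_comm neq0 *.
  have [|||||//] := br_primitive pk (sub1G D) (norms1 D) pD lP brl (y := br D l * e D).
  - by apply: (subalgM (in_subalg_subalg _ _)) => //; apply: br_in.
  - by rewrite mulrA -(mulrA (br D l)) -le_comm mulrA brlQ -mulrA eeQ.
  - by rewrite mulrA brlQ.
  - by rewrite -mulrA -le_comm mulrA brlQ.
  by move/eqP; rewrite (negPf neq0).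
have pQD : Q \proper D by rewrite properEneq eq_sym nDQ.
have [N NE] : {N : {group gT} | N = 'N_D(Q)%G} by exists 'N_D(Q)%G.
have sND : N \subset D by rewrite NE subsetIl.
have QN : Q \proper N by rewrite NE; apply: nilpotent_proper_norm (pgroup_nil pD) pQD.
have sQN := proper_sub QN; have sNN : N \subset 'N(Q)%g by rewrite NE subsetIr.
have pN := pgroupS sND pD; have flN := fixed_byS sND fl.
have NQ u : u \in N -> (Q :^ u)%g = Q.
  by move=> /(subsetP sNN)/normP.
have eBu u : u \in N -> is_block 'C(Q)%G (gconj u (e Q)).
  by move=> uN; have := block_gconj u eB; rewrite NQ ?groupV.
pose Stset := [set u in N | gconj u (e Q) == e Q].
have gSt : group_set Stset.
  apply/group_setP; split=> [|u v]; first by rewrite inE group1 gconj1 eqxx.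
  rewrite !inE => /andP[uN /eqP Eu] /andP[vN /eqP Ev].
  by rewrite groupM // gconjM Ev Eu eqxx.
pose St := Group gSt; have sSt : St \subset N by apply/subsetP=> u; rewrite inE => /andP[].
have fSt : fixed_by St (e Q) by move=> u; rewrite inE => /andP[_ /eqP].
pose F := rel_trace St N (e Q).
have fF : fixed_by N F := rel_trace_fixed sSt fSt.
have orth X Y : X \in lcosets St N -> Y \in lcosets St N -> X != Y ->
    gconj (repr X) (e Q) * gconj (repr Y) (e Q) = 0.
  move=> XN YN; have [rX EX] := repr_lcosets XN sSt.
  have [rY EY] := repr_lcosets YN sSt; apply: contraNeq => n0.
  have E := block_eq (eBu _ rX) (eBu _ rY) n0.
  rewrite EX EY; apply/eqP/lcoset_eqP; rewrite mem_lcoset inE groupM ?groupV //=.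
  by rewrite gconjM E gconjK.
have FX X : X \in lcosets St N -> F * gconj (repr X) (e Q) = gconj (repr X) (e Q).
  move=> XN; rewrite /F mulr_suml (bigD1 X) //= big1 => [|Y /andP[YN YX]]; last exact: orth.
  by rewrite addr0 -rmorphM eeQ.
have FF : F * F = F.
  by rewrite {2}/F mulr_sumr; apply: eq_bigr => X XN; apply: FX.
have Fe : F * e Q = e Q.
  have XN : (1 *: St)%g \in lcosets St N by apply/lcosetsP; exists 1%g.
  by have := FX _ XN; rewrite gconj_repr // gconj1.
have FC : sfix 'C(Q)%G 'C(Q)%G F.
  apply: (subalg_sum (sfix_subalg _ _ _)) => [|X XN].
    by rewrite -(scale0r 1); apply: (subalgZ (sfix_subalg _ _ _)); apply: sfix1.
  have [rX _] := repr_lcosets XN sSt.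
  by have /blockP[] := eBu _ rX.
have absorb W : Q \proper W -> W \subset N ->
    br W l * br W F = br W l \/ br W l * br W F = 0.
  move=> QW sWN; have sWD := subset_trans sWN sND; have pW := pgroupS sWD pD.
  have [cF iF] := br_center pk (proper_sub QW) pW FC FF (fixed_byS sWN fF).
  have IHW : br W l * e W = br W l.
    apply: IH => //; rewrite -ltnS; apply: leq_trans leQ; rewrite ltnS.
    by apply: ltn_sub2l; rewrite proper_card // (sub_proper_trans sWD).
  by rewrite -IHW -mulrA; have [->|->] := block_absorb (proj1 (eP sWD)) cF iF;
    [left | right; rewrite mulr0].
have NN W : Q \proper W -> W \subset N -> br N (br W l * br W F) = br N l * br N F.
  move=> QW sWN; have sWD := subset_trans sWN sND; have pW := pgroupS sWD pD.
  rewrite -(brM pk pW (fixed_byS sWN flN) (fixed_byS sWN fF)) br_br //.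
  exact: (brM pk pN flN fF).
have brN : br N l != 0 by apply: contraNneq brl => E; rewrite -(br_br l sND) E linear0.
have central z : sfix 'C(Q)%G 'C(Q)%G z -> z * z = z -> fixed_by N z ->
    (forall W, Q \proper W -> W \subset N -> br W l * br W z = 0) -> br Q l * z = 0.
  rewrite {1 2}NE; by move=> cz zz fz; apply: (br_orthogonal pk (sub1G Q) pQD (norms1 D) pD lP brl cz zz fz).
have [full | none] := absorb N QN (subxx N); last first.
  case/eqP: neq0; rewrite -Fe mulrA central ?mul0r // => W QW sWN.
  have [EW|//] := absorb W QW sWN.
  by case/eqP: brN; rewrite -(br_br l sWN) -EW NN // none.
have lF : br Q l * F = br Q l.
  apply/eqP; rewrite eq_sym -subr_eq0 -[X in X - _]mulr1 -mulrBr; apply/eqP.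
  apply: central.
  - exact: (subalgB (sfix_subalg _ _ _) (sfix1 _ _ _)).
  - by rewrite mulrBr mulr1 mulrBl mul1r FF subrr subr0.
  - by apply: (subalgB (fixed_subalg _ N)) => //; apply: fixed_by1.
  move=> W QW sWN; rewrite linearB /= br1 mulrBr mulr1.
  have [->|EW] := absorb W QW sWN; first by rewrite subrr.
  by case/eqP: brN; rewrite -full -(NN W) // EW linear0.
have [StN | nStN] := eqVneq St N.
  by rewrite -{2}lF /F StN rel_trace_id // -StN.
have pSt : St \proper N by rewrite properEneq nStN.
case/eqP: brN; rewrite -(br_br l sQN) -lF.
have flQN : fixed_by N (br Q l) by apply: br_fixed.
rewrite /F -rel_trace_mull // (br_rel_trace0 pk) //.
by apply: (subalgM (fixed_subalg _ St)) => //; apply: fixed_byS flQN.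
Qed.

Lemma br_l_neq0 Q : Q \subset D -> br Q l != 0.
Proof. by move=> sQD; apply: contraNneq brl => E; rewrite -(br_br l sQD) E linear0. Qed.

Lemma block_unique Q f : Q \subset D -> is_block 'C(Q)%G f -> br Q l * f != 0 -> f = e Q.
Proof.
move=> sQD fB n0; apply/esym/(block_eq (proj1 (eP sQD)) fB).
by apply: contraNneq n0 => E; rewrite -(br_block sQD) -mulrA E mulr0.
Qed.

Lemma block_conjD Q d : Q \subset D -> d \in D -> gconj d (e Q) = e (Q :^ d^-1)%G.
Proof.
move=> sQD dD; have sQdD : (Q :^ d^-1)%G \subset D.
  by rewrite /= -(conjGid (groupVr dD)) conjSg.
have [eB n0] := eP sQD; apply: block_unique => //; first exact: block_gconj.
rewrite -{1}(fl dD) br_gconj -rmorphM; apply: contraNneq n0 => E.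
by apply/eqP/(gconj_inj (g := d)); rewrite E raddf0.
Qed.

Lemma block_fixed Q (N : {group gT}) : Q \subset D -> N \subset 'N_D(Q)%g -> fixed_by N (e Q).
Proof.
move=> sQD sN u uN; have /setIP[uD uQ] := subsetP sN _ uN; rewrite block_conjD //.
by congr e; apply/val_inj; rewrite /= (normP _) // groupV.
Qed.

(** The image of e V at W contains or kills e W, and the image of l lies in both. *)
Lemma block_chain V W : W \subset D -> V \subset W -> W \subset 'N(V)%g ->
  br W (e V) * e W = e W.
Proof.
move=> sWD sVW sWN; have sVD := subset_trans sVW sWD; have pW := pgroupS sWD pD.
have fW : fixed_by W (e V) by apply: block_fixed; rewrite // subsetI sWD.
have [cV eeV] := block_idem sVD; have [cb ib] := br_center pk sVW pW cV eeV fW.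
have [sW cW] := cb; have [[sWe _] _] := block_idem sWD.
rewrite (comm_of_fixed cW sWe); have [//|E] := block_absorb (proj1 (eP sWD)) cb ib.
case/eqP: (br_l_neq0 sWD); have fbl : fixed_by W (br V l).
  by apply: br_fixed => //; apply: fixed_byS fl.
rewrite -(br_br l sVW) -(br_block sVD) (brM pk) // br_br // -(br_block sWD).
by rewrite -mulrA E mulr0.
Qed.

(** The same for a primitive idempotent j of (kC(R))^T instead of l; here the e W are
known to be fixed and compatible, so that br_orthogonal applies to 1 - e V at once. *)
Lemma br_block_local R T j V : T \subset D -> R \subset T -> T \subset 'N(R)%g ->
    primitive_idempotent_in (sfix 'C(R)%G T) j -> br T j * e T != 0 ->
    R \subset V -> V \subset T -> br V j * e V = br V j.
Proof.
move=> sTD sRT sTN jP neT sRV sVT; have pT := pgroupS sTD pD.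
have [[sj fj] jj _ _] := jP.
have bj : br T j != 0 by apply: contraNneq neT => ->; rewrite mul0r.
have [n] := ubnP (#|T| - #|V|); elim: n V sRV sVT => // n IH V sRV sVT leV.
have sVD := subset_trans sVT sTD; have pV := pgroupS sVD pD.
have [[seV ceV] eeV] := block_idem sVD; have fjV := fixed_byS sVT fj.
have brjV := br_idem pk pV fjV jj.
have comm : br V j * e V = e V * br V j.
  by apply/esym; apply: comm_of_fixed ceV (@br_in _ _ V j).
have [TV | nTV] := eqVneq T V.
  rewrite -{}TV in seV ceV eeV brjV comm *.
  have [|||||//] := br_primitive pk sRT sTN pT jP bj (y := br T j * e T).
  - by apply: (subalgM (in_subalg_subalg _ _)) => //; apply: br_in.
  - by rewrite mulrA -(mulrA (br T j)) -comm mulrA brjV -mulrA eeV.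
  - by rewrite mulrA brjV.
  - by rewrite -mulrA -comm mulrA brjV.
  by move/eqP; rewrite (negPf neT).
have pVT : V \proper T by rewrite properEneq eq_sym nTV.
apply/esym/eqP; rewrite -subr_eq0 -[X in X - _]mulr1 -mulrBr; apply/eqP.
have fN : fixed_by 'N_T(V)%G (e V) by apply: block_fixed; rewrite // setSI.
apply: (br_orthogonal pk sRV pVT sTN pT jP bj).
- exact: (subalgB (sfix_subalg _ _ _) (sfix1 _ _ _)).
- by rewrite mulrBr mulr1 mulrBl mul1r eeV subrr subr0.
- by apply: (subalgB (fixed_subalg _ _)) => //; apply: fixed_by1.
move=> W VW sWN; have sWT : W \subset T := subset_trans sWN (subsetIl _ _).
have sWD := subset_trans sWT sTD; rewrite linearB /= br1.
have sWNV : W \subset 'N(V)%g := subset_trans sWN (subsetIr _ _).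
rewrite -(IH W) //; last 2 first.
- exact: subset_trans (proper_sub VW).
- rewrite -ltnS; apply: leq_trans leV; rewrite ltnS.
  by apply: ltn_sub2l; rewrite proper_card // (sub_proper_trans (proper_sub VW)) // proper_card.
have [[sW cW] eeW] := block_idem sWD; have pW := pgroupS sWD pD.
have sVW := proper_sub VW.
rewrite -mulrA mulrBr mulr1 (comm_of_fixed cW (@br_in _ _ W (e V))) block_chain //.
by rewrite subrr mulr0.
Qed.

End SourceIdempotent.

(** * Conjugacy of Brauer pairs *)

Section PairStabiliser.
Variables (k : fieldType) (gT : finGroupType).
Implicit Types (f : galg k gT) (g h u : gT) (Q R : {group gT}).

Definition pair_stab_set Q f := [set u in 'N(Q)%g | gconj u f == f].

Fact pair_stab_group_set Q f : group_set (pair_stab_set Q f).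
Proof.
apply/group_setP; split=> [|u v]; first by apply/setIdP; rewrite group1 gconj1.
move=> /setIdP[uN /eqP Eu] /setIdP[vN /eqP Ev].
by apply/setIdP; rewrite groupM // gconjM Ev Eu.
Qed.

Definition pair_stab Q f := Group (pair_stab_group_set Q f).

Lemma pair_stabP Q f u : reflect (u \in 'N(Q)%g /\ gconj u f = f) (u \in pair_stab Q f).
Proof. by apply: (iffP setIdP) => -[? /eqP]. Qed.

Lemma pair_stab_norm Q f : pair_stab Q f \subset 'N(Q)%g.
Proof. by apply/subsetP=> u /pair_stabP[]. Qed.

Lemma pair_stab_fixed Q f : fixed_by (pair_stab Q f) f.
Proof. by move=> u /pair_stabP[]. Qed.

Lemma cent_pair_stab Q f : fixed_by 'C(Q)%G f -> 'C(Q)%g \subset pair_stab Q f.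
Proof.
move=> cf; apply/subsetP=> u uC; apply/pair_stabP; split; last exact: cf.
exact: (subsetP (cent_sub Q)).
Qed.

Lemma sub_pair_stab Q f : in_subalg 'C(Q)%G f -> Q \subset pair_stab Q f.
Proof.
move=> sf; apply/subsetP=> u uQ; apply/pair_stabP; split; last exact: in_cent_fixed sf _ _.
exact: (subsetP (normG Q)).
Qed.

Lemma block_stab_primitive Q f : is_block 'C(Q)%G f ->
  primitive_idempotent_in (sfix 'C(Q)%G (pair_stab Q f)) f.
Proof.
move=> /blockP[[sf cf] ff f0 prim]; split=> //; first by split=> //; apply: pair_stab_fixed.
move=> e1 e2 [s1 f1] [s2 f2]; apply: prim; split=> //.
  exact: fixed_byS (cent_pair_stab cf) f1.
exact: fixed_byS (cent_pair_stab cf) f2.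
Qed.

Lemma pair_stab_conj Q f x : (pair_stab Q f :^ x^-1)%G = pair_stab (Q :^ x^-1)%G (gconj x f).
Proof.
apply/val_inj/setP=> u; rewrite /= mem_conjgV.
have -> : (u ^ x \in pair_stab_set Q f)%g = (u ^ x \in pair_stab Q f)%g by [].
have -> : (u \in pair_stab_set (Q :^ x^-1)%G (gconj x f)) =
          (u \in pair_stab (Q :^ x^-1)%G (gconj x f)) by [].
have E : gconj (u ^ x)%g f = gconj x^-1%g (gconj u (gconj x f)).
  by rewrite conjgE !gconjM.
apply/pair_stabP/pair_stabP; rewrite E normJ mem_conjgV => -[uN uf]; split=> //.
  by rewrite -{2}uf gconjKV.
by rewrite uf gconjK.
Qed.

End PairStabiliser.

Section PairConjugacy.
Variables (k : fieldType) (gT : finGroupType) (p : nat).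
Hypothesis pk : p \in [pchar k].
Implicit Types (a c f i j x y z : galg k gT) (S : galg k gT -> Prop).
Implicit Types (g h u : gT) (C H P Q R T V W : {group gT}).
Variables (D : {group gT}) (b l : galg k gT) (e : {group gT} -> galg k gT).
Hypothesis src : source_pairs p D l e.
Hypothesis bP : primitive_idempotent_in (sfix 'C(1)%G [set: gT]%G) b.
Hypothesis bl : b * l = l.
Variable cD : galg k gT.
Hypotheses (fcD : fixed_by D cD) (bE : b = rel_trace D [set: gT]%G cD).

Let pD := sp_pgroup src.
Let lP := sp_primitive src.
Let brl := sp_local src.
Let eP := sp_block src.
Let fl : fixed_by D l. Proof. by case: lP => [[]]. Qed.
Let fb : fixed_by [set: gT]%G b. Proof. by case: bP => [[]]. Qed.

Lemma b_central a : b * a = a * b.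
Proof. by apply: (comm_of_fixed fb); apply: in_subalgT. Qed.

(** Let b be a trace from D of multiples of the primitive idempotent j.  By trace_local
the idempotent l, which lies in b and survives at D, is isomorphic to a conjugate of j,
and m is a multiple of a conjugate of j. *)
Lemma below_source T m : (p.-group T)%g ->
    primitive_idempotent_in (sfix 'C(1)%G T) m -> b * m = m -> br T m != 0 ->
  exists g, T \subset (D :^ g^-1)%g /\
    exists x y, [/\ fixed_by T x, fixed_by T y & m = x * gconj g l * y].
Proof.
move=> pT mP bm brm.
have n1 (A : {group gT}) : A \subset 'N(1%G)%g by apply: norms1.
have [d [j [dS jP bj E]]] := trace_from_primitive (subsetT D) (n1 _) bP
  (fun a _ => b_central a) (conj (@in_subalg_C1 _ _ cD) fcD) bE.
have [[_ fj] jj _ _] := jP.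
have [h [_ sDh [x [y [Sx Sy lE]]]]] :=
  trace_local pk (subsetT D) (subsetT D) (n1 _) pD dS (conj (@in_subalg_C1 _ _ j) fj) E lP bl brl.
have Dh : (D :^ h^-1)%G = D.
  by apply/val_inj/eqP; rewrite /= eq_sym eqEcard sDh cardJg leqnn.
have hjP : primitive_idempotent_in (sfix 'C(1)%G D) (gconj h j).
  have C1 : ('C(1) :^ h^-1)%G = 'C(1)%G by apply/val_inj; rewrite /= -centJ conjs1g.
  by have := primitive_gconj h jP; rewrite Dh C1.
have [x' [y' [Sx' Sy' xyl yxj]]] := primitive_iso (sfix_subalg _ _ _) lP hjP Sx Sy lE.
have [[_ fx'] [_ fy']] := (Sx', Sy').
have [_ hjj _ _] := hjP.
have jE : gconj h j = y' * l * x' by rewrite -xyl !mulrA yxj -mulrA yxj hjj.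
have [g [_ sTg [u [v [[_ fu] [_ fv] mE]]]]] :=
  trace_local pk (subsetT D) (subsetT T) (n1 _) pT dS (conj (@in_subalg_C1 _ _ j) fj) E mP bm brm.
pose w := (g * h^-1)%g.
have Dw : (D :^ w^-1 = D :^ g^-1)%g.
  by rewrite /w invMg invgK conjsgM -{1}(congr1 val Dh) /= conjsgKV.
have fw a : fixed_by D a -> fixed_by T (gconj w a).
  by move=> fa; apply: (fixed_byS _ (fixed_by_gconj (g := w) fa)); rewrite /= Dw.
exists w; split; first by rewrite Dw.
exists (u * gconj w y'), (gconj w x' * v); split.
- by apply: (subalgM (fixed_subalg _ _)) => //; apply: fw.
- by apply: (subalgM (fixed_subalg _ _)) => //; apply: fw.
have -> : m = u * gconj w (gconj h j) * v by rewrite -gconjM mulgKV.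
by rewrite jE !rmorphM /= !mulrA.
Qed.

(** The image of b contains or kills the block e Q, and it contains that of l. *)
Lemma br_b_block Q : Q \subset D -> e Q * br Q b = e Q.
Proof.
move=> sQD; have pQ := pgroupS sQD pD; have flQ := fixed_byS sQD fl.
have [[_ cb] bb _ _] := bP; have fbQ := fixed_byS (subsetT Q) fb.
have [cbr ibr] := br_center pk (sub1G Q) pQ
   (conj (@in_subalg_C1 _ _ b) (fixed_byS (subsetT _) fb)) bb fbQ.
have [//|E] := block_absorb (proj1 (eP sQD)) cbr ibr.
case/eqP: (br_l_neq0 src sQD).
by rewrite -bl b_central (brM pk) // -(br_block pk src sQD) -mulrA E mulr0.
Qed.

(** Some primitive idempotent m of (kG)^T in b has an image which meets f.  By
below_source m is a multiple of a conjugate of l, whose image must meet f too; undoing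
the conjugation, f becomes the block determined by l. *)
Lemma pair_to_source Q T f : Q \subset D -> Q \subset T -> T \subset pair_stab Q (e Q) ->
    (p.-group T)%g -> is_block 'C(T)%G f -> br T (e Q) * f != 0 ->
  exists x : gT, [/\ (T :^ x^-1)%g \subset D, gconj x f = e (T :^ x^-1)%G &
    gconj x (e Q) = e (Q :^ x^-1)%G].
Proof.
move=> sQD sQT sTH pT fB n0.
have sTN := subset_trans sTH (@pair_stab_norm _ _ _ _).
have feQ : fixed_by T (e Q) := fixed_byS sTH (@pair_stab_fixed _ _ _ _).
have [[seQ ceQ] eeQ] := block_idem src sQD.
have [cbr ibr] := br_center pk sQT pT (conj seQ ceQ) eeQ feQ.
have [[sf cf] ff _ _] := (proj1 (blockP _ _)) fB.
have [sbr fbr] := cbr.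
have fe : br T (e Q) * f = f.
  rewrite (comm_of_fixed fbr sf); have [//|E] := block_absorb fB cbr ibr.
  by rewrite (comm_of_fixed fbr sf) E eqxx in n0.
have [_ bb _ _] := bP; have fbT := fixed_byS (subsetT T) fb.
have fbb : br T b * f = f.
  rewrite -{1}fe mulrA -(br_br b sQT) -(brM pk) //; last first.
    by apply: br_fixed => //.
  have -> : br Q b * e Q = e Q.
    rewrite -[RHS](br_b_block sQD); apply/esym; apply: (comm_of_fixed ceQ).
    exact: br_in.
  by rewrite fe.
have [|m [mP nm bm _]] := primitive_local (sub1G T) (norms1 T) pT
   (conj (@in_subalg_C1 _ _ b) fbT) bb sf.
  by rewrite fbb; case: ((proj1 (blockP _ _)) fB).
have brm : br T m != 0 by apply: contraNneq nm => ->; rewrite mul0r.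
have [g [sTg [x [y [fx fy mE]]]]] := below_source pT mP bm brm.
have fgl : fixed_by T (gconj g l).
  by apply: (fixed_byS _ (fixed_by_gconj (g := g) fl)).
have nglf : br T (gconj g l) * f != 0.
  apply: contraNneq nm => E; rewrite mE (brM pk pT (subalgM (fixed_subalg _ T) fx fgl) fy).
  rewrite (brM pk pT fx fgl) -mulrA -(comm_of_fixed cf (@br_in _ _ T y)) mulrA.
  by rewrite -(mulrA (br T x)) E mulr0 mul0r.
have sTD : (T :^ g^-1^-1)%G \subset D by rewrite /= sub_conjgV.
have moved a : br (T :^ g^-1^-1)%G (gconj g^-1%g a) = gconj g^-1%g (br T a) by apply: br_gconj.
have gf : gconj g^-1%g f = e (T :^ g^-1^-1)%G.
  apply: (block_unique pk src sTD); first exact: block_gconj.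
  rewrite -{1}[l](gconjK g) moved -rmorphM; apply: contraNneq nglf => E.
  by apply/eqP/(gconj_inj (g := g^-1%g)); rewrite E raddf0.
exists g^-1%g; split=> //.
have sQgD : (Q :^ g^-1^-1)%G \subset D by apply: subset_trans sTD; rewrite /= conjSg.
apply: (block_unique pk src sQgD); first by apply: block_gconj; case: (eP sQD).
apply/eqP=> E; case/eqP: (br_l_neq0 src sTD).
have sQTg : (Q :^ g^-1^-1)%G \subset (T :^ g^-1^-1)%G by rewrite /= conjSg.
have nTQ : (T :^ g^-1^-1)%G \subset 'N(Q :^ g^-1^-1)%g by rewrite /= normJ conjSg.
have := congr1 (fun a => br (T :^ g^-1^-1)%G a * gconj g^-1%g f) E.
rewrite linear0 mul0r (brM pk) ?pgroupJ //; first last.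
- exact: fixed_by_gconj.
- by apply: br_fixed => //; apply: fixed_byS fl.
by rewrite br_br // moved -mulrA -rmorphM /= fe gf (br_block pk src sTD).
Qed.

(** Receptivity of R, for T a defect group of (R, e R) inside D.  Let N = N_D(Q) and
choose a primitive idempotent i of (kC(Q))^N below e Q whose image meets e N.  Transported
by s it lies below e R, so by trace_local an element h of the stabiliser of (R, e R)
moves it below j and N into T.  As the images of j lie in the blocks e V, the
map w = h^-1 s sends e N to the block of its image. *)
Lemma extend_to_normaliser R T d j Q s :
    R \subset T -> T \subset D -> T \subset pair_stab R (e R) ->
    sfix 'C(R)%G T d -> primitive_idempotent_in (sfix 'C(R)%G T) j ->
    e R = rel_trace T (pair_stab R (e R)) (d * j) -> br T j * e T != 0 ->
    Q \subset D -> (Q :^ s^-1)%G = R -> gconj s (e Q) = e R ->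
  exists w : gT, [/\ ('N_D(Q) :^ w^-1)%g \subset T,
    gconj w (e 'N_D(Q)%G) = e ('N_D(Q) :^ w^-1)%G, (Q :^ w^-1)%G = R &
    gconj w (e Q) = e R].
Proof.
move=> sRT sTD sTH dS jP eRE neT sQD QsR eQs; have sRD := subset_trans sRT sTD.
pose H := pair_stab R (e R); have sHN : H \subset 'N(R)%g := @pair_stab_norm _ _ _ _.
have sTN := subset_trans sTH sHN.
have [N NE] : {N : {group gT} | N = 'N_D(Q)%G} by exists 'N_D(Q)%G.
rewrite -!NE -[('N_D(Q))%g]/(val 'N_D(Q)%G) -NE.
have sND : N \subset D by rewrite NE subsetIl.
have sNQ : N \subset 'N(Q)%g by rewrite NE subsetIr.
have sQN : Q \subset N by rewrite NE subsetI sQD normG.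
have pN := pgroupS sND pD.
have fN : fixed_by N (e Q) by apply: (block_fixed pk src) => //; rewrite NE.
have [[seQ ceQ] eeQ] := block_idem src sQD.
have [[seN ceN] eeN] := block_idem src sND.
have [|i [iP ni ei _]] := primitive_local sQN sNQ pN (conj seQ fN) eeQ seN.
  by rewrite (block_chain pk src) //; have [/blockP[]] := eP sND.
have [[si fi] _ _ _] := iP.
have sNH : (N :^ s^-1)%G \subset H.
  apply/subsetP=> u; rewrite /= mem_conjgV => uN; apply/pair_stabP; split.
    by rewrite -QsR /= normJ mem_conjgV (subsetP sNQ).
  rewrite -eQs -gconjM -[in RHS](fN _ uN) -gconjM; congr (gconj _ _).
  by rewrite conjgE mulKVg.
have siP := primitive_gconj s iP.
have CR : ('C(Q) :^ s^-1)%G = 'C(R)%G by apply/val_inj; rewrite /= -QsR /= centJ.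
rewrite CR in siP.
have [[_ fj] jj _ _] := jP; have [[sj _] _ _ _] := jP.
have esi : e R * gconj s i = gconj s i by rewrite -eQs -rmorphM ei.
have bsi : br (N :^ s^-1)%G (gconj s i) != 0.
  rewrite br_gconj; apply: contraNneq ni => E; apply/eqP/(gconj_inj (g := s)).
  by rewrite rmorphM /= E mul0r raddf0.
have pNs : (p.-group (N :^ s^-1)%G)%g by rewrite /= pgroupJ.
have [h [hH sNsT [x [y [[_ fx] [_ fy] iE]]]]] :=
  trace_local pk sTH sNH sHN pNs dS (conj sj fj) eRE siP esi bsi.
pose w := (h^-1 * s)%g; pose V := (N :^ w^-1)%G.
have wV (A : {set gT}) : (A :^ w^-1 = (A :^ s^-1) :^ h)%g by rewrite /w invMg invgK conjsgM.
have sVT : V \subset T by rewrite /= wV sub_conjg.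
have Qw : (Q :^ w^-1)%G = R.
  apply/val_inj; rewrite /= wV (congr1 val QsR : (Q :^ s^-1)%g = R).
  by apply/normP; apply: (subsetP sHN).
have eQw : gconj w (e Q) = e R.
  by rewrite gconjM eQs; apply: (@pair_stab_fixed _ _ R (e R)); rewrite groupV.
exists w; split=> //.
have sVD := subset_trans sVT sTD; have pV := pgroupS sVD pD.
apply: (block_unique pk src sVD); first by apply: block_gconj; case: (eP sND).
have sRV : R \subset V by rewrite -Qw /= conjSg.
have fhV a : fixed_by (N :^ s^-1)%G a -> fixed_by V (gconj h^-1%g a).
  move=> /(fixed_by_gconj (g := h^-1%g)); rewrite invgK.
  by congr (fixed_by _ _); apply/val_inj; rewrite /= wV.
have wiE : gconj w i = gconj h^-1%g x * j * gconj h^-1%g y.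
  by rewrite gconjM iE [gconj _ (_ * y)]rmorphM /= [gconj _ (x * _)]rmorphM /= gconjK.
have BB : is_block 'C(V)%G (gconj w (e N)) by apply: block_gconj; case: (eP sND).
have [[sB cB] _ _ _] := (proj1 (blockP _ _)) BB.
have fjV := fixed_byS sVT fj; have fxV := fhV _ fx; have fyV := fhV _ fy.
have nj : br V j * gconj w (e N) != 0.
  apply: contraNneq ni => E; apply/eqP/(gconj_inj (g := w)).
  rewrite rmorphM /= -br_gconj -/V wiE.
  rewrite (brM pk pV (subalgM (fixed_subalg _ V) fxV fjV) fyV) (brM pk pV fxV fjV).
  rewrite -mulrA -(comm_of_fixed cB (@br_in _ _ V _)) mulrA -(mulrA (br V (gconj _ x))).
  by rewrite E mulr0 mul0r raddf0.
have EV : e V = gconj w (e N).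
  apply: (block_eq (proj1 (eP sVD)) BB); apply: contraNneq nj => E.
  by rewrite -(br_block_local pk src sTD sRT sTN jP neT sRV sVT) -mulrA E mulr0.
by rewrite -EV (br_block pk src sVD) (br_l_neq0 src sVD).
Qed.

End PairConjugacy.

(** * Fusion modulo a subgroup containing the hyperfocal subgroup *)

Section FusionModulo.
Variables (k : fieldType) (gT : finGroupType) (p : nat).
Hypothesis pk : p \in [pchar k].
Hypothesis closed_k : GRing.closed_field_axiom k.
Implicit Types (a c f i j x y z : galg k gT) (S : galg k gT -> Prop).
Implicit Types (g h u v : gT) (C H P Q R T L V W : {group gT}).

(** Evaluating f = Tr_L^H(fz) at the residue field k of the local ring Z(kC(R))f, on
which H acts trivially, shows that |H : L| is invertible in k. *)
Lemma index_coprime R H T L f c : is_block 'C(R)%G f -> H \subset 'N(R)%g -> fixed_by H f ->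
    T \subset L -> L \subset H -> 'C(R)%g \subset L ->
    sfix 'C(R)%G T c -> f = rel_trace T H c -> ~~ (p %| #|H : L|)%N.
Proof.
move=> fB sHN fH sTL sLH sCL [sc fc] fE; apply/negP => pdiv.
have fP := proj1 (blockP _ _) fB; have sS := sfix_subalg k 'C(R)%G 'C(R)%G.
have [[sf cf] ff f0 _] := fP.
pose z := rel_trace T L c; have fz : fixed_by L z := rel_trace_fixed sTL fc.
have sNH g : g \in H -> g \in 'N('C(R))%g by apply: norm_cent sHN.
have sz : in_subalg 'C(R)%G z.
  apply: (subalg_sum (in_subalg_subalg _ _)) => [g gC|X XL]; first by rewrite gcoef0.
  have [rL _] := repr_lcosets XL sTL.
  by apply: in_subalg_norm => //; apply: sNH; apply: (subsetP sLH).
have zE : f = rel_trace L H (f * z).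
  by rewrite rel_trace_mull // -(rel_trace_trans sTL) // -fE ff.
have Sz : sfix 'C(R)%G 'C(R)%G z by split=> //; apply: fixed_byS fz.
have corn : corner (sfix 'C(R)%G 'C(R)%G) f (f * z).
  split; [exact: (subalgM sS) | by rewrite mulrA ff |].
  by rewrite -mulrA -(comm_of_fixed cf sz) mulrA ff.
have [r nr] := corner_eigenvalue sS fP closed_k corn.
pose n := f * z - r *: f.
have corn_n : corner (sfix 'C(R)%G 'C(R)%G) f n by apply: cornerB => //; apply: cornerZ.
have conj_n h : h \in H -> corner (sfix 'C(R)%G 'C(R)%G) f (gconj h n) /\ nilpot (gconj h n).
  move=> hH; have [[sn cn] fn nf] := corn_n; split.
    split.
    - split; first by apply: in_subalg_norm => //; apply: sNH.
      have := fixed_by_gconj (g := h) cn; congr (fixed_by _ _); apply/val_inj => /=.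
      by apply/normP; rewrite groupV; apply: sNH.
    - by rewrite -(fH h hH) -rmorphM fn.
    by rewrite -(fH h hH) -rmorphM nf.
  by have [m E] := nr; exists m; rewrite -rmorphXn /= E raddf0.
case/eqP: f0; apply: nilp_idem ff _.
have -> : f = \sum_(X in lcosets L H) gconj (repr X) n.
  transitivity (rel_trace L H (f * z) - rel_trace L H (r *: f)).
    rewrite -zE rel_traceZ rel_trace_const //.
    have /dvdnP[m ->] := pdiv.
    have p0 (a : galg k gT) : a *+ p = 0.
      by rewrite -scaler_nat pcharf0 // scale0r.
    by rewrite mulrnA p0 scaler0 subr0.
  rewrite /rel_trace -sumrB; apply: eq_bigr => X _.
  by rewrite raddfB.
have [] // : corner (sfix 'C(R)%G 'C(R)%G) f (\sum_(X in lcosets L H) gconj (repr X) n)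
     /\ nilpot (\sum_(X in lcosets L H) gconj (repr X) n).
apply: (big_ind (fun z => corner (sfix 'C(R)%G 'C(R)%G) f z /\ nilpot z)).
- by split; [apply: corner0 | apply: nilp0].
- by move=> x y [xS nx] [yS ny]; split; [apply: cornerD | apply: (nilpD sS fP)].
by move=> X XH; apply: conj_n; case: (repr_lcosets XH sLH).
Qed.

Variables (D Dt : {group gT}) (b l : galg k gT) (e : {group gT} -> galg k gT).
Hypothesis src : source_pairs p D l e.
Hypothesis nDt : (Dt <| D)%g.
Hypothesis hypDt : hyperfocal D e p \subset Dt.

Let pD := sp_pgroup src.
Let eP := sp_block src.

(** Conjugation by y is a p'-element of Aut_F(R); it lies in every normal subgroup of
p-power index. *)
Lemma p_regular_hyperfocal R (y u : gT) : R \subset D -> y \in pair_stab R (e R) ->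
  (p^'.-elt y)%g -> u \in R -> (u * (u ^ y^-1)^-1)%g \in Dt.
Proof.
move=> sRD yH py uR; have [yN ye] := pair_stabP _ _ _ yH.
apply: (subsetP hypDt); apply: mem_gen; apply/bigcupP; exists R => //.
pose a := conj_aut R y^-1%g; have yVN : y^-1%g \in 'N(R)%g by rewrite groupV.
have aE v : v \in R -> a v = (v ^ y^-1)%g by move=> vR; rewrite norm_conj_autE.
have aAut : a \in Aut R.
  by apply: (subsetP (Aut_conj_aut R 'N(R)%G)); apply: mem_morphim.
have RyR : (R :^ y^-1)%G = R by apply/val_inj; rewrite /= (normP yVN).
pose X := Group (fusion_aut_group_set e sRD).
have aX : a \in X.
  rewrite inE aAut /fusion_hom sRD /=; apply/existsP; exists y.
  rewrite RyR ye eqxx (normP yVN) subxx /=.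
  by apply/forall_inP=> v vR; rewrite aE.
apply/imset2P; exists u a => //; last by rewrite aE ?groupV // conjVg.
apply/bigcapP=> N /andP[nNX pXN].
have aN : a \in 'N(N)%g := subsetP (normal_norm nNX) _ aX.
apply: coset_idr => //; apply/eqP; rewrite -order_eq1.
have pa : (p^'.-elt (coset N a))%g.
  apply: morph_p_elt => //; rewrite /a; apply: (morph_p_elt (conj_aut_morphism R)) => //.
  by rewrite p_eltV.
have pa' : (p.-elt (coset N a))%g by apply: (mem_p_elt (G := (X / N)%G) pXN); apply: mem_quotient.
by apply/eqP; apply: (pnat_1 pa' pa).
Qed.

Definition mod_conj Q (g d : gT) : Prop :=
  forall u, u \in Q -> coset Dt (u ^ g^-1)%g = coset Dt (u ^ d^-1)%g.

(** The stabiliser H of (R, e R) is generated by the defect group T, by C(R) and by the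
p'-elements: no q <> p divides the index, since Sylow q-subgroups consist of p'-elements,
and p does not by index_coprime.  Elements of T lie in D, those of C(R) act trivially on
R, and p'-elements act trivially modulo Dt. *)
Lemma stabiliser_mod R T c n : R \subset D -> T \subset D -> T \subset pair_stab R (e R) ->
    sfix 'C(R)%G T c -> e R = rel_trace T (pair_stab R (e R)) c ->
    n \in pair_stab R (e R) ->
  exists2 d, d \in D & mod_conj R n d.
Proof.
move=> sRD sTD sTH cS eE nH; set H := pair_stab R (e R) in sTH eE nH *.
have sHN : H \subset 'N(R)%g := @pair_stab_norm _ _ _ _.
have [[seR ceR] eeR] := block_idem src sRD.
have sCH : 'C(R)%g \subset H := cent_pair_stab ceR.
have sDN : D \subset 'N(Dt)%g := normal_norm nDt.
pose gens := (T :|: 'C(R) :|: [set y in H | (p^'.-elt y)%g])%g.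
pose L := <<gens>>%G.
have sLH : L \subset H.
  rewrite gen_subG !subUset sTH sCH /=.
  by apply/subsetP=> y /setIdP[].
have sgL : gens \subset L by apply: subset_gen.
have sTL : T \subset L.
  by apply: subset_trans sgL; rewrite /gens -setUA subsetUl.
have sCL : 'C(R)%g \subset L.
  by apply: subset_trans sgL; rewrite /gens [T :|: _]setUC -setUA subsetUl.
have npdiv := index_coprime (proj1 (eP sRD)) sHN (@pair_stab_fixed _ _ _ _) sTL sLH sCL cS eE.
have HL : H \subset L.
  rewrite -indexg_eq1; apply: contraT => n1.
  have [q q_pr qdiv] : exists2 q, prime q & (q %| #|H : L|)%N.
    by exists (pdiv #|H : L|); rewrite ?pdiv_dvd // pdiv_prime // ltn_neqAle eq_sym n1 indexg_gt0.
  have qp : q != p by apply: contraNneq npdiv => <-.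
  have [Q sylQ] := Sylow_exists q H.
  have sQL : Q \subset L.
    apply: subset_trans sgL; apply/subsetP=> y yQ; apply/setUP; right.
    apply/setIdP; split; first exact: (subsetP (pHall_sub sylQ)).
    have := mem_p_elt (pHall_pgroup sylQ) yQ; apply: sub_in_pnat => r _ /eqP ->.
    by rewrite inE /= inE.
  have : q^'.-nat #|H : Q| by case/and3P: sylQ.
  by rewrite p'natE // (dvdn_trans qdiv) // indexgS.
pose B := [set n in H | [exists d in D, [forall u in R,
   coset Dt (u ^ n^-1)%g == coset Dt (u ^ d^-1)%g]]].
have BP m : reflect (m \in H /\ exists2 d, d \in D & mod_conj R m d) (m \in B).
  apply: (iffP setIdP) => -[mH].
    move=> /existsP[d /andP[dD /forall_inP Pd]]; split=> //; exists d => // u uR.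
    exact/eqP/Pd.
  move=> [d dD Pd]; split=> //; apply/existsP; exists d; rewrite dD /=.
  by apply/forall_inP=> u uR; apply/eqP/Pd.
have gB : group_set B.
  apply/group_setP; split=> [|m m'].
    by apply/BP; split=> //; exists 1%g.
  move=> /BP[mH [d dD Pd]] /BP[mH' [d' dD' Pd']]; apply/BP; split; first exact: groupM.
  exists (d * d')%g; first exact: groupM.
  move=> u uR; rewrite !invMg !conjgM.
  have um : (u ^ m'^-1)%g \in R by rewrite memJ_norm // groupV (subsetP sHN).
  have ND v : v \in D -> v \in 'N(Dt)%g := subsetP sDN v.
  have [uD umD] := (subsetP sRD _ uR, subsetP sRD _ um).
  rewrite Pd // morphJ ?ND ?groupV //= Pd' // -morphJ ?ND ?groupV //.
  by rewrite groupJ ?groupV.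
have : L \subset Group gB.
  rewrite gen_subG !subUset -andbA; apply/and3P; split; apply/subsetP=> y yT; apply/BP.
  - by split; [apply: (subsetP sTH) | exists y; [apply: (subsetP sTD)|]].
  - split; first exact: (subsetP sCH); exists 1%g => // u uR.
    rewrite invg1 conjg1 (conjg_fixP _) //; apply/commgP.
    by apply: commuteV; apply: commute_sym; move/centP: yT => /(_ u uR).
  case/setIdP: yT => yH py; split=> //; exists 1%g => // u uR; rewrite invg1 conjg1.
  have uD : u \in D := subsetP sRD _ uR.
  have yN := subsetP sHN _ yH.
  have uyR : (u ^ y^-1)%g \in R by rewrite memJ_norm // groupV.
  have uyD : (u ^ y^-1)%g \in D := subsetP sRD _ uyR.
  have := coset_id (p_regular_hyperfocal sRD yH py uR).
  rewrite morphM ?morphV ?groupV ?(subsetP sDN) // => E.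
  by apply/esym/eqP; rewrite eq_mulgV1 E.
by move=> /subsetP/(_ n); rewrite (subsetP HL) // => /(_ isT) /BP[].
Qed.

Hypothesis bP : primitive_idempotent_in (sfix 'C(1)%G [set: gT]%G) b.
Hypothesis bl : b * l = l.
Variable cD : galg k gT.
Hypotheses (fcD : fixed_by D cD) (bE : b = rel_trace D [set: gT]%G cD).

(** A defect group T of (Q, e Q), with a block of kC(T) that meets j, is moved into
(D, e D) by pair_to_source. *)
Lemma defect_in_source Q : Q \subset D ->
  exists (x : gT) T (d j : galg k gT), let R := (Q :^ x^-1)%G in
    [/\ R \subset T, T \subset D, T \subset pair_stab R (e R) & gconj x (e Q) = e R] /\
    [/\ sfix 'C(R)%G T d, primitive_idempotent_in (sfix 'C(R)%G T) j,
      e R = rel_trace T (pair_stab R (e R)) (d * j) & br T j * e T != 0].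
Proof.
move=> sQD; have [[seQ ceQ] eeQ] := block_idem src sQD; have pQ := pgroupS sQD pD.
have [T [d [j [sTH sQT pT [dS jP ej bj eE]]]]] :=
  defect_point pk (sub_pair_stab seQ) (@pair_stab_norm _ _ Q (e Q)) pQ
    (block_stab_primitive (proj1 (eP sQD))) (fun a sa => comm_of_fixed ceQ sa).
have sTN := subset_trans sTH (@pair_stab_norm _ _ Q (e Q)).
have [[sj fj] jj _ _] := jP.
have [|||f [fP nf _ _]] := primitive_below (S := sfix 'C(T)%G 'C(T)%G) (y := 1)
    (Pr := fun y => br T j * y != 0) (sfix_subalg _ _ _) (sfix1 _ _ _) (mulr1 _).
- by rewrite mulr1.
- by rewrite mulr0 eqxx.
- move=> y1 y2 _ _ _ _ _ _; rewrite mulrDr => n0.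
  have [E1|] := eqVneq (br T j * y1) 0; last by left.
  by right; rewrite E1 add0r in n0.
have fB : is_block 'C(T)%G f by apply/blockP.
have feQ : fixed_by T (e Q) := fixed_byS sTH (@pair_stab_fixed _ _ Q (e Q)).
have n0 : br T (e Q) * f != 0.
  apply: contraNneq nf => E.
  have -> : br T j = br T j * br T (e Q).
    by rewrite -(brM pk) // -(comm_of_fixed ceQ sj) ej.
  by rewrite -mulrA E mulr0.
have [x [sTD xf xe]] := pair_to_source pk src bP bl fcD bE sQD sQT sTH pT fB n0.
have CE : ('C(Q) :^ x^-1)%G = 'C(Q :^ x^-1)%G by apply/val_inj; rewrite /= centJ.
exists x, (T :^ x^-1)%G, (gconj x d), (gconj x j) => R; split; split=> //.
- by rewrite /= conjSg.
- by rewrite -xe -pair_stab_conj /= conjSg.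
- by rewrite -CE; apply: sfix_gconj.
- by rewrite -CE; apply: primitive_gconj.
- rewrite -xe -pair_stab_conj -rmorphM -rel_trace_gconj -?eE //.
  exact: (subalgM (fixed_subalg _ T) (proj2 dS) fj).
rewrite br_gconj -xf -rmorphM; apply: contraNneq nf => E.
by apply/eqP/(gconj_inj (g := x)); rewrite E raddf0.
Qed.

(** Induction on the index of Q in D.  Let R be a conjugate of Q as in
defect_in_source.  By extend_to_normaliser some fusion maps w1 from Q and w2 from the
image of Q onto R extend to the normalisers in D, where the induction hypothesis
applies to them; and w2 g w1^-1 belongs to the stabiliser of (R, e R), which
stabiliser_mod settles. *)
Theorem fusion_mod Q g : Q \subset D -> (Q :^ g^-1)%G \subset D ->
    gconj g (e Q) = e (Q :^ g^-1)%G ->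
  exists2 d, d \in D & mod_conj Q g d.
Proof.
have [n] := ubnP (#|D| - #|Q|); elim: n Q g => // n IH Q g leQ sQD sgD ge.
have [x [T [d [j [[sRT sTD sTH xe] [dS jP eE nj]]]]]] := defect_in_source sQD.
set R := (Q :^ x^-1)%G in sRT sTH xe dS jP eE *.
have sRD := subset_trans sRT sTD; have sDN : D \subset 'N(Dt)%g := normal_norm nDt.
have [[sj fj] _ _ _] := jP; have djS := subalgM (sfix_subalg _ _ _) dS (conj sj fj).
have middle m := stabiliser_mod (n := m) sRD sTD sTH djS eE.
(* the maps w1 and w2 come from here; if Q' = D then R = D and no extension is needed *)
have step Q' s : Q' \subset D -> #|Q'| = #|Q| -> (Q' :^ s^-1)%G = R -> gconj s (e Q') = e R ->
  exists w, [/\ (Q' :^ w^-1)%G = R, gconj w (e Q') = e R & exists2 d', d' \in D & mod_conj Q' w d'].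
  move=> sQD' cQ' QR es.
  have [DQ|nDQ] := eqVneq D Q'.
    have QRs : (D :^ s^-1)%g = R :> {set gT} by rewrite DQ; exact: (congr1 (@gval gT) QR).
    have RD : R = D by apply/val_inj/eqP; rewrite /= eqEcard sRD -QRs cardJg leqnn.
    have sH : s \in pair_stab R (e R).
      apply/pair_stabP; split; last by rewrite {1}RD DQ.
      by rewrite -groupV; apply/normP; rewrite {1}RD.
    by exists s; split=> //; have := middle s sH; rewrite {1}RD DQ.
  have [w [swT we wQ weQ]] := extend_to_normaliser pk src sRT sTD sTH dS jP eE nj sQD' QR es.
  have pQN : Q' \proper 'N_D(Q').
    by apply: nilpotent_proper_norm (pgroup_nil pD) _; rewrite properEneq eq_sym nDQ.
  exists w; split=> //; have [||||d' d'D md] := IH 'N_D(Q')%G w.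
  - rewrite -ltnS; apply: leq_trans leQ; rewrite ltnS -cQ'.
    by apply: ltn_sub2l; rewrite proper_card // properEneq eq_sym nDQ.
  - exact: subsetIl.
  - exact: subset_trans swT sTD.
  - by rewrite we; congr e; apply/val_inj.
  by exists d' => // u uQ; apply: md; apply: (subsetP (proper_sub pQN)).
have [w1 [w1Q w1e [d1 d1D m1]]] := step Q x sQD erefl erefl xe.
have xgQ : ((Q :^ g^-1) :^ (x * g^-1)^-1)%G = R.
  by apply/val_inj; rewrite /= invMg invgK conjsgM conjsgKV.
have xge : gconj (x * g^-1)%g (e (Q :^ g^-1)%G) = e R.
  by rewrite -ge gconjM gconjK.
have [w2 [w2Q w2e [d2 d2D m2]]] := step _ _ sgD (cardJg _ _) xgQ xge.
pose m := (w2 * g * w1^-1)%g.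
have mH : m \in pair_stab R (e R).
  apply/pair_stabP; split; last by rewrite -w1e /m !gconjM gconjK ge w2e.
  rewrite -groupV; apply/normP; rewrite /m !invMg invgK.
  rewrite -{1}w1Q /= mulgA !conjsgM conjsgKV.
  by have := congr1 val w2Q.
have [d3 d3D m3] := middle _ mH.
pose dd := (d1^-1 * (d3^-1 * d2))%g.
exists dd^-1%g; first by rewrite groupV !groupM ?groupV.
move=> u uQ; have uD := subsetP sQD _ uQ.
have ugQ : (u ^ g^-1)%g \in (Q :^ g^-1)%G by rewrite /= memJ_conjg.
have uw : (u ^ w1^-1)%g \in R by rewrite -w1Q /= memJ_conjg.
have E := m3 _ uw.
rewrite -conjgM {1}/m !invMg invgK !mulgA mulVg mul1g conjgM in E.
rewrite m2 // in E.
have ND v : v \in D -> v \in 'N(Dt)%g := subsetP sDN v.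
have ugD := subsetP sgD _ ugQ; have uwD := subsetP sRD _ uw.
have E2 : coset Dt ((u ^ w1^-1) ^ d3^-1)%g = coset Dt ((u ^ d1^-1) ^ d3^-1)%g.
  by rewrite morphJ ?ND ?groupV //= m1 // -morphJ ?ND ?groupJ ?groupV.
transitivity (coset Dt (((u ^ g^-1) ^ d2^-1) ^ d2)%g); first by rewrite conjgKV.
have N1 : ((u ^ g^-1) ^ d2^-1)%g \in 'N(Dt)%g by rewrite ND // groupJ ?groupV.
have N2 : ((u ^ d1^-1) ^ d3^-1)%g \in 'N(Dt)%g by rewrite ND // !groupJ ?groupV.
rewrite (morphJ (coset_morphism Dt) N1 (ND _ d2D)) /= E E2.
rewrite -(morphJ (coset_morphism Dt) N2 (ND _ d2D)) /=.
by rewrite invgK /dd -!conjgM !mulgA.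
Qed.

End FusionModulo.

(** * Blocks with central defect group have a single point *)

Section CentralDefect.
Variables (k : fieldType) (gT : finGroupType) (p : nat).
Hypothesis pk : p \in [pchar k].
Implicit Types (a c f i j s w x y : galg k gT) (S : galg k gT -> Prop).
Implicit Types (g h u v z : gT) (H P Q R T L V : {group gT}).
Variables (D : {group gT}) (f : galg k gT).
Hypothesis pD : (p.-group D)%g.
Hypothesis fB : is_block 'C(D)%G f.

Local Notation C := ('C(D)%G).
Local Notation S := (in_subalg (R := k) C).

Let sS : is_subalg S := in_subalg_subalg k C.
Let sf : S f. Proof. by case: (proj1 (blockP _ _) fB) => [[]]. Qed.
Let cf : fixed_by C f. Proof. by case: (proj1 (blockP _ _) fB) => [[]]. Qed.
Let ff : f * f = f. Proof. by case: (proj1 (blockP _ _) fB). Qed.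
Let f0 : f <> 0. Proof. by case: (proj1 (blockP _ _) fB) => _ _ /eqP. Qed.
Let fC a : S a -> f * a = a * f. Proof. by move=> sa; apply: comm_of_fixed cf sa. Qed.

(** If f is a trace from D to its stabiliser, it is already a trace from D to
DC(D): by locality one of the conjugate partial traces is invertible in the centre. *)
Lemma trace_to_centraliser c : S c -> f = rel_trace D (pair_stab D f) c ->
  exists2 c', S c' & f = rel_trace D (D <*> C)%G c'.
Proof.
move=> sc fE; set H := pair_stab D f in fE; pose L := (D <*> C)%G.
have sDL : D \subset L := joing_subl _ _; have sCL : C \subset L := joing_subr _ _.
have sDH : D \subset H := sub_pair_stab sf; have sCH := cent_pair_stab cf.
have sLH : L \subset H by rewrite join_subG sDH sCH.
have sHN : H \subset 'N(D)%g := @pair_stab_norm _ _ _ _.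
have fcD : fixed_by D c := in_cent_fixed sc.
have fH : fixed_by H f := @pair_stab_fixed _ _ _ _.
have sNH g : g \in H -> g \in 'N('C(D))%g by apply: norm_cent sHN.
pose z := rel_trace D L c; have fz : fixed_by L z := rel_trace_fixed sDL fcD.
have sz : S z.
  apply: (subalg_sum sS) => [g gC|X XL]; first by rewrite gcoef0.
  have [rL _] := repr_lcosets XL sDL.
  by apply: in_subalg_norm => //; apply: sNH; apply: (subsetP sLH).
have Sz : sfix C C z by split=> //; apply: fixed_byS fz.
have fP := proj1 (blockP _ _) fB; have sSC := sfix_subalg k C C.
have corn h : h \in H -> corner (sfix C C) f (f * gconj h z).
  move=> hH.
  have Szh : sfix C C (gconj h z).
    split; first by apply: in_subalg_norm => //; apply: sNH.
    have := fixed_by_gconj (g := h) (proj2 Sz); congr (fixed_by _ _); apply/val_inj => /=.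
    by apply/normP; rewrite groupV; apply: sNH.
  split; [exact: (subalgM sSC (conj sf cf)) | by rewrite mulrA ff |].
  by rewrite -mulrA -(fC (proj1 Szh)) mulrA ff.
have [| |X XH [a [[[sa ca] fa af] _ aX]]] := local_sum sSC fP (P := fun X => X \in lcosets L H)
  (F := fun X => f * gconj (repr X) z).
- by move=> X XH; apply: corn; case: (repr_lcosets XH sLH).
- rewrite -mulr_sumr -/(rel_trace L H z) -(rel_trace_trans sDL) // -fE ff.
  by move=> nf; apply: f0; apply: nilp_idem ff nf.
have [hH _] := repr_lcosets XH sLH; set h := repr X in aX hH.
pose a' := gconj h^-1%g a.
have sa' : S a' by apply: in_subalg_norm => //; rewrite groupV; apply: sNH.
have ca' : fixed_by C a'.
  have := fixed_by_gconj (g := h^-1%g) ca; rewrite invgK; congr (fixed_by _ _).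
  by apply/val_inj => /=; apply/normP; apply: sNH.
have a'z : a' * z = f.
  have := congr1 (gconj h^-1%g) aX; rewrite mulrA af [LHS]rmorphM /= gconjK => ->.
  by apply: fH; rewrite groupV.
have fLa' : fixed_by L a'.
  move=> u; rewrite /L /= (cent_joinEr (subxx _)) => /mulsgP[d v dD vC ->].
  by rewrite gconjM (ca' v vC) (in_cent_fixed sa').
exists (a' * c); first exact: (subalgM sS).
by rewrite rel_trace_mull // -/z a'z.
Qed.

Section Regular.
Variable c : galg k gT.
Hypotheses (sc : S c) (fE : f = rel_trace D (D <*> C)%G c).

Definition zsum : galg k gT := \sum_(z in 'Z(D)%g) gelt k z.

Let ZD z : z \in 'Z(D)%g -> z \in D /\ z \in C. Proof. by move=> /setIP. Qed.

Lemma zsum_in : S zsum.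
Proof.
apply: (subalg_sum sS) => [g gC|z /ZD[_ zC]]; first by rewrite gcoef0.
exact: in_subalg_gelt.
Qed.

Lemma gelt_center z a : z \in 'Z(D)%g -> S a -> gelt k z * a = a * gelt k z.
Proof. by move=> /ZD[zD _] sa; apply/gconj_id_comm; apply: in_cent_fixed sa _ zD. Qed.

Lemma zsum_comm a : S a -> zsum * a = a * zsum.
Proof.
by move=> sa; rewrite mulr_suml mulr_sumr; apply: eq_bigr => z zZ; apply: gelt_center.
Qed.

Lemma gelt_zsum z : z \in 'Z(D)%g -> gelt k z * zsum = zsum.
Proof.
move=> zZ; rewrite mulr_sumr [RHS](reindex_inj (mulgI z)) /=.
by apply: eq_big => [y|y _]; rewrite ?geltM // groupMl.
Qed.

Lemma br_mul_in a s : S s -> br D (a * s) = br D a * s.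
Proof.
move=> ss; apply/galgP=> g; rewrite gcoef_br.
have split_sum : forall b : galg k gT, gcoef (b * s) g =
    \sum_(h | (h^-1 * g)%g \in C) gcoef b h * gcoef s (h^-1 * g)%g.
  move=> b; rewrite gcoefM (bigID (fun h => (h^-1 * g)%g \in C)) /= [X in _ + X]big1 ?addr0 //.
  by move=> h hC; rewrite ss ?mulr0.
rewrite !split_sum; case: ifP => gC.
  by apply: eq_bigr => h hC; rewrite gcoef_br ifT // -groupV -(groupMr _ gC).
rewrite big1 // => h hC; rewrite gcoef_br ifF ?mul0r //.
by apply: contraFF gC => hC'; rewrite -(groupMl g (groupVr hC')).
Qed.

(** Modulo the augmentation ideal of kZ(D), equivalently after multiplication by
zsum, the algebra kC(D)f is von Neumann regular: averaging a linear quasi-inverse of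
right multiplication by a with the help of c makes it left linear. *)
Lemma regular_mod a : S a -> f * a = a -> exists2 b, S b & a * b * a * zsum = a * zsum.
Proof.
move=> sa fa.
(* q w is a quotient of w by zsum * a when there is one; t w is its part in kC(D) *)
pose A := rmat (zsum * a).
pose q w := ungrow (grow w *m pinvmx A).
have qD x y : q (x + y) = q x + q y by rewrite /q linearD mulmxDl linearD.
have qZ r x : q (r *: x) = r *: q x by rewrite /q linearZ /= -scalemxAl linearZ.
have qP w : q (w * (zsum * a)) * (zsum * a) = w * (zsum * a).
  apply: grow_inj; rewrite !grow_mul /q ungrowK grow_mul -/A.
  by rewrite mulmxKpV ?submxMl.
pose t w := br D (q w); have st w : S (t w) by apply: br_in.
have sza : S (zsum * a) by apply: (subalgM sS) => //; apply: zsum_in.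
have tP w : S w -> t (w * (zsum * a)) * (zsum * a) = w * (zsum * a).
  move=> sw; rewrite /t -br_mul_in // qP br_id //; exact: (subalgM sS).
pose L := (D <*> C)%G; have sDL : D \subset L := joing_subl _ _.
have LE : L :=: ('C(D) * D)%g by rewrite /= joingC cent_joinEl.
(* every coset of D in DC(D) has representatives in C(D), unique up to Z(D) *)
pose r (X : {set gT}) := repr (X :&: 'C(D))%g.
have rP X : X \in lcosets D L -> [/\ r X \in X, r X \in C & X = (r X *: D)%g].
  move=> XL; have [hL XE] := repr_lcosets XL sDL.
  have : r X \in (X :&: 'C(D))%g.
    move: hL; rewrite LE => /mulsgP[x d xC dD E].
    apply: (mem_repr x); rewrite inE xC andbT XE E lcosetM (lcoset_id dD).
    by rewrite lcoset_refl.
  by move=> /setIP[rX rC]; split=> //; rewrite XE; apply/esym/lcoset_eqP; rewrite -XE.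
have fcD : fixed_by D c := in_cent_fixed sc.
have fE' : f = \sum_(X in lcosets D L) gconj (r X) c.
  rewrite {1}fE; apply: eq_bigr => X XL; have [_ _ XE] := rP X XL.
  by rewrite {1}XE gconj_repr.
pose b := \sum_(X in lcosets D L) gelt k (r X) * c * t (gelt k (r X)^-1%g * zsum).
have sb : S b.
  apply: (subalg_sum sS) => [g gC|X XL]; first by rewrite gcoef0.
  have [_ rC _] := rP X XL.
  by apply: (subalgM sS) => //; apply: (subalgM sS) => //; apply: in_subalg_gelt.
(* m v is the average of t v, weighted by c; on zsum it commutes with C(D), by mg, because
a change of representative by an element of Z(D) is absorbed by zsum *)
pose m (v : galg k gT) := \sum_(X in lcosets D L) gelt k (r X) * c * (t (gelt k (r X)^-1%g * v) * zsum).
have mg g : g \in C -> gelt k g * m zsum = m (gelt k g * zsum).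
  move=> gC; have gL : g \in L by apply: (subsetP (joing_subr D C)).
  rewrite /m [RHS](big_lcosets_shift _ gL sDL) mulr_sumr; apply: eq_bigr => X XL.
  have gXL : (g *: X)%g \in lcosets D L by rewrite lcosets_lmul.
  have [rgX rgC _] := rP _ gXL; have [rX rC XE] := rP _ XL.
  have [z zZ E] : exists2 z : gT, z \in 'Z(D)%g & r (g *: X)%g = (g * r X * z)%g.
    exists ((g * r X)^-1 * r (g *: X))%g; last by rewrite mulKVg.
    apply/setIP; split; first by rewrite -mem_lcoset lcosetM -XE.
    by rewrite -[('C(D))%g]/(gval C) !(groupM, groupV).
  have zC : gelt k z * c = c * gelt k z by apply: gelt_center.
  have -> : gelt k (r (g *: X)%g)^-1%g * (gelt k g * zsum) = gelt k (r X)^-1%g * zsum.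
    rewrite E !invMg -!geltM -!mulrA (mulrA _ (gelt k g)) gelt_Vmul mul1r.
    rewrite mulrA gelt_center ?groupV //; last by apply: in_subalg_gelt; rewrite groupV.
    by rewrite -mulrA gelt_zsum ?groupV.
  rewrite E -!geltM -!mulrA; congr (_ * (_ * _)).
  rewrite [RHS]mulrA zC -[RHS]mulrA; congr (_ * _).
  set T := t _; have sT : S T by apply: st.
  by rewrite [RHS]mulrA (gelt_center zZ sT) -mulrA gelt_zsum.
have tD x y : t (x + y) = t x + t y by rewrite /t qD linearD.
have tZ (u : k) x : t (u *: x) = u *: t x by rewrite /t qZ linearZ.
have mD x y : m (x + y) = m x + m y.
  rewrite /m -big_split; apply: eq_bigr => X _ /=.
  by rewrite mulrDr tD mulrDl mulrDr.
have mZ (u : k) x : m (u *: x) = u *: m x.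
  rewrite /m scaler_sumr; apply: eq_bigr => X _.
  by rewrite -scalerAr tZ -scalerAl -scalerAr.
have m0 : m 0 = 0 by have := mZ 0 0; rewrite !scale0r.
have aE : a * m zsum = m (a * zsum).
  have mS (F : gT -> galg k gT) : m (\sum_g F g) = \sum_g m (F g).
    exact: (big_morph m mD m0).
  transitivity (\sum_g gcoef a g *: (gelt k g * m zsum)).
    rewrite {1}[a]galg_expand mulr_suml; apply: eq_bigr => g _; by rewrite scalerAl.
  rewrite {2}[a]galg_expand mulr_suml mS; apply: eq_bigr => g _.
  have [gC|gC] := boolP (g \in C); first by rewrite mg // -scalerAl mZ.
  by rewrite sa // !scale0r mul0r m0.
have bE : m zsum = b * zsum.
  by rewrite /m /b mulr_suml; apply: eq_bigr => X _; rewrite !mulrA.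
exists b => //.
transitivity (m (a * zsum) * a).
  by rewrite -aE bE -!mulrA; congr (_ * (_ * _)); rewrite zsum_comm.
rewrite -zsum_comm // /m mulr_suml.
transitivity (f * (zsum * a)); last first.
  by rewrite -[in RHS]fa !mulrA fC //; apply: zsum_in.
rewrite fE' [RHS]mulr_suml; apply: eq_bigr => X XL; have [_ rC _] := rP X XL.
rewrite -!mulrA tP; last by apply: in_subalg_gelt; rewrite groupV.
by rewrite /gconj !mulrA.
Qed.

(** A p-group acting on a nonzero space in characteristic p fixes a nonzero vector:
(z - 1) is nilpotent for each z. *)
Lemma fixed_vector (W : galg k gT -> Prop) (zs : seq gT) :
    (forall x y, W x -> W y -> W (x - y)) ->
    (forall z x, z \in 'Z(D)%g -> W x -> W (gelt k z * x)) ->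
    {subset zs <= 'Z(D)%g} -> forall w, W w -> w != 0 ->
  exists w', [/\ W w', w' != 0 & forall z, z \in zs -> gelt k z * w' = w'].
Proof.
move=> WB WZ; elim: zs => [|z zs IH] sub w Ww w0; first by exists w.
have [|v [Wv v0 vzs]] := IH _ w Ww w0; first by move=> y yz; apply: sub; rewrite inE yz orbT.
have zZ : z \in 'Z(D)%g by apply: sub; rewrite inE eqxx.
pose W' x := W x /\ forall y : gT, y \in zs -> gelt k y * x = x.
have W'z x : W' x -> W' (gelt k z * x - x).
  move=> [Wx xzs]; split; first by apply: WB => //; apply: WZ.
  move=> y yz; rewrite mulrBr (xzs y yz) mulrA geltM.
  have [zD zC] := ZD zZ; have [yD _] := ZD (sub y (mem_behead (s := z :: zs) yz)).
  by rewrite -(centP zC y yD) -geltM -mulrA (xzs y yz).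
have pz : exists m, (z ^+ (p ^ m))%g = 1%g.
  have /p_natP[m E] : (p.-nat #[z])%N by apply: (mem_p_elt pD); case: (ZD zZ).
  by exists m; rewrite -E expg_order.
have [m zm] := pz.
have geltX n : gelt k z ^+ n = gelt k (z ^+ n)%g.
  by elim: n => [|n IHn]; rewrite ?expr0 // exprS IHn geltM expgS.
have nil : (gelt k z - 1) ^+ (p ^ m) = 0.
  have pP : p \in [pchar {poly k}] by rewrite pchar_poly.
  have pmm : [pchar {poly k}].-nat (p ^ m)%N.
    by rewrite pnatX; apply/orP; left; rewrite pnatE ?(pcharf_prime pk).
  have := congr1 (horner_alg (gelt k z)) (exprDn_pchar ('X : {poly k}) (-1) pmm).
  rewrite exprNn_pchar // expr1n !(rmorphXn, rmorphD, rmorphN, rmorph1) /= horner_algX => ->.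
  by rewrite geltX zm gelt1 subrr.
have iterE n x : W' x -> W' ((gelt k z - 1) ^+ n * x).
  move=> W'x; elim: n => [|n IHn]; first by rewrite expr0 mul1r.
  by rewrite exprS -mulrA mulrBl mul1r; apply: W'z.
have ex0 : exists n, (gelt k z - 1) ^+ n * v == 0 by exists (p ^ m)%N; rewrite nil mul0r.
have [[|n] /eqP En nmin] := ex_minnP ex0.
  by rewrite expr0 mul1r in En; rewrite En eqxx in v0.
have [Wn nzs] := iterE n v (conj Wv vzs).
exists ((gelt k z - 1) ^+ n * v); split=> //.
  by apply/negP=> /nmin; rewrite ltnn.
move=> y; rewrite inE => /orP[/eqP->|/nzs//].
by apply/eqP; rewrite -subr_eq0 -{2}[_ * v]mul1r -mulrBl mulrA -exprS En.
Qed.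

(** W contains a nonzero vector fixed by Z(D); it is constant on the cosets of Z(D), hence
a multiple of zsum. *)
Lemma zsum_detects (W : galg k gT -> Prop) w :
    (forall x y, W x -> W y -> W (x - y)) -> (forall x, W x -> S x) ->
    (forall z x, z \in 'Z(D)%g -> W x -> W (gelt k z * x)) ->
    W w -> w != 0 ->
  exists t, [/\ S t, t * zsum != 0 & W (t * zsum)].
Proof.
move=> WB WS WZ Ww w0.
have [|w' [Ww' w'0 fw']] := fixed_vector (zs := enum 'Z(D)%g) WB WZ _ Ww w0.
  by move=> z; rewrite mem_enum.
have sw' := WS _ Ww'; pose Z := 'Z(D)%G.
pose t : galg k gT := galg_mk (fun g => if g == repr (g *: Z)%g then gcoef w' g else 0).
have st : S t by move=> g gC; rewrite gcoefE sw' // if_same.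
suff E : t * zsum = w' by exists t; rewrite E.
apply/galgP=> g; rewrite mulr_sumr gcoef_sum.
have [gC|gC] := boolP (g \in C); last first.
  rewrite sw' // big1 // => z /ZD[_ zC]; rewrite gcoef_mul_gelt st //.
  by rewrite groupMr // groupV.
case/lcosetP: (mem_repr_lcoset Z g) => z0 z0Z E; have [z0D z0C] := ZD z0Z.
have inv z : z \in 'Z(D)%g -> gcoef w' (g * z)%g = gcoef w' g.
  move=> zZ; rewrite -[in RHS](fw' z^-1%g) ?mem_enum ?groupV //.
  have zVZ : z^-1%g \in 'Z(D)%g by rewrite groupV.
  by rewrite gelt_center // gcoef_mul_gelt invgK.
rewrite (bigD1 z0^-1%g) ?groupV //= gcoef_mul_gelt invgK gcoefE.
have cos z : z \in 'Z(D)%g -> ((g * z) *: Z = g *: Z)%g.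
  by move=> zZ; rewrite lcosetM (lcoset_id zZ).
rewrite cos // E eqxx inv // big1 ?addr0 // => z /andP[zZ nz].
rewrite gcoef_mul_gelt gcoefE cos ?groupV // E (inj_eq (mulgI g)).
by rewrite -(inj_eq invg_inj) invgK (negPf nz).
Qed.

Definition linked i j : Prop := exists x y, [/\ S x, S y & i = x * j * y].

Section Link.
Variables (i j : galg k gT).
Hypotheses (iP : primitive_idempotent_in S i) (fi : f * i = i).
Hypotheses (jj : j * j = j) (sj : S j).

(** By zsum_detects iSj contains some x with x * zsum <> 0, and regular_mod provides b
with xbx * zsum = x * zsum.  So xbi is not nilpotent, and it is invertible in the local
corner of i: i is a multiple of xj = x. *)
Lemma link_of_neq0 s : S s -> i * s * j != 0 -> linked i j.
Proof.
move=> ss n0; have [si ii i0 _] := iP.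
pose W x := exists2 u, S u & x = i * u * j.
have WS x : W x -> S x.
  by move=> [u su ->]; apply: (subalgM sS) => //; apply: (subalgM sS).
have [|||||t [st tz [u su tzE]]] := @zsum_detects W (i * s * j).
- by move=> x y [u su ->] [v sv ->]; exists (u - v); [apply: (subalgB sS)|rewrite mulrBr mulrBl].
- exact: WS.
- move=> z x zZ [u su ->]; exists (gelt k z * u).
    by apply: (subalgM sS) => //; apply: in_subalg_gelt; case: (ZD zZ).
  by rewrite !mulrA gelt_center.
- by exists s.
- by [].
have [x xE] : {x | x = i * t * j} by exists (i * t * j).
have sx : S x by rewrite xE; apply: WS; exists t.
have xz : x * zsum = t * zsum.
  rewrite xE -!mulrA -zsum_comm // (mulrA t) tzE !mulrA ii -!mulrA; congr (_ * (_ * _)).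
  by rewrite jj.
have ix : i * x = x by rewrite xE !mulrA ii.
have xj : x * j = x by rewrite xE -!mulrA jj.
have fx : f * x = x by rewrite -ix mulrA fi.
have [b sb bE] := regular_mod sx fx.
pose y := x * b * i.
have yC : corner S i y.
  split; first by apply: (subalgM sS) => //; apply: (subalgM sS).
    by rewrite /y !mulrA ix.
  by rewrite /y -!mulrA ii.
have yx n : y ^+ n * (x * zsum) = x * zsum.
  elim: n => [|n IH]; first by rewrite expr0 mul1r.
  by rewrite exprS -mulrA IH /y -!mulrA (mulrA i) ix !mulrA bE.
case: (primitive_dichotomy sS iP yC) => [[n E] | [v [[sv _ _] yv _]]].
  by case/eqP: tz; rewrite -xz -(yx n.+1) E mul0r.
exists x, (b * i * v); split=> //.
  by apply: (subalgM sS) => //; apply: (subalgM sS).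
by rewrite xj -[LHS]yv /y !mulrA.
Qed.

End Link.

Lemma linked_sym i j : primitive_idempotent_in S i -> primitive_idempotent_in S j ->
  linked i j -> linked j i.
Proof.
move=> iP jP [x [y [sx sy iE]]].
have [x' [y' [sx' sy' xy yx]]] := primitive_iso sS iP jP sx sy iE.
have [_ jj _ _] := jP; exists y', x'; split=> //.
by rewrite -xy !mulrA yx -mulrA yx jj.
Qed.

(** All primitive idempotents of kC(D)f are linked: otherwise a maximal idempotent E
unlinked with i would commute with kC(D)f, and f would not be primitive in the
centre. *)
Lemma all_linked i j : primitive_idempotent_in S i -> primitive_idempotent_in S j ->
  f * i = i -> f * j = j -> linked i j.
Proof.
move=> iP jP fi fj; apply: NNPP => nlij.
have [si ii i0 _] := iP; have [sj jj j0 _] := jP.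
pose unl E := [/\ S E, E * E = E, f * E = E & forall s, S s -> i * s * E = 0 /\ E * s * i = 0].
have unlinked m : primitive_idempotent_in S m -> f * m = m -> ~ linked i m ->
    forall s, S s -> i * s * m = 0 /\ m * s * i = 0.
  move=> mP fm nl s ss; have [sm mm _ _] := mP.
  split; apply/eqP; apply: contraPT isT => n0 _; apply: nl.
    exact: link_of_neq0 n0.
  by apply: linked_sym => //; apply: link_of_neq0 n0.
have unlj : unl j by split=> //; apply: unlinked.
suff none : forall n E, unl E -> E != 0 -> (#|gT| - \rank (rmat E) < n)%N -> False.
  exact: (none _ j unlj j0 (ltnSn _)).
elim=> // n IH E [sE EE fEl uE] E0 rk.
have Ef : E * f = E by rewrite -fC.
have grow_unl m : primitive_idempotent_in S m -> f * m = m -> E * m = 0 -> m * E = 0 ->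
    (exists2 q, primitive_idempotent_in S q & E * q = q /\ q * E = q /\ linked m q) -> False.
  move=> mP fm Em mE [q qP [Eq [qE [x [y [sx sy mEq]]]]]]; have [sm mm m0 _] := mP.
  have [sq _ _ _] := qP.
  have um : forall s, S s -> i * s * m = 0 /\ m * s * i = 0.
    move=> s ss; rewrite mEq; split.
      have [z0 _] := uE _ (subalgM sS ss sx).
      by rewrite -Eq !mulrA -(mulrA i s x) z0 !mul0r.
    have [_ z0] := uE _ (subalgM sS sy ss).
    by rewrite -qE -!mulrA (mulrA y s i) (mulrA E) z0 !mulr0.
  have EmE : (E + m) * (E + m) = E + m by rewrite mulrDl !mulrDr EE Em mE mm addr0 add0r.
  apply: (IH (E + m)).
  - split=> //; first exact: (subalgD sS).
      by rewrite mulrDr fEl fm.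
    move=> s ss; have [a1 a2] := uE s ss; have [b1 b2] := um s ss.
    by rewrite mulrDr a1 b1 addr0 !mulrDl a2 b2 addr0.
  - apply: contraNneq E0 => z0; have : E * (E + m) = 0 by rewrite z0 mulr0.
    by rewrite mulrDr EE Em addr0 => ->.
  have rkl := rank_orthogonal EE mm Em mE (elimN eqP m0).
  apply: leq_trans (ltnSE rk); apply: ltn_sub2l => //.
  exact: leq_trans rkl (rank_leq_col _).
have SfE : S (f - E) by apply: (subalgB sS).
have fEi : (f - E) * (f - E) = f - E.
  by rewrite mulrBl !mulrBr ff fEl Ef EE subrr subr0.
have EfE : E * (f - E) = 0 by rewrite mulrBr Ef EE subrr.
have fEE : (f - E) * E = 0 by rewrite mulrBl fEl EE subrr.
have below m : (f - E) * m = m -> m * (f - E) = m -> [/\ f * m = m, E * m = 0 & m * E = 0].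
  move=> m1 m2; split; first by rewrite -m1 mulrA mulrBr ff fEl m1.
    by rewrite -m1 mulrA EfE mul0r.
  by rewrite -m2 -mulrA fEE mulr0.
have split_left q y1 y2 : (exists2 s, S s & (y1 + y2) * s * q != 0) ->
    (exists2 s, S s & y1 * s * q != 0) \/ (exists2 s, S s & y2 * s * q != 0).
  move=> [s ss]; rewrite !mulrDl => n0; have [E1|] := eqVneq (y1 * s * q) 0; last by left; exists s.
  by right; exists s => //; rewrite E1 add0r in n0.
have split_right q y1 y2 : (exists2 s, S s & q * s * (y1 + y2) != 0) ->
    (exists2 s, S s & q * s * y1 != 0) \/ (exists2 s, S s & q * s * y2 != 0).
  move=> [s ss]; rewrite mulrDr => n0; have [E1|] := eqVneq (q * s * y1) 0; last by left; exists s.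
  by right; exists s => //; rewrite E1 add0r in n0.
have case1 s : S s -> (f - E) * s * E = 0.
  move=> ss; apply/eqP; apply: contraPT isT => n0 _.
  have [|||m [mP nm m1 m2]] := primitive_below (y := f - E)
      (Pr := fun y => exists2 s, S s & y * s * E != 0) sS SfE fEi.
  - by exists s.
  - by case=> s' _; rewrite !mul0r eqxx.
  - by move=> y1 y2 _ _ _ _ _ _; apply: split_left.
  have [||q [qP [s' ss' nq] q1 q2]] := primitive_below (y := E)
      (Pr := fun y => exists2 s, S s & m * s * y != 0) sS sE EE nm.
  - by case=> s' _; rewrite mulr0 eqxx.
  - by move=> y1 y2 _ _ _ _ _ _; apply: split_right.
  have [fm Em mE] := below m m1 m2; apply: (grow_unl m) => //.
  have [sq qq _ _] := qP.
  by exists q => //; split=> //; split=> //; apply: (link_of_neq0 mP fm qq sq ss' nq).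
have case2 s : S s -> E * s * (f - E) = 0.
  move=> ss; apply/eqP; apply: contraPT isT => n0 _.
  have [|||m [mP nm m1 m2]] := primitive_below (y := f - E)
      (Pr := fun y => exists2 s, S s & E * s * y != 0) sS SfE fEi.
  - by exists s.
  - by case=> s' _; rewrite mulr0 eqxx.
  - by move=> y1 y2 _ _ _ _ _ _; apply: split_right.
  have [||q [qP [s' ss' nq] q1 q2]] := primitive_below (y := E)
      (Pr := fun y => exists2 s, S s & y * s * m != 0) sS sE EE nm.
  - by case=> s' _; rewrite !mul0r eqxx.
  - by move=> y1 y2 _ _ _ _ _ _; apply: split_left.
  have [fm Em mE] := below m m1 m2; apply: (grow_unl m) => //.
  have [[sm mm _ _] [sq qq _ _]] := (mP, qP).
  exists q => //; split=> //; split=> //; apply: linked_sym => //.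
  by apply: (link_of_neq0 qP _ mm sm ss' nq); rewrite -q1 mulrA fEl.
have EC s : S s -> E * s = s * E.
  move=> ss; have := case1 s ss; have := case2 s ss.
  rewrite mulrBr mulrBl => /eqP; rewrite subr_eq0 => /eqP E2.
  rewrite mulrBl => /eqP; rewrite subr_eq0 => /eqP E1.
  have {E1} E1 : s * E = E * s * E by rewrite -E1 (fC ss) -mulrA fEl.
  by rewrite E1 -E2 -mulrA -(fC ss) mulrA Ef.
have cE : sfix C C E.
  split=> // u uC; apply/gconj_id_comm; rewrite EC //; exact: in_subalg_gelt.
have [E1|E1] := block_absorb fB cE EE; last by case/eqP: E0; rewrite -fEl.
have {E1} Ef1 : E = f by rewrite -fEl.
have [z0 _] := uE 1 (@in_subalg1 k gT C).
by case/eqP: i0; rewrite -fi (fC si) -Ef1 -[i]mulr1 z0.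
Qed.

End Regular.
End CentralDefect.

Section SourceConjugates.
Variables (k : fieldType) (gT : finGroupType) (p : nat).
Hypothesis pk : p \in [pchar k].
Implicit Types (g h u v : gT) (Q R T : {group gT}).
Variables (D : {group gT}) (b l : galg k gT) (e : {group gT} -> galg k gT).
Hypothesis src : source_pairs p D l e.
Hypothesis bP : primitive_idempotent_in (sfix 'C(1)%G [set: gT]%G) b.
Hypothesis bl : b * l = l.
Variable cD : galg k gT.
Hypotheses (fcD : fixed_by D cD) (bE : b = rel_trace D [set: gT]%G cD).

(** An element of the stabiliser of (D, e D) conjugates l to an isomorphic idempotent
of (kG)^D: the images in kC(D) are linked, and the link lifts since l is local. *)
Lemma source_conjugate h : h \in pair_stab D (e D) ->
  exists x y, [/\ fixed_by D x, fixed_by D y, x * y = l & y * x = gconj h l].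
Proof.
move=> hH; have pD := sp_pgroup src; have lP := sp_primitive src.
have eB := proj1 (sp_block src (subxx D)).
have [[seD ceD] eeD] := block_idem src (subxx D).
have [[_ fl] ll l0 _] := lP; have brl := sp_local src.
have [hN eh] := pair_stabP _ _ _ hH.
have [c sc eE] : exists2 c, in_subalg 'C(D)%G c & e D = rel_trace D (pair_stab D (e D)) c.
  have [x [T [d [j]]]] := defect_in_source pk src bP bl fcD bE (subxx D).
  set R := (D :^ x^-1)%G => -[[sRT sTD sTH xe] [[sd _] [[sj _] _ _ _] eE _]].
  have RD : R = D.
    by apply/val_inj/eqP; rewrite eqEcard (subset_trans sRT sTD) /= cardJg.
  have TD : T = D by apply/val_inj/eqP; rewrite eqEsubset sTD -{1}RD.
  rewrite RD TD in sd sj eE; exists (d * j) => //.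
  exact: (subalgM (in_subalg_subalg _ _) sd sj).
have [c' sc' eE'] := trace_to_centraliser eB sc eE.
have C1 : ('C(1) :^ h^-1)%G = 'C(1)%G by apply/val_inj; rewrite /= -centJ conjs1g.
have Dh : (D :^ h^-1)%G = D by apply/val_inj; rewrite /= (normP _) // groupV.
have hlP : primitive_idempotent_in (sfix 'C(1)%G D) (gconj h l).
  by have := primitive_gconj h lP; rewrite C1 Dh.
have brh : br D (gconj h l) = gconj h (br D l) by apply: br_norm.
have nbrh : br D (gconj h l) != 0.
  by rewrite brh; apply: contraNneq brl => E; apply/eqP/(gconj_inj (g := h)); rewrite E raddf0.
have prim (m : galg k gT) : primitive_idempotent_in (sfix 'C(1)%G D) m -> br D m != 0 ->
    primitive_idempotent_in (in_subalg 'C(D)%G) (br D m).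
  by move=> mP nm; apply: (br_primitive_in pk (sub1G D) (norms1 D) pD mP nm).
have el : e D * br D l = br D l.
  by rewrite (comm_of_fixed ceD (@br_in _ _ D l)) (br_block pk src).
have ehl : e D * br D (gconj h l) = br D (gconj h l).
  by rewrite brh -{1}eh -rmorphM el.
have [x [y [sx sy iE]]] := all_linked pk pD eB sc' eE' (prim _ lP brl) (prim _ hlP nbrh) el ehl.
have [fx fy] := (in_cent_fixed sx, in_cent_fixed sy).
have [[_ fhl] hlhl _ _] := hlP; have sS := sfix_subalg k 'C(1)%G D.
have SD (a : galg k gT) : fixed_by D a -> sfix 'C(1)%G D a by split=> //; apply: in_subalg_C1.
have M := subalgM (fixed_subalg k D).
pose s := x * gconj h l * y.
have fs : fixed_by D s by apply: (M) => //; apply: (M).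
have brs : br D s = br D l.
  rewrite /s (brM pk pD (M _ _ fx fhl) fy) (brM pk pD fx fhl).
  by rewrite (br_id sx) (br_id sy) -iE.
have sC : corner (sfix 'C(1)%G D) l (l * s * l) by apply: corner_cut => //; apply: SD.
have brll := br_idem pk pD fl ll.
case: (primitive_dichotomy sS lP sC) => [ns | [v [[[_ fv] _ _] sv _]]].
  case/eqP: brl; apply: (nilp_idem brll).
  have -> : br D l = br D (l * s * l).
    by rewrite (brM pk pD (M _ _ fl fs) fl) (brM pk pD fl fs) brs !brll.
  by apply: (br_nilpot pk) => //; case: sC => [[]].
have lE : l = (l * x) * gconj h l * (y * l * v) by rewrite -[LHS]sv /s !mulrA.
have Slx : sfix 'C(1)%G D (l * x) by apply: SD; apply: M.
have Syv : sfix 'C(1)%G D (y * l * v) by apply: SD; apply: (M) => //; apply: (M).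
have [x' [y' [[_ fx'] [_ fy'] xy yx]]] := primitive_iso sS lP hlP Slx Syv lE.
by exists x', y'.
Qed.

End SourceConjugates.

(** * Lifting from the residue field *)

Section Reduction.
Variables (p : nat) (O : comNzRingType) (k : fieldType) (res : {rmorphism O -> k}).
Variable gT : finGroupType.
Implicit Types (a b c d w x y : galg O gT) (g h u v : gT) (H Q T : {group gT}).

Definition red a : galg k gT := galg_mk (fun g => res (gcoef a g)).

Lemma gcoef_red a g : gcoef (red a) g = res (gcoef a g).
Proof. exact: gcoefE. Qed.

Fact red_is_zmod_morphism : zmod_morphism red.
Proof. by move=> a b; apply/galgP=> g; rewrite gcoefB !gcoef_red gcoefB rmorphB. Qed.

HB.instance Definition _ :=
  GRing.isZmodMorphism.Build (galg O gT) (galg k gT) red red_is_zmod_morphism.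

Lemma red_gelt g : red (gelt O g) = gelt k g.
Proof. by apply/galgP=> h; rewrite gcoef_red !gcoef_gelt rmorph_nat. Qed.

Fact red_is_monoid_morphism : monoid_morphism red.
Proof.
split=> [|a b]; first exact: red_gelt.
apply/galgP=> g; rewrite gcoef_red !gcoefM rmorph_sum; apply: eq_bigr => h _.
by rewrite rmorphM !gcoef_red.
Qed.

HB.instance Definition _ :=
  GRing.isMonoidMorphism.Build (galg O gT) (galg k gT) red red_is_monoid_morphism.

Lemma redZ r a : red (r *: a) = res r *: red a.
Proof. by apply/galgP=> g; rewrite gcoefZ !gcoef_red gcoefZ rmorphM. Qed.

Lemma red_gconj g a : red (gconj g a) = gconj g (red a).
Proof. by apply/galgP=> h; rewrite gcoef_gconj !gcoef_red gcoef_gconj. Qed.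

Lemma red_rel_trace T H a : red (rel_trace T H a) = rel_trace T H (red a).
Proof. by rewrite raddf_sum; apply: eq_bigr => X _; rewrite /= red_gconj. Qed.

Lemma red_fixed H a : fixed_by H a -> fixed_by H (red a).
Proof. by move=> fa u uH; rewrite -red_gconj fa. Qed.

Lemma brauer_red Q a : brauer res Q a = br Q (red a).
Proof.
by apply/galgP=> g; rewrite gcoef_br /brauer gcoefE gcoef_red.
Qed.

Hypothesis hO : complete_local_base p res.

Let m : O -> Prop := fun r => res r = 0.

Lemma ideal_m : is_ideal m.
Proof.
split; rewrite /m; first exact: rmorph0.
  by move=> x y mx my; rewrite rmorphD mx my addr0.
by move=> c x mx; rewrite rmorphM mx mulr0.
Qed.

Lemma ideal_pow_ideal n : is_ideal (ideal_pow m n).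
Proof.
case: n => [|n]; first by [].
split.
- by exists [::]; rewrite big_nil.
- move=> x y [s [sP ->]] [t [tP ->]]; exists (s ++ t); rewrite big_cat; split=> // q.
  by rewrite mem_cat => /orP[/sP|/tP].
move=> c x [s [sP ->]]; exists [seq (c * q.1, q.2) | q <- s]; split.
  move=> q /mapP[r /sP[mr pr] ->]; split=> //=.
  by case: ideal_m => _ _; apply.
by rewrite big_map mulr_sumr; apply: eq_bigr => q _; rewrite mulrA.
Qed.

Lemma ideal_powS n (x y : O) : m x -> ideal_pow m n y -> ideal_pow m n.+1 (x * y).
Proof.
move=> mx py; exists [:: (x, y)]; rewrite big_seq1; split=> // q.
by rewrite inE => /eqP ->.
Qed.

Lemma ideal_pow_le n i (x : O) : (n <= i)%N -> ideal_pow m i x -> ideal_pow m n x.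
Proof.
move=> /subnK <-; elim: (i - n)%N => // {}i IH; rewrite addSn => -[s [sP xE]].
apply: IH; rewrite {}xE; have [p0 pD pM] := ideal_pow_ideal (i + n).
rewrite big_seq; apply: (big_ind (ideal_pow m (i + n))) => // q /sP[_ pq].
exact: pM.
Qed.

(** Congruence to 0 modulo the n-th power of the maximal ideal. *)
Definition adic n a : Prop := forall g, ideal_pow m n (gcoef a g).

Lemma adicD n a b : adic n a -> adic n b -> adic n (a + b).
Proof. by move=> pa pb g; rewrite gcoefD; case: (ideal_pow_ideal n) => _ pD _; apply: pD. Qed.

Lemma adicN n a : adic n a -> adic n (- a).
Proof.
move=> pa g; rewrite gcoefN -mulN1r.
by case: (ideal_pow_ideal n) => _ _; apply.
Qed.

Lemma adicB n a b : adic n a -> adic n b -> adic n (a - b).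
Proof. by move=> pa pb; apply: adicD => //; apply: adicN. Qed.

Lemma adic_sum n (F : gT -> O) : (forall g, ideal_pow m n (F g)) ->
  ideal_pow m n (\sum_g F g).
Proof.
by move=> pF; have [p0 pD _] := ideal_pow_ideal n; apply: big_ind.
Qed.

Lemma adicMl n a b : adic n b -> adic n (a * b).
Proof.
move=> pb g; rewrite gcoefM; apply: adic_sum => h.
by case: (ideal_pow_ideal n) => _ _; apply.
Qed.

Lemma adicMr n a b : adic n a -> adic n (a * b).
Proof.
move=> pb g; rewrite gcoefM; apply: adic_sum => h; rewrite mulrC.
by case: (ideal_pow_ideal n) => _ _; apply.
Qed.

Lemma adicS n a b : red a = 0 -> adic n b -> adic n.+1 (a * b).
Proof.
move=> ra pb g; rewrite gcoefM; apply: adic_sum => h; apply: ideal_powS => //.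
by rewrite /m -gcoef_red ra gcoef0.
Qed.

Lemma adic0 a : adic 0 a. Proof. by []. Qed.

Lemma adic1 a : red a = 0 <-> adic 1 a.
Proof.
split=> [ra | pa]; first by rewrite -[a]mulr1; apply: adicS.
apply/galgP=> g; rewrite gcoef_red gcoef0; have [s [sP ->]] := pa g.
rewrite rmorph_sum big_seq big1 // => q /sP[mq _].
by rewrite rmorphM mq mul0r.
Qed.

Lemma adic_le n i a : (n <= i)%N -> adic i a -> adic n a.
Proof. by move=> le pa g; apply: ideal_pow_le (pa g). Qed.

Lemma adic_sep a : (forall n, adic n a) -> a = 0.
Proof.
move=> pa; apply/galgP=> g; rewrite gcoef0; have [sep _] := clb_complete hO.
by apply: sep => n; apply: pa.
Qed.

(** Coefficientwise completeness, for sequences with a prescribed rate of convergence, so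
that the limit comes with explicit congruences. *)
Lemma adic_limit (a : nat -> galg O gT) : (forall n, adic n (a n.+1 - a n)) ->
  exists x, forall n, adic n (x - a n).
Proof.
move=> aS.
have cau n i : (n <= i)%N -> adic n (a i - a n).
  move=> /subnK <-; elim: (i - n)%N => [|j IH]; first by rewrite subrr => g; rewrite gcoef0; case: (ideal_pow_ideal n).
  rewrite addSn -(subrK (a (j + n)%N) (a _.+1)) -addrA; apply: adicD => //.
  by apply: adic_le (aS _); rewrite leq_addl.
have [_ comp] := clb_complete hO.
have lim g : exists r : O, forall n, ideal_pow m n (r - gcoef (a n) g).
  have [|r rP] := comp (fun n => gcoef (a n) g).
    move=> n; exists n => i j ni nj; rewrite -gcoefB.
    by rewrite -(subrK (a n) (a i)) -addrA; apply: adicD; [apply: cau | rewrite -opprB; apply: adicN; apply: cau].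
  exists r => n; have [N NP] := rP n.
  have le1 : (n <= maxn n N)%N by apply: leq_maxl.
  have := NP (maxn n N) (leq_maxr _ _); have := cau n _ le1 g; rewrite gcoefB.
  have [_ pD pM] := ideal_pow_ideal n => p1 p2.
  have -> : r - gcoef (a n) g = (gcoef (a (maxn n N)) g - gcoef (a n) g)
     + (-1) * (gcoef (a (maxn n N)) g - r) by ring.
  by apply: pD => //; apply: pM.
have [f fP] := fin_all_exists lim.
by exists (galg_mk f) => n g; rewrite gcoefB gcoefE.
Qed.

(** The inverse is the sum of the powers of d. *)
Lemma geometric d : red d = 0 -> exists w, (1 - d) * w = 1 /\ w * (1 - d) = 1.
Proof.
move=> rd; pose a n := \sum_(i < n) d ^+ i.
have dn n : adic n (d ^+ n).
  by elim: n => [|n IH]; [apply: adic0 | rewrite exprS; apply: adicS].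
have [|w wP] := adic_limit (a := a).
  by move=> n; rewrite /a big_ord_recr /= addrAC subrr add0r; apply: dn.
have aE n : (1 - d) * a n = 1 - d ^+ n.
  elim: n => [|n IH]; first by rewrite /a big_ord0 mulr0 expr0 subrr.
  rewrite /a big_ord_recr /= mulrDr -/(a n) IH mulrBl mul1r -exprS.
  by rewrite addrA subrK.
have aE' n : a n * (1 - d) = 1 - d ^+ n.
  elim: n => [|n IH]; first by rewrite /a big_ord0 mul0r expr0 subrr.
  rewrite /a big_ord_recr /= mulrDl -/(a n) IH mulrBr mulr1 -exprSr.
  by rewrite addrA subrK.
exists w; split; apply/eqP; rewrite -subr_eq0; apply/eqP/adic_sep => n.
  have -> : (1 - d) * w - 1 = (1 - d) * (w - a n) - d ^+ n.
    by rewrite [in RHS]mulrBr aE opprB addrA addrAC [X in _ = X]addrAC subrK.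
  by apply: adicB; [apply: adicMl | apply: dn].
have -> : w * (1 - d) - 1 = (w - a n) * (1 - d) - d ^+ n.
  by rewrite [in RHS]mulrBl aE' opprB addrA addrAC [X in _ = X]addrAC subrK.
by apply: adicB; [apply: adicMr | apply: dn].
Qed.

(** Choose y lifting the inverse of res r; then ry is 1 up to an element that reduces to 0. *)
Lemma res_unit (r : O) : res r != 0 -> exists s, r * s = 1.
Proof.
move=> r0; have [y ry] := clb_surj hO (res r)^-1.
have [|w [ww _]] := @geometric ((1 - r * y) *: 1).
  by rewrite redZ rmorphB rmorph1 rmorphM /= ry divff // subrr scale0r.
exists (y * gcoef w 1%g); have := congr1 (fun a => gcoef a 1%g) ww.
have -> : gcoef (1 : galg O gT) 1%g = 1 by rewrite gcoef_gelt eqxx.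
rewrite mulrBl mul1r -scalerAl mul1r gcoefB gcoefZ => <-.
by ring.
Qed.

(** Lift one coefficient in each H-class. *)
Lemma lift_fixed H (z : galg k gT) : fixed_by H z -> exists2 a, fixed_by H a & red a = z.
Proof.
move=> fz; have [f fP] := fin_all_exists (fun g => clb_surj hO (gcoef z g)).
exists (galg_mk (fun g => f (repr (g ^: H)%g))).
  apply/fixed_byP=> u g uH; rewrite !gcoefE; congr (f (repr _)).
  by rewrite (class_eqP (memJ_class g uH)).
apply/galgP=> g; rewrite gcoef_red gcoefE fP.
have /imsetP[u uH ->] : repr (g ^: H)%g \in (g ^: H)%g by apply: (mem_repr g); apply: class_refl.
by move/fixed_byP: fz => ->.
Qed.

Lemma lift_any (z : galg k gT) : exists a, red a = z.
Proof.
have [|a _ aE] := @lift_fixed 1%G z; last by exists a.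
by move=> u /set1P->; rewrite gconj1.
Qed.

(** Newton iteration: x |-> 3x^2 - 2x^3 stays in the corner of l and multiplies x^2 - x by
a multiple of itself. *)
Lemma lift_idempotent H l (z : galg k gT) : fixed_by H l -> l * l = l ->
    fixed_by H z -> z * z = z -> red l * z = z -> z * red l = z ->
  exists E, [/\ fixed_by H E, E * E = E, l * E = E, E * l = E & red E = z].
Proof.
move=> fl ll fz zz lz zl; have [a fa ra] := lift_fixed fz.
pose nu (X : {poly O}) : {poly O} := X ^+ 2 *+ 3 - X ^+ 3 *+ 2.
pose newton x := horner_alg x (nu 'X).
have newtonE x : newton x = x ^+ 2 *+ 3 - x ^+ 3 *+ 2.
  by rewrite /newton /nu rmorphB /= !raddfMn /= !rmorphXn /= horner_algX.
pose x n := iter n newton (l * a * l).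
have M := subalgM (fixed_subalg O H).
have xP n : [/\ fixed_by H (x n), l * x n = x n, x n * l = x n & red (x n) = z].
  elim: n => [|n [f1 f2 f3 f4]].
    split; first by apply: (M) => //; apply: (M).
    - by rewrite /x /= !mulrA ll.
    - by rewrite /x /= -!mulrA ll.
    by rewrite /x /= !rmorphM /= ra lz zl.
  rewrite [x _]/= -/(x n) newtonE; split.
  - apply: (subalgB (fixed_subalg O H)) => u uH; by rewrite raddfMn /= rmorphXn /= f1.
  - by rewrite mulrBr !mulrnAr !exprS !mulrA f2.
  - by rewrite mulrBl !mulrnAl !exprSr -!mulrA f3.
  rewrite rmorphB /= !raddfMn /= !rmorphXn /= f4.
  have z2 : z ^+ 2 = z by rewrite expr2 zz.
  by rewrite [z ^+ 3]exprS z2 zz mulNrn [z *+ 3]mulrS addrK.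
have nuX y : horner_alg y (nu 'X) = newton y by [].
have evX y (i : nat) : horner_alg y ('X ^+ i) = y ^+ i by rewrite rmorphXn /= horner_algX.
have evN y (P : {poly O}) i : horner_alg y (P *+ i) = horner_alg y P *+ i by rewrite raddfMn.
have evB y (P Q : {poly O}) : horner_alg y (P - Q) = horner_alg y P - horner_alg y Q.
  by rewrite rmorphB.
have evM y (P Q : {poly O}) : horner_alg y (P * Q) = horner_alg y P * horner_alg y Q.
  by rewrite rmorphM.
have step n : newton (x n) - x n = (1 - x n *+ 2) * (x n ^+ 2 - x n).
  have E : nu 'X - 'X = (1 - 'X *+ 2) * ('X ^+ 2 - 'X) :> {poly O} by rewrite /nu; ring.
  have := congr1 (horner_alg (x n)) E; rewrite evB nuX evM !evB evN evX horner_algX.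
  by rewrite rmorph1.
have quad n : newton (x n) ^+ 2 - newton (x n) =
    (x n ^+ 2 - x n) * ((x n ^+ 2 - x n) * (x n ^+ 2 *+ 4 - x n *+ 4 - 1 *+ 3)).
  have E : nu 'X ^+ 2 - nu 'X = ('X ^+ 2 - 'X) * (('X ^+ 2 - 'X) *
     ('X ^+ 2 *+ 4 - 'X *+ 4 - 1 *+ 3)) :> {poly O} by rewrite /nu; ring.
  have := congr1 (horner_alg (x n)) E.
  rewrite evB expr2 evM nuX !evM !evB !evN evX horner_algX rmorph1.
  by rewrite -expr2.
have red0 n : red (x n ^+ 2 - x n) = 0.
  by have [_ _ _ rx] := xP n; rewrite rmorphB rmorphXn /= rx expr2 zz subrr.
have dP n : adic n.+1 (x n ^+ 2 - x n).
  elim: n => [|n IH]; first by apply/adic1.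
  rewrite [x n.+1]/= -/(x n) quad; apply: adicS (red0 n) _; exact: adicMr.
have [|E EP] := adic_limit (a := x).
  by move=> n; rewrite [x n.+1]/= -/(x n) step; apply: adicMl; apply: adic_le (dP n).
have zero y : (forall n, adic n y) -> y = 0 by apply: adic_sep.
exists E; split.
- move=> u uH; apply/eqP; rewrite -subr_eq0; apply/eqP/zero => n.
  have [f1 _ _ _] := xP n.
  have -> : gconj u E - E = gconj u (E - x n) - (E - x n).
    by rewrite raddfB /= f1 // opprB addrA subrK.
  by apply: adicB; last exact: EP; apply: adicMr; apply: adicMl.
- apply/eqP; rewrite -subr_eq0; apply/eqP/zero => n.
  have -> : E * E - E = (E - x n) * E + x n * (E - x n) + (x n ^+ 2 - x n) - (E - x n).
    rewrite mulrBl mulrBr expr2 [E * E - _ + _]addrA subrK [E * E - _ + _]addrA subrK.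
    by rewrite opprB addrA subrK.
  apply: adicB; last exact: EP; apply: adicD; last exact: adic_le (leqnSn n) (dP n).
  by apply: adicD; [apply: adicMr | apply: adicMl].
- apply/eqP; rewrite -subr_eq0; apply/eqP/zero => n; have [_ f2 _ _] := xP n.
  have -> : l * E - E = l * (E - x n) - (E - x n).
    by rewrite mulrBr f2 opprB addrA subrK.
  by apply: adicB; [apply: adicMl|].
- apply/eqP; rewrite -subr_eq0; apply/eqP/zero => n; have [_ _ f3 _] := xP n.
  have -> : E * l - E = (E - x n) * l - (E - x n).
    by rewrite mulrBl f3 opprB addrA subrK.
  by apply: adicB; [apply: adicMr|].
have [_ _ _ <-] := xP 1%N; apply/eqP; rewrite -subr_eq0 -rmorphB; apply/eqP/adic1.
exact: EP.
Qed.

(** An orthogonal splitting of the reduction lifts to one of l. *)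
Lemma red_primitive H l : primitive_idempotent_in (fixed_by H) l -> red l != 0 ->
  primitive_idempotent_in (fixed_by H) (red l).
Proof.
move=> [fl ll l0 prim] rl0; split=> //; first exact: red_fixed.
  by rewrite /is_idempotent -rmorphM ll.
move=> e1 e2 f1 f2 i1 i2 o12 o21 lE.
have [| |E [fE EE lEE ElE rE]] := lift_idempotent fl ll f1 i1.
- by rewrite lE mulrDl i1 o21 addr0.
- by rewrite lE mulrDr i1 o12 addr0.
case: (prim E (l - E)) => //.
- exact: (subalgB (fixed_subalg O H)).
- by rewrite /is_idempotent mulrBl !mulrBr ll lEE ElE EE subrr subr0.
- by rewrite mulrBr ElE EE subrr.
- by rewrite mulrBl lEE EE subrr.
- by rewrite addrC subrK.
- by move=> E0; left; rewrite -rE E0 raddf0.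
move/eqP; rewrite subr_eq0 => /eqP E1; right.
by move: lE; rewrite -rE -E1 -[X in X = _]addr0 => /addrI.
Qed.

(** For a lift Y of y the elements l - xY and l - Yx reduce to 0, so that 1 - (l - xY) and
1 - (l - Yx), which act on l as xY and Yx, are invertible by geometric. *)
Lemma unit_lift l x (y : galg k gT) : l * l = l -> in_corner l x ->
    red l * y * red l = y -> red x * y = red l -> y * red x = red l ->
  invertible_in_corner l x.
Proof.
move=> ll xC yC xy yx; split=> //.
have [c xE] := xC; have lx : l * x = x by rewrite xE !mulrA ll.
have xl : x * l = x by rewrite xE -!mulrA ll.
have [Y0 rY] := lift_any y; have [Y YE] : {Y | Y = l * Y0 * l} by exists (l * Y0 * l).
have rY' : red Y = y by rewrite YE !rmorphM /= rY.
have lY : l * Y = Y by rewrite YE !mulrA ll.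
have Yl : Y * l = Y by rewrite YE -!mulrA ll.
have [|w [ww _]] := @geometric (l - x * Y).
  by rewrite rmorphB rmorphM /= rY' xy subrr.
have [|w' [_ ww']] := @geometric (l - Y * x).
  by rewrite rmorphB rmorphM /= rY' yx subrr.
have lA : l * (1 - (l - x * Y)) = x * Y.
  by rewrite mulrBr mulr1 mulrBr ll (mulrA l) lx subKr.
have Al : (1 - (l - Y * x)) * l = Y * x.
  by rewrite mulrBl mul1r mulrBl ll -(mulrA Y) xl subKr.
have R : x * (Y * w * l) = l by rewrite !mulrA -lA -(mulrA l) ww mulr1 ll.
have L : (l * w' * Y) * x = l.
  by rewrite -[l * w' * Y * x]mulrA -Al -mulrA (mulrA w') ww' mul1r ll.
have E : l * w' * Y = Y * w * l.
  have -> : l * w' * Y = l * w' * Y * l by rewrite -[RHS]mulrA Yl.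
  rewrite -[X in _ * X]R (mulrA _ x) L !mulrA lY //.
exists (Y * w * l); split=> //; last by rewrite -E.
by exists (Y * w); rewrite mulrA lY.
Qed.

End Reduction.

(** * Stable bases of the corner of an idempotent *)

Section Families.
Variables (R : comNzRingType) (gT : finGroupType).
Implicit Types (a : galg R gT) (x F G : gT -> galg R gT) (g h u v : gT).

Definition family_mx x : 'M[R]_#|gT| :=
  \matrix_(i, j) gcoef (x (enum_val i)) (enum_val j).

Lemma big_enum_val_all (V : nmodType) (F : gT -> V) :
  \sum_g F g = \sum_(i < #|gT|) F (enum_val i).
Proof. by rewrite (reindex _ (onW_bij _ (enum_val_bij gT))). Qed.

Lemma gcoef_comb x (c : gT -> R) h :
  gcoef (\sum_g c g *: x g) h =
  ((\row_i c (enum_val i)) *m family_mx x) 0 (enum_rank h).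
Proof.
rewrite gcoef_sum big_enum_val_all mxE; apply: eq_bigr => i _.
by rewrite gcoefZ !mxE enum_rankK.
Qed.

Lemma family_free x (s : R) (c : gT -> R) : \det (family_mx x) * s = 1 ->
  \sum_g c g *: x g = 0 -> forall g, c g = 0.
Proof.
move=> ds E g; pose r : 'rV[R]_#|gT| := \row_i c (enum_val i).
have rM : r *m family_mx x = 0.
  apply/rowP=> j; rewrite -[j]enum_valK -gcoef_comb E gcoef0 mxE //.
have := congr1 (fun B : 'rV[R]_#|gT| => (B *m \adj (family_mx x)) 0 (enum_rank g)) rM.
rewrite -mulmxA mul_mx_adj mul_mx_scalar mul0mx !mxE enum_rankK => Z.
by rewrite -[c g]mul1r -ds mulrAC Z mul0r.
Qed.

Lemma family_span x (s : R) a : \det (family_mx x) * s = 1 ->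
  exists c : gT -> R, a = \sum_g c g *: x g.
Proof.
move=> ds; pose r : 'rV[R]_#|gT| := \row_j gcoef a (enum_val j).
pose v := r *m \adj (family_mx x).
exists (fun g => s * v 0 (enum_rank g)); apply/galgP=> h; rewrite gcoef_comb.
have -> : \row_i (s * v 0 (enum_rank (enum_val i))) = s *: v.
  by apply/rowP=> j; rewrite !mxE enum_valK.
rewrite -scalemxAl -mulmxA mul_adj_mx mul_mx_scalar !mxE enum_rankK.
by rewrite mulrA (mulrC s) ds mul1r.
Qed.

(** Multilinearity of the determinant in its rows. *)
Lemma det_family_split F G :
  \sum_(S : {set gT}) \det (family_mx (fun g => if g \in S then F g else G g)) =
  \det (family_mx (fun g => F g + G g)).
Proof.
rewrite /determinant exchange_big /=; apply: eq_bigr => s _; rewrite -mulr_sumr.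
congr (_ * _).
pose F' i := family_mx F i (s i); pose G' i := family_mx G i (s i).
rewrite [RHS](eq_bigr (fun i => F' i + G' i)) => [|i _]; last by rewrite /F' /G' !mxE gcoefD.
rewrite bigA_distr.
have bij : bijective (fun S : {set gT} => [set i : 'I_#|gT| | enum_val i \in S]).
  exists (fun J : {set 'I_#|gT|} => [set g | enum_rank g \in J]) => A; apply/setP=> t.
    by rewrite !inE enum_rankK.
  by rewrite !inE enum_valK.
rewrite [RHS](reindex _ (onW_bij _ bij)) /=; apply: eq_big => [S|S _]; first by rewrite /=.
apply: eq_bigr => i _; rewrite inE /F' /G' !mxE; by case: ifP.
Qed.

Lemma det_family_id : \det (family_mx (@gelt R gT)) = 1.
Proof.
rewrite (_ : family_mx _ = 1%:M) ?det1 //; apply/matrixP=> i j.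
by rewrite !mxE gcoef_gelt (inj_eq enum_val_inj) eq_sym.
Qed.

Lemma det_family_perm x (y : gT -> galg R gT) (s : {perm gT}) :
  (forall g h, gcoef (y (s g)) (s h) = gcoef (x g) h) ->
  \det (family_mx y) = \det (family_mx x).
Proof.
move=> xy; pose f (i : 'I_#|gT|) := enum_rank (s (enum_val i)).
have f_inj : injective f by move=> i j /enum_rank_inj/perm_inj/enum_val_inj.
pose t := perm f_inj.
have -> : family_mx x = row_perm t (col_perm t (family_mx y)).
  by apply/matrixP=> i j; rewrite !mxE !permE !enum_rankK xy.
rewrite row_permE col_permE !det_mulmx !det_perm odd_permV mulrCA.
by rewrite -expr2 sqrr_sign mulr1.
Qed.

(** A right action of G x G whose D x D-orbits are the double cosets of D. *)
Definition bact (g : gT) (w : gT * gT) : gT := (w.1^-1 * g * w.2)%g.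

Fact bact1 g : bact g 1%g = g.
Proof. by rewrite /bact invg1 mul1g mulg1. Qed.

Fact bactM g : act_morph bact g.
Proof. by move=> w w'; rewrite /bact /= invMg !mulgA. Qed.

Definition bact_action := TotalAction bact1 bactM.

(** The members with g in S lie in the corner of a, the others are annihilated by
x |-> axa; so if the family is a basis, the former are a basis of the corner. *)
Definition cut_family a (S : {set gT}) g : galg R gT :=
  if g \in S then a * gelt R g * a else gelt R g - a * gelt R g * a.

Lemma sum_det_cut a : \sum_(S : {set gT}) \det (family_mx (cut_family a S)) = 1.
Proof.
rewrite (det_family_split (fun g => a * gelt R g * a) (fun g => gelt R g - a * gelt R g * a)).
rewrite -det_family_id; congr (\det _); apply/matrixP=> i j.
by rewrite !mxE addrC subrK.
Qed.

Lemma translate_cut (D : {group gT}) a (S S' : {set gT}) u v g : fixed_by D a ->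
    u \in D -> v \in D -> ((u * g * v^-1)%g \in S') = (g \in S) ->
  gelt R u * cut_family a S g * gelt R v^-1%g = cut_family a S' (u * g * v^-1)%g.
Proof.
move=> fa uD vD SS; rewrite /cut_family SS -!geltM.
have cu : gelt R u * a = a * gelt R u by apply/gconj_id_comm/fa.
have cv : gelt R v^-1%g * a = a * gelt R v^-1%g by apply/gconj_id_comm/fa; rewrite groupV.
have E : gelt R u * (a * gelt R g * a) * gelt R v^-1%g =
         a * (gelt R u * gelt R g * gelt R v^-1%g) * a.
  by rewrite -!mulrA -cv !mulrA cu.
by case: ifP => _; rewrite // mulrBr mulrBl E.
Qed.

End Families.

Section StableSubset.
Variables (k : fieldType) (gT : finGroupType) (p : nat).
Hypothesis pk : p \in [pchar k].
Variables (D : {group gT}) (l : galg k gT).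
Hypotheses (pD : (p.-group D)%g) (fl : fixed_by D l).
Implicit Types (g h u v : gT) (S : {set gT}).

(** The determinants of all the cut families add up to 1 and are constant on the
orbits of the p-group D x D, so a D x D-stable S has a nonzero determinant. *)
Lemma stable_cut : exists S : {set gT},
  (forall u v h, u \in D -> v \in D -> ((u * h * v^-1)%g \in S) = (h \in S)) /\
  \det (family_mx (cut_family l S)) != 0.
Proof.
pose P := setX_group D D; pose to := (bact_action gT)^*%act.
have pP : (p.-group P)%g by rewrite /pgroup cardsX pnatM; apply/andP.
have inv S w : w \in P -> \det (family_mx (cut_family l (to S w))) = \det (family_mx (cut_family l S)).
  case: w => u v; rewrite inE /= => /andP[uD vD].
  pose s := perm (act_inj (bact_action gT) (u, v)).
  apply: (det_family_perm (s := s)) => g h; rewrite !permE /= /bact /=.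
  have -> : cut_family l (to S (u, v)) (u^-1 * g * v)%g =
      gelt k u^-1%g * cut_family l S g * gelt k v^-1^-1%g.
    rewrite -[in LHS](invgK v); apply/esym; apply: (translate_cut fl); rewrite ?groupV // invgK.
    by apply/imsetP/idP => [[g' g'S /(act_inj (bact_action gT) (u, v))->//]|gS]; exists g.
  rewrite gcoef_mul_gelt gcoef_gelt_mul; congr (gcoef _ _).
  by rewrite !invgK -!mulgA mulKVg mulgV mulg1.
have S1 := sum_det_cut l.
rewrite (sum_over_fixpoints (to := to) pk pP) in S1; last by move=> S w wP; apply: inv.
have [/existsP[S /andP[/afixP fS nz]] | /existsPn no] :=
  boolP [exists S, (S \in 'Fix_to(P)) && (\det (family_mx (cut_family l S)) != 0)].
  exists S; split=> // u v h uD vD.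
  have wP : (u^-1, v^-1)%g \in P by rewrite inE /= !groupV uD vD.
  rewrite -{1}(fS _ wP); apply/imsetP/idP => [[g gS E] | hS].
    suff -> : h = g by [].
    by apply: (act_inj (bact_action gT) (u^-1, v^-1)%g); rewrite -E /= /bact /= invgK.
  by exists h; rewrite //= /bact /= invgK.
case/eqP: (oner_neq0 k); rewrite -S1 big1 // => S fS; apply/eqP.
by have := no S; rewrite fS /= negbK.
Qed.

(** The form lam dual to the member lgl of the basis is invariant under the pairs
(c_g(v), v) with v in Q.  Expand lam (lgl) = 1 over the support of l^(g^-1) l, translated by
g: the terms outside C(Q) cancel modulo p, so some coefficient in C(Q) is nonzero. *)
Lemma cut_local S g (Q : {group gT}) :
    (forall u v h, u \in D -> v \in D -> ((u * h * v^-1)%g \in S) = (h \in S)) ->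
    \det (family_mx (cut_family l S)) != 0 -> g \in S -> Q :=: (D :&: D :^ g)%g ->
  br Q (gconj g^-1%g l) * br Q l != 0.
Proof.
move=> SS nz gS QE; pose M := family_mx (cut_family l S).
have Mu : M \in unitmx by rewrite unitmxE unitfE.
have sQD : Q \subset D by rewrite QE subsetIl.
have sQgD v : v \in Q -> (v ^ g^-1)%g \in D.
  by rewrite QE => /setIP[_]; rewrite mem_conjg.
pose lam a := (grow a *m invmx M) 0 (enum_rank g).
have lamD a b : lam (a + b) = lam a + lam b by rewrite /lam linearD mulmxDl mxE.
have lamZ (r : k) a : lam (r *: a) = r * lam a by rewrite /lam linearZ -scalemxAl mxE.
have lam_sum (I : finType) (F : I -> galg k gT) : lam (\sum_i F i) = \sum_i lam (F i).
  by apply: (big_morph lam lamD); have := lamZ 0 0; rewrite scale0r mul0r.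
have lam_cut h : lam (cut_family l S h) = (h == g)%:R.
  have -> : cut_family l S h = \sum_g' (g' == h)%:R *: cut_family l S g'.
    rewrite (bigD1 h) //= eqxx scale1r big1 ?addr0 // => g' /negPf->.
    by rewrite scale0r.
  rewrite /lam; set c := fun g' => _.
  have -> : grow (\sum_g' (g' == h)%:R *: cut_family l S g') =
      (\row_i (enum_val i == h)%:R) *m M.
    apply/rowP=> j; rewrite mxE (gcoef_comb _ (fun g' => (g' == h)%:R)).
    by rewrite enum_valK.
  by rewrite mulmxK // mxE enum_rankK eq_sym.
have lam_inv v a : v \in Q -> lam (gelt k (v ^ g^-1)%g * a * gelt k v^-1%g) = lam a.
  move=> vQ; have vD := subsetP sQD _ vQ; have vgD := sQgD _ vQ.
  have [|c ->] := @family_span k gT (cut_family l S) (\det M)^-1 a; first by rewrite divff.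
  rewrite mulr_sumr mulr_suml !lam_sum; apply: eq_bigr => h _.
  rewrite -scalerAr -scalerAl !lamZ; congr (_ * _).
  rewrite (translate_cut fl vgD vD (SS _ _ h vgD vD)) ?lam_cut.
  congr ((nat_of_bool _)%:R); apply/eqP/eqP => [E | ->].
    apply: (mulgI (v ^ g^-1)%g); apply: (mulIg v^-1%g); rewrite E.
    by rewrite conjgE invgK !mulgA !mulgKV mulgK.
  by rewrite conjgE invgK !mulgA !mulgKV mulgK.
apply/eqP=> Z.
have pQ := pgroupS sQD pD; have flQ := fixed_byS sQD fl.
have fgl : fixed_by Q (gconj g^-1%g l).
  apply: fixed_byS (fixed_by_gconj (g := g^-1%g) fl).
  by rewrite /= invgK QE subsetIr.
rewrite -(brM pk) // in Z.
pose y := l * gelt k g * l.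
have yE h : gcoef y (g * h)%g = gcoef (gconj g^-1%g l * l) h.
  have -> : y = gelt k g * (gconj g^-1%g l * l) by rewrite /gconj invgK !mulrA gelt_mulV mul1r.
  by rewrite gcoef_gelt_mul mulKg.
have lamy : lam y = 1 by have := lam_cut g; rewrite /cut_family gS eqxx.
have : lam y = \sum_h gcoef (gconj g^-1%g l * l) h * lam (gelt k (g * h)%g).
  rewrite [y in LHS]galg_expand lam_sum (reindex_inj (mulgI g)) /=.
  by apply: eq_bigr => h _; rewrite lamZ yE.
rewrite lamy (sum_over_fixpoints (to := conjg_action gT) pk pQ) /=.
  rewrite big1 => [/eqP|h]; first by rewrite oner_eq0.
  rewrite afixJ => hC; have := congr1 (fun a => gcoef a h) Z.
  by rewrite gcoef_br hC gcoef0 => ->; rewrite mul0r.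
move=> h u uQ; congr (_ * _).
  by apply: (proj1 (fixed_byP _ _)) uQ; apply: (subalgM (fixed_subalg _ Q)).
rewrite -(lam_inv _ _ uQ) !geltM; congr (lam (gelt _ _)).
by rewrite !conjgE invgK -!mulgA !mulKg mulKVg mulgV mulg1.
Qed.

End StableSubset.

Section UnitalBasis.
Variables (p : nat) (O : comNzRingType) (k : fieldType) (res : {rmorphism O -> k}).
Hypothesis hO : complete_local_base p res.
Variables (gT : finGroupType) (D : {group gT}) (l : galg O gT).
Hypotheses (pD : (p.-group D)%g) (fl : fixed_by D l) (ll : l * l = l).
Implicit Types (g h u v r : gT).

Local Notation red := (@red O k res gT).

Hypothesis hunit : forall g (Q : {group gT}), Q :=: (D :&: D :^ g)%g ->
  br Q (gconj g^-1%g (red l)) * br Q (red l) != 0 ->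
  exists a a', [/\ in_corner l a, in_corner l a', a * a' = l, a' * a = l &
    forall v, v \in Q -> gelt O (v ^ g^-1)%g * a = a * gelt O v].

Let lC c : in_corner l c -> l * c = c /\ c * l = c.
Proof. by case=> d ->; rewrite -!mulrA ll !mulrA ll. Qed.

Let comm_l u : u \in D -> gelt O u * l = l * gelt O u.
Proof. by move=> uD; apply/gconj_id_comm/fl. Qed.

(** Choose units at representatives r of the double cosets of D and put
a (u r v^-1) = u a_r v^-1.  This is well defined since a_r commutes with the stabiliser of
r, in the sense of the last condition on it. *)
Lemma equivariant_units (S : {set gT}) :
    (forall u v h, u \in D -> v \in D -> ((u * h * v^-1)%g \in S) = (h \in S)) ->
    (forall g (Q : {group gT}), g \in S -> Q :=: (D :&: D :^ g)%g ->
       br Q (gconj g^-1%g (red l)) * br Q (red l) != 0) ->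
  exists a a' : gT -> galg O gT,
    (forall g, g \in S ->
       [/\ in_corner l (a g), in_corner l (a' g), a g * a' g = l & a' g * a g = l]) /\
    (forall g u v, g \in S -> u \in D -> v \in D ->
       gelt O u * a g * gelt O v^-1%g = a (u * g * v^-1)%g).
Proof.
move=> SS Sloc.
have ex0 r : exists q : galg O gT * galg O gT, r \in S ->
    [/\ in_corner l q.1, in_corner l q.2, q.1 * q.2 = l, q.2 * q.1 = l &
     forall v, v \in (D :&: D :^ r)%g -> gelt O (v ^ r^-1)%g * q.1 = q.1 * gelt O v].
  have [rS|_] := boolP (r \in S); last by exists (0, 0).
  have QE : (D :&: D :^ r)%G :=: (D :&: D :^ r)%g by [].
  have [a [a' [H1 H2 H3 H4 H5]]] := hunit QE (Sloc r _ rS QE).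
  by exists (a, a').
have [a0 a0P] := fin_all_exists ex0.
pose P := setX_group D D; pose orb g := orbit (bact_action gT) P g.
pose rep g := repr (orb g).
have repP g : exists w : gT * gT, [/\ w.1 \in D, w.2 \in D & g = (w.1 * rep g * w.2^-1)%g].
  have : rep g \in orb g by apply: (mem_repr g); apply: orbit_refl.
  move=> /orbitP[[u v]]; rewrite inE /= => /andP[uD vD] E; exists (u, v); split=> //=.
  by rewrite -E /bact /= !mulgA mulgV mul1g mulgK.
have [w wP] := fin_all_exists repP.
have repS g : (rep g \in S) = (g \in S).
  by have [w1 w2 E] := wP g; rewrite [in RHS]E SS.
have repT u v g : u \in D -> v \in D -> rep (u * g * v^-1)%g = rep g.
  move=> uD vD; congr repr; apply/esym/orbit_eqP/orbitP; exists (u, v).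
    by rewrite inE /= uD vD.
  by rewrite /= /bact /= !mulgA mulVg mul1g mulgKV.
exists (fun g => gelt O (w g).1 * (a0 (rep g)).1 * gelt O (w g).2^-1%g),
       (fun g => gelt O (w g).2 * (a0 (rep g)).2 * gelt O (w g).1^-1%g); split.
  move=> g gS; have [w1 w2 _] := wP g.
  have [|c1 c2 e1 e2 _] := a0P (rep g); first by rewrite repS.
  have [la al] := lC c1; have [la' a'l] := lC c2.
  split.
  - exists (gelt O (w g).1 * (a0 (rep g)).1 * gelt O (w g).2^-1%g).
    rewrite !mulrA -comm_l // -!mulrA comm_l ?groupV // !mulrA.
    by rewrite -[_ * l * (a0 _).1]mulrA la -[_ * (a0 _).1 * l]mulrA al.
  - exists (gelt O (w g).2 * (a0 (rep g)).2 * gelt O (w g).1^-1%g).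
    rewrite !mulrA -comm_l // -!mulrA comm_l ?groupV // !mulrA.
    by rewrite -[_ * l * (a0 _).2]mulrA la' -[_ * (a0 _).2 * l]mulrA a'l.
  - rewrite !mulrA -(mulrA _ (gelt O _^-1%g)) gelt_Vmul mulr1.
    by rewrite -(mulrA (gelt O _)) e1 comm_l // -mulrA gelt_mulV mulr1.
  rewrite !mulrA -(mulrA _ (gelt O _^-1%g)) gelt_Vmul mulr1.
  by rewrite -(mulrA (gelt O _)) e2 comm_l // -mulrA gelt_mulV mulr1.
move=> g u v gS uD vD; rewrite repT //.
have [w1 w2 gE] := wP g; have := wP (u * g * v^-1)%g; rewrite repT //.
set r := rep g in gE *; set w' := w (u * g * v^-1)%g => -[w1' w2' E'].
have [|_ _ _ _ inv] := a0P r; first by rewrite repS.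
have [s sE] : {s | s = (w'.1^-1 * u * (w g).1)%g} by exists (w'.1^-1 * u * (w g).1)%g.
have [t tE] : {t | t = (w'.2^-1 * v * (w g).2)%g} by exists (w'.2^-1 * v * (w g).2)%g.
have sD : s \in D by rewrite sE !groupM ?groupV.
have tD : t \in D by rewrite tE !groupM ?groupV.
have srt : (r * t * r^-1 = s)%g.
  have E : (u * ((w g).1 * r * (w g).2^-1) * v^-1 = w'.1 * r * w'.2^-1)%g.
    by rewrite -gE -E'.
  have {}E : (s * r = r * t)%g.
    rewrite sE tE; apply: (mulgI w'.1); apply: (mulIg ((w g).2^-1 * v^-1)%g).
    move: E; rewrite !mulgA mulgV mul1g => ->.
    by rewrite !mulgK.
  by rewrite -E mulgK.
have := inv t; rewrite inE tD mem_conjg conjgE invgK mulgA srt sD => /(_ isT) sa.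
have uE : (u * (w g).1 = w'.1 * s)%g by rewrite sE !mulgA mulgV mul1g.
have vE : ((w g).2^-1 * v^-1 = t^-1 * w'.2^-1)%g.
  by rewrite tE !invMg invgK !mulgA mulgK.
rewrite !mulrA geltM -[_ * gelt O (w g).2^-1%g * _]mulrA geltM uE vE -!geltM.
rewrite -(mulrA (gelt O w'.1)) sa !mulrA -(mulrA _ (gelt O t)) gelt_mulV mulr1 //.
Qed.

(** Take x g = lgl + t a_g for g in S.  Its reduction is a_g (t - z_g), where z_g is minus
the product of a_g^-1 and lgl, so it is invertible unless t is a root of a polynomial f_g
annihilating z_g.  The determinant of the new family is a polynomial in t which
does not vanish at 0.  As k is infinite, some t avoids all these roots. *)
Theorem stable_unital_basis : has_stable_unital_basis D l.
Proof.
have pk := clb_char hO; have closed := clb_closed hO.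
pose lb := red l; have flb : fixed_by D lb := red_fixed res fl.
have llb : lb * lb = lb by rewrite -rmorphM ll.
have [S [SS nz]] := stable_cut pk pD flb.
have [|a [a' [aP aT]]] := equivariant_units SS.
  by move=> g Q gS QE; apply: (cut_local pk pD flb SS nz gS QE).
pose A := family_mx (fun g => if g \in S then red (a g) else 0).
pose P1 := \det (map_mx polyC (family_mx (cut_family lb S)) + 'X *: map_mx polyC A).
have P1E (t : k) : P1.[t] =
    \det (family_mx (fun g => cut_family lb S g + t *: (if g \in S then red (a g) else 0))).
  rewrite -horner_evalE -det_map_mx; congr (\det _); apply/matrixP=> i j.
  rewrite !mxE /= horner_evalE hornerD hornerM hornerX !hornerC gcoefD gcoefZ.
  by [].
have P10 : P1 != 0.
  apply: contraNneq nz => E; have := P1E 0; rewrite E horner0 => H.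
  apply/eqP; rewrite [RHS]H; congr (\det _); apply/matrixP=> i j; rewrite !mxE.
  by rewrite scale0r addr0.
pose z g := - (red (a' g) * (lb * gelt k g * lb)).
have ann g : exists f : {poly k}, f != 0 /\ horner_alg (z g) f = 0.
  by have [f f0 fz] := exists_annihilator (z g); exists f.
have [f fP] := fin_all_exists ann.
have q0 : P1 * \prod_g f g != 0.
  by rewrite mulf_neq0 //; apply/prodf_neq0 => g _; case: (fP g).
have [t] := PreClosedField.closed_nonrootP closed _ q0.
rewrite rootM negb_or => /andP[P1t ft].
have {}ft g : ~~ root (f g) t.
  by apply: contra ft => fg; rewrite (bigD1 g) //= rootM fg.
have [tau tauE] := clb_surj hO t.
pose x g := if g \in S then l * gelt O g * l + tau *: a g else gelt O g - l * gelt O g * l.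
have redx g : red (x g) = cut_family lb S g + t *: (if g \in S then red (a g) else 0).
  rewrite /x /cut_family; case: ifP => _.
    by rewrite rmorphD !rmorphM /= red_gelt redZ tauE.
  by rewrite rmorphB !rmorphM /= red_gelt scaler0 addr0.
have [s ds] : exists s, \det (family_mx x) * s = 1.
  apply: (@res_unit p O k res gT hO); rewrite -det_map_mx; apply: contraNneq P1t => E.
  rewrite /root P1E -E; apply/eqP; congr (\det _); apply/matrixP=> i j.
  by rewrite !mxE -redx gcoef_red.
have xC g : g \in S -> in_corner l (x g).
  move=> gS; have [aC _ _ _] := aP g gS; have [la al] := lC aC.
  exists (gelt O g + tau *: a g); rewrite /x gS mulrDr mulrDl; congr (_ + _).
  by rewrite -scalerAr -scalerAl la al.
have xU g : g \in S -> invertible_in_corner l (x g).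
  move=> gS; have [aC aC' e1 e2] := aP g gS.
  have [[la al] [la' a'l]] := (lC aC, lC aC').
  pose al_ := red (a g); pose be := red (a' g).
  have ab : al_ * be = lb by rewrite -rmorphM e1.
  have ba : be * al_ = lb by rewrite -rmorphM e2.
  have all_ : al_ * lb = al_ by rewrite -rmorphM al.
  have lbe : lb * be = be by rewrite -rmorphM la'.
  have bel : be * lb = be by rewrite -rmorphM a'l.
  have lz : lb * z g = z g by rewrite /z mulrN !mulrA lbe.
  have zl : z g * lb = z g by rewrite /z mulNr -!mulrA llb.
  have [_ fz] := fP g.
  have [q qE] : exists q, f g - (f g).[t]%:P = q * ('X - t%:P).
    by apply/factor_theorem; rewrite /root hornerD hornerN hornerC subrr.
  pose c := (f g).[t]; have c0 : c != 0 by apply: ft.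
  pose T := t *: 1 - z g.
  pose W := c^-1 *: horner_alg (z g) q.
  have key : horner_alg (z g) q * T = c *: 1.
    have := congr1 (horner_alg (z g)) qE.
    rewrite rmorphB rmorphM rmorphB /= fz !horner_algC horner_algX sub0r => E.
    by rewrite /T -opprB mulrN -E opprK.
  have Tq : T * horner_alg (z g) q = horner_alg (z g) q * T.
    rewrite /T mulrBl mulrBr -scalerAl mul1r -scalerAr mulr1; congr (_ - _).
    by rewrite -{1 4}(horner_algX (z g)) -!rmorphM mulrC.
  have WT : W * T = 1 by rewrite /W -scalerAl key scalerA mulVf // scale1r.
  have TW : T * W = 1 by rewrite /W -scalerAr Tq key scalerA mulVf // scale1r.
  have lT : lb * T = T * lb.
    by rewrite /T mulrBl mulrBr lz zl -scalerAl -scalerAr mul1r mulr1.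
  have rx : red (x g) = al_ * T.
    rewrite redx /cut_family gS /T mulrBr -scalerAr mulr1 addrC; congr (_ + _).
    by rewrite /z -/be mulrN opprK [RHS]mulrA ab !mulrA llb.
  apply: (unit_lift hO ll (xC g gS) (y := lb * W * be)).
  - by rewrite !mulrA llb -mulrA bel.
  - by rewrite rx !mulrA -(mulrA al_) -lT mulrA all_ -(mulrA al_) TW mulr1 ab.
  rewrite rx !mulrA -(mulrA _ be) ba -!mulrA lT !mulrA -(mulrA lb W) WT mulr1 llb //.
have xT g u v : g \in S -> u \in D -> v \in D ->
    gelt O u * x g * gelt O v^-1%g = x (u * g * v^-1)%g.
  move=> gS uD vD; have gS' : (u * g * v^-1)%g \in S by rewrite SS.
  have := translate_cut fl uD vD (SS u v g uD vD).
  rewrite /cut_family /x gS gS' => E.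
  by rewrite mulrDr mulrDl E -scalerAr -scalerAl aT.
exists #|S|, [tuple x (enum_val i) | i < #|S|]; split.
- split=> [i | c E i | b [d bE]].
  + by rewrite tnth_mktuple; apply: xC; apply: enum_valP.
  + pose c' g := \sum_(i < #|S|) c i * (enum_val i == g)%:R.
    have c'E j : c' (enum_val j) = c j.
      rewrite /c' (bigD1 j) //= eqxx mulr1 big1 ?addr0 // => i' i'j.
      by rewrite (inj_eq enum_val_inj) (negPf i'j) mulr0.
    rewrite -c'E; apply: (family_free ds); rewrite -[RHS]E.
    transitivity (\sum_g \sum_(i < #|S|) (c i * (enum_val i == g)%:R) *: x g).
      by apply: eq_bigr => g _; rewrite scaler_suml.
    rewrite exchange_big /=; apply: eq_bigr => j _; rewrite tnth_mktuple.
    rewrite (bigD1 (enum_val j)) //= eqxx mulr1 big1 ?addr0 // => g gj.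
    by rewrite eq_sym (negPf gj) mulr0 scale0r.
  have [c cE] := family_span b ds; exists (fun i => c (enum_val i)).
  have -> : b = l * b * l by rewrite bE !mulrA ll -!mulrA ll.
  rewrite {1}cE mulr_sumr mulr_suml (bigID (mem S)) /= [X in _ + X]big1 ?addr0.
    rewrite big_enum_val /=; apply: eq_bigr => i _; rewrite tnth_mktuple.
    have [lx xl] := lC (xC _ (enum_valP i)).
    by rewrite -scalerAr -scalerAl lx xl.
  move=> g /negPf gS; rewrite /x gS -scalerAr -scalerAl mulrBr mulrBl !mulrA ll.
  by rewrite -(mulrA _ l l) ll subrr scaler0.
- by move=> i; rewrite tnth_mktuple; apply: xU; apply: enum_valP.
move=> u v _ uD vD /tnthP[i ->]; rewrite tnth_mktuple.
have gS := enum_valP i; rewrite xT //.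
have gS' : (u * enum_val i * v^-1)%g \in S by rewrite SS.
apply/tnthP; exists (enum_rank_in gS' (u * enum_val i * v^-1)%g).
by rewrite tnth_mktuple enum_rankK_in.
Qed.

End UnitalBasis.

(** * Fusion maps extending to D *)

Section Corollary.
Variables (p : nat) (O : comNzRingType) (k : fieldType) (res : {rmorphism O -> k}).
Hypothesis hO : complete_local_base p res.
Variable gT : finGroupType.
Variables (b : galg O gT) (D : {group gT}) (l : galg O gT) (e : {group gT} -> galg k gT).
Hypothesis hb : is_block [set: gT]%G b.
Hypothesis hD : is_defect_group b D.
Hypothesis hDp : (p.-group D)%g.
Hypothesis hl : is_source_idempotent res b D l.
Hypothesis he : is_block_choice res D l e.
Implicit Types (g h u v : gT) (Q R : {group gT}).

Local Notation red := (@red O k res gT).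
Let pk : p \in [pchar k] := clb_char hO.

Let fl : fixed_by D l. Proof. by case: hl => [[[_ ?]]]. Qed.
Let ll : l * l = l. Proof. by case: hl => [[]]. Qed.
Let brl : br D (red l) != 0. Proof. by rewrite -brauer_red; case: hl. Qed.
Let rl0 : red l != 0. Proof. by apply: contraNneq brl => ->; rewrite linear0. Qed.

Let bl : b * l = l.
Proof.
have [[[[c lE] _] _ _ _] _] := hl; have [[_ cb] bb _ _] := proj1 (blockP _ _) hb.
by rewrite lE (comm_of_fixed cb (@in_subalgT _ _ _)) -mulrA bb.
Qed.

Lemma reduced_source : source_pairs p D (red l) e.
Proof.
split=> //; last by move=> Q sQD; rewrite -brauer_red; apply: he.
have lP : primitive_idempotent_in (fixed_by D) l.
  have [[[[c lE] _] _ l0 prim] _] := hl; split=> // e1 e2 f1 f2 i1 i2 o12 o21 E.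
  apply: prim => //; split=> //.
    by exists (e1 * c); rewrite -mulrA -lE E mulrDr i1 o12 addr0.
  by exists (e2 * c); rewrite -mulrA -lE E mulrDr i2 o21 add0r.
apply: primitive_eq (red_primitive hO lP rl0) => a.
by split=> [fa | []]; [split=> //; apply: in_subalg_C1 |].
Qed.

Lemma reduced_block : primitive_idempotent_in (sfix 'C(1)%G [set: gT]%G) (red b).
Proof.
have bP : primitive_idempotent_in (fixed_by [set: gT]%G) b.
  apply: primitive_eq (proj1 (blockP _ _) hb) => a.
  by split=> [[]|fa] //; split=> //; apply: in_subalgT.
apply: primitive_eq (red_primitive hO bP _) => [a|].
  by split=> [fa | []]; [split=> //; apply: in_subalg_C1 |].
by apply: contraNneq rl0 => E; rewrite -bl rmorphM /= E mul0r.
Qed.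

Let src := reduced_source.

Lemma reduced_bl : red b * red l = red l.
Proof. by rewrite -rmorphM bl. Qed.

Lemma reduced_trace : exists2 c, fixed_by D c & red b = rel_trace D [set: gT]%G c.
Proof.
have [[a [fa ->]] _] := hD; exists (red a); first exact: red_fixed.
exact: red_rel_trace.
Qed.

(** The condition that cut_local puts on g makes the block e Q and the conjugate by g^-1
of the block of the g-conjugate of Q meet the image of l together, so they are equal and
c_g is a fusion map.  Let h extend it, and let X, Y be as in source_conjugate, with XY = l
and YX the h-conjugate of l.  A lift of X which is fixed by D, multiplied by h and cut
down to the corner of l, is the required unit. *)
Theorem basis_of_extension :
    (forall Q g, Q \subset D -> (Q :^ g^-1)%G \subset D ->
       gconj g (e Q) = e (Q :^ g^-1)%G ->
     exists2 h, h \in pair_stab D (e D) & forall u, u \in Q -> (u ^ h^-1 = u ^ g^-1)%g) ->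
  has_stable_unital_basis D l.
Proof.
move=> ext; apply: (stable_unital_basis hO hDp fl ll) => g Q QE nz.
have sQD : Q \subset D by rewrite QE subsetIl.
have sgD : (Q :^ g^-1)%G \subset D by rewrite /= sub_conjgV QE subsetIr.
have [eB ge0] := sp_block src sQD; have [egB _] := sp_block src sgD.
have ge : gconj g (e Q) = e (Q :^ g^-1)%G.
  have gegB : is_block 'C(Q)%G (gconj g^-1%g (e (Q :^ g^-1)%G)).
    have := block_gconj g^-1%g egB; congr (is_block _ _).
    by apply/val_inj; rewrite /= invgK conjsgKV.
  rewrite -[RHS](gconjKV g); congr (gconj g _); apply: (block_eq eB gegB).
  have brg : br Q (gconj g^-1%g (red l)) = gconj g^-1%g (br (Q :^ g^-1)%G (red l)).
    rewrite -br_gconj; congr (br _ _); apply/val_inj; by rewrite /= invgK conjsgKV.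
  apply: contraNneq nz => E.
  have [[_ cg] _ _ _] := proj1 (blockP _ _) gegB.
  rewrite brg -(br_block pk src sgD) rmorphM /= -(br_block pk src sQD).
  have [[se _] _] := block_idem src sQD.
  rewrite (_ : _ * _ * _ = gconj g^-1%g (br (Q :^ g^-1)%G (red l)) *
    ((e Q * gconj g^-1%g (e (Q :^ g^-1)%G)) * br Q (red l))); first by rewrite E mul0r mulr0.
  rewrite -(comm_of_fixed cg se) -!mulrA; congr (_ * (_ * _)).
  by have [[_ ce] _] := block_idem src sQD; rewrite (comm_of_fixed ce (@br_in _ _ _ _)).
have [h hH hg] := ext Q g sQD sgD ge.
have [c fc cE] := reduced_trace; have [hN _] := pair_stabP _ _ _ hH.
have [X [Y [fX fY XY YX]]] :=
  source_conjugate pk src reduced_block reduced_bl fc cE hH.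
have [X0 fX0 rX] := lift_fixed hO fX.
pose a := l * (X0 * gelt O h) * l; pose lb := red l.
have lblb : lb * lb = lb by rewrite -rmorphM ll.
have XhL : X * gconj h lb = lb * X by rewrite -YX mulrA XY.
pose u := X * gelt k h; pose w := gelt k h^-1%g * Y.
have hlh : gelt k h * lb = gconj h lb * gelt k h by apply: gelt_gconj.
have ulb : u * lb = lb * u by rewrite -mulrA hlh mulrA XhL mulrA.
have uw : u * w = lb by rewrite /u /w mulrA -(mulrA X) gelt_mulV mulr1.
have wu : w * u = lb.
  by rewrite /w /u mulrA -(mulrA _ Y X) YX -/lb -mulrA -hlh mulrA gelt_Vmul mul1r.
have ra : red a = lb * u * lb by rewrite /a !rmorphM /= rX red_gelt.
have [aC [a' [a'C aa' a'a]]] : invertible_in_corner l a.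
  have aC : in_corner l a by exists (X0 * gelt O h).
  clearbody u w; apply: (unit_lift hO ll (y := lb * w * lb)) => //.
  - by rewrite -/lb !mulrA lblb -mulrA lblb.
  - rewrite -/lb ra -ulb -!mulrA !(mulrA lb lb) !lblb !(mulrA lb lb) !lblb.
    by rewrite (mulrA u) ulb -(mulrA lb) (mulrA u) uw !lblb.
  rewrite -/lb ra -!mulrA ulb !(mulrA lb lb) !lblb !(mulrA lb lb) !lblb.
  by rewrite -ulb (mulrA w) wu !lblb.
exists a, a'; split=> // v vQ; rewrite -hg //.
have vD := subsetP sQD _ vQ.
have vhD : (v ^ h^-1)%g \in D by rewrite memJ_norm // groupV.
have vl : gelt O v * l = l * gelt O v by apply/gconj_id_comm/fl.
have hl' : gelt O (v ^ h^-1)%g * l = l * gelt O (v ^ h^-1)%g by apply/gconj_id_comm/fl.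
have hX : gelt O (v ^ h^-1)%g * X0 = X0 * gelt O (v ^ h^-1)%g by apply/gconj_id_comm/fX0.
have hv : gelt O (v ^ h^-1)%g * gelt O h = gelt O h * gelt O v.
  by rewrite !geltM conjgE invgK !mulgA mulgKV.
by rewrite /a !mulrA hl' -(mulrA l) hX -!mulrA (mulrA (gelt O _) (gelt O h)) hv -!mulrA vl.
Qed.

(** For R = D the extensions in the definition of the normaliser category are
morphisms D -> D, and D can only be mapped onto itself. *)
Lemma fusion_hom_D phi Q Q1 : Q \subset D -> Q1 \subset D ->
  fusion_hom D e (D <*> Q)%G (D <*> Q1)%G phi ->
  exists2 h, h \in pair_stab D (e D) & {in D, phi =1 (fun u => u ^ h^-1)%g}.
Proof.
move=> sQD sQ1D; have -> : (D <*> Q)%G = D by apply/val_inj; rewrite /= (joing_idPl sQD).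
have -> : (D <*> Q1)%G = D by apply/val_inj; rewrite /= (joing_idPl sQ1D).
move=> /and3P[_ _ /existsP[h /and3P[sh /eqP eh /forall_inP ph]]].
have Dh : (D :^ h^-1)%G = D by apply/val_inj/eqP; rewrite /= eqEcard sh cardJg leqnn.
exists h => [|u uD]; last exact/eqP/ph.
apply/pair_stabP; split; last by rewrite eh Dh.
by rewrite -groupV; apply/normP; apply: (congr1 (@gval gT) Dh).
Qed.

Lemma conj_fusion_hom Q g : Q \subset D -> (Q :^ g^-1)%G \subset D ->
  gconj g (e Q) = e (Q :^ g^-1)%G -> fusion_hom D e Q (Q :^ g^-1)%G (fun u => u ^ g^-1)%g.
Proof.
move=> sQD sgD ge; rewrite /fusion_hom sQD sgD; apply/existsP; exists g.
by rewrite subxx ge eqxx; apply/forall_inP.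
Qed.

Lemma controlled_basis :
  cat_eq (fusion_cat D e) (normalizer_cat D (fusion_cat D e) D) ->
  has_stable_unital_basis D l.
Proof.
move=> [_ homE]; apply: basis_of_extension => Q g sQD sgD ge.
have /(homE _ _ _ sQD sgD) := conj_fusion_hom sQD sgD ge.
case=> _ _ _ [phi' [hom' phiE _]]; have [h hH phiD] := fusion_hom_D sQD sgD hom'.
by exists h => // u uQ; rewrite -phiD ?phiE // (subsetP sQD).
Qed.

Lemma inner_pair_stab d : d \in D -> d \in pair_stab D (e D).
Proof.
move=> dD; apply/pair_stabP; split; first exact: (subsetP (normG D)).
by have [[se _] _] := block_idem src (subxx D); apply: in_cent_fixed se _ dD.
Qed.

(** By fusion_mod there is d in D such that c_g and c_d agree modulo Dt on Q.  So the graph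
of the map induced by d^-1 g lies in the fibre product, the map extends to D by
hypothesis, and composing with c_d extends c_g. *)
Lemma hyperfocal_basis (Dt : {group gT}) : (Dt <| D)%g -> hyperfocal D e p \subset Dt ->
    cat_eq (fibre_fusion_cat D e Dt) (normalizer_cat D (fibre_fusion_cat D e Dt) D) ->
  has_stable_unital_basis D l.
Proof.
move=> nDt hyp [_ homE]; apply: basis_of_extension => Q g sQD sgD ge.
have [c fc cE] := reduced_trace.
have [d dD gd] := fusion_mod pk (clb_closed hO) src nDt hyp reduced_block reduced_bl fc cE sQD sgD ge.
have sDN : D \subset 'N(Dt)%g := normal_norm nDt.
have ND v : v \in D -> v \in 'N(Dt)%g by apply: (subsetP sDN).
pose g' := (d^-1 * g)%g.
have g'E (A : {set gT}) : (A :^ g'^-1 = (A :^ g^-1) :^ d)%g by rewrite /g' invMg invgK conjsgM.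
have g'u u : (u ^ g'^-1 = (u ^ g^-1) ^ d)%g by rewrite /g' invMg invgK conjgM.
have sg'D : (Q :^ g'^-1)%G \subset D by rewrite /= g'E -(conjGid dD) conjSg.
have g'e : gconj g' (e Q) = e (Q :^ g'^-1)%G.
  rewrite gconjM ge (block_conjD pk src) ?groupV //; congr e.
  by apply/val_inj; rewrite /= g'E invgK.
have hom' := conj_fusion_hom sQD sg'D g'e.
have graph : graph_of Q (fun u => u ^ g'^-1)%g \subset fibre_product D Dt.
  apply/subsetP=> w /imsetP[u uQ ->]; have uD := subsetP sQD _ uQ.
  have ug'D : (u ^ g'^-1)%g \in D by apply: (subsetP sg'D); rewrite /= memJ_conjg.
  have ugD : (u ^ g^-1)%g \in D by apply: (subsetP sgD); rewrite /= memJ_conjg.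
  rewrite inE /= inE /= ug'D uD /=; rewrite -!norm_rlcoset ?ND //.
  have cJ v : v \in D -> coset Dt (v ^ d)%g = (coset Dt v ^ coset Dt d)%g.
    by move=> vD; exact: (morphJ (coset_morphism Dt) (ND _ vD) (ND _ dD)).
  apply/eqP/rcoset_eqP/rcoset_kercosetP; rewrite ?ND //.
  by rewrite g'u cJ // gd // -cJ ?groupJ ?groupV // conjgKV.
have /(homE _ _ _ sQD sg'D) : cat_hom (fibre_fusion_cat D e Dt) Q (Q :^ g'^-1)%G
    (fun u => u ^ g'^-1)%g by [].
case=> _ _ _ [phi' [[hom2 _] phiE _]]; have [h hH phiD] := fusion_hom_D sQD sg'D hom2.
exists (d * h)%g; first by apply: groupM => //; apply: inner_pair_stab.
move=> u uQ; rewrite invMg conjgM -phiD ?(subsetP sQD) // phiE // g'u.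
by rewrite conjgK.
Qed.

Lemma nilpotent_basis : is_nilpotent_fusion D e p -> has_stable_unital_basis D l.
Proof.
move=> hyp1; apply: basis_of_extension => Q g sQD sgD ge.
have [c fc cE] := reduced_trace.
have hyp : hyperfocal D e p \subset 1%G by rewrite hyp1.
have [d dD gd] := fusion_mod pk (clb_closed hO) src (normal1 D) hyp reduced_block reduced_bl fc cE sQD sgD ge.
exists d; first exact: inner_pair_stab.
move=> u uQ; have N1 (v : gT) : v \in 'N(1%G)%g by rewrite norm1 inE.
have /esym/(rcoset_kercosetP (N1 _) (N1 _)) := gd u uQ.
by rewrite mul1g => /set1P.
Qed.

End Corollary.

End StableBases.

Theorem corollary1p5 (p : nat) (O : comNzRingType) (k : fieldType)
    (res : {rmorphism O -> k}) (hO : complete_local_base p res)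
    (gT : finGroupType) (hG : p %| #|[set: gT]|)
    (b : galg O gT) (hb : is_block [set: gT]%G b)
    (D : {group gT}) (hD : is_defect_group b D) (hDp : (p.-group D)%g)
    (l : galg O gT) (hl : is_source_idempotent res b D l)
    (e : {group gT} -> galg k gT) (he : is_block_choice res D l e) :
  [/\ (exists Dt : {group gT},
         [/\ (Dt <| D)%g, hyperfocal D e p \subset Dt &
             cat_eq (fibre_fusion_cat D e Dt)
                    (normalizer_cat D (fibre_fusion_cat D e Dt) D)]) ->
        has_stable_unital_basis D l,
      cat_eq (fusion_cat D e) (normalizer_cat D (fusion_cat D e) D) ->
        has_stable_unital_basis D l
    & is_nilpotent_fusion D e p ->
        has_stable_unital_basis D l].
Proof.
split.
- move=> [Dt [nDt hyp eqC]].
  exact: (StableBases.hyperfocal_basis hO hb hD hDp hl he nDt hyp eqC).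
- exact: (StableBases.controlled_basis hO hb hD hDp hl he).
- exact: (StableBases.nilpotent_basis hO hb hD hDp hl he).
Qed.
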